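(* The generating function $H(z)=\sum_{n\ge 2}|\mathcal H_n|\,z^{n-1}$ of the tree-decorated hierarchical triangulations $\mathcal H_n$ is $$H(z)=\frac{1-\sqrt{1-12z}}{3}=2z+6z^2+36z^3+\cdots .$$ Explicitly, for $n\ge2$, the enumeration and its large-$n$ asymptotics are given by $$|\mathcal H_n|=2\cdot 3^{n-2}\operatorname{Cat}(n-2)\ \stackrel{n\to\infty}{\sim}\ \frac{1}{72\sqrt{\pi}}\,\frac{12^n}{n^{3/2}}.$$
   Context: $\operatorname{Cat}(n)=\frac1{n+1}\binom{2n}{n}$. A planar map is a connected multigraph (loops and multiple edges allowed) drawn without crossings on the 2-sphere, up to orientation-preserving homeomorphism; it is rooted if it has a distinguished oriented edge. A planar triangulation is a planar map in which all faces have degree 3. A planar triangulation is hierarchical if it can be obtained from the unique loopless planar triangulation with two triangles by repeatedly selecting an edge, opening it into a 2-gon, and inserting in the 2-gon a pair of triangles glued to each other along two of their sides (i.e. a new vertex joined to the two endpoints of the edge). $\mathcal H_n$ is the set of rooted hierarchical triangulations with $n+1$ vertices with a distinguished spanning tree that contains the root edge and contains no edge belonging to a cycle of length 2. *)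

(* Defs.v *)
From mathcomp Require Import all_boot all_algebra.
From mathcomp Require Import boolp classical_sets.

Set Implicit Arguments.
Unset Strict Implicit.
Unset Printing Implicit Defensive.

(* Maps on closed oriented surfaces are encoded as combinatorial maps.  A dart
   is an oriented edge; [edge] reverses its orientation; [node] sends it to the
   next dart in counterclockwise order around its origin.  Thus the vertices,
   edges and faces of the map are the orbits of [node], [edge] and [face]
   (defined below), and a combinatorial map is the same datum as a map up to
   orientation-preserving homeomorphism.  (The map with one vertex and no edge
   has no dart and is not represented.) *)
Record cmap := CMap {
  dart :> finType;
  edge : dart -> dart;
  node : dart -> dart;
  edgeK : involutive edge;
  edge_neq : forall x, edge x != x;
  node_inj : injective node }.

Section CombinatorialMap.

Variable M : cmap.
Implicit Types (x y : M) (c : seq M) (T : {set M}).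

(* The orbit of [x] under [face] is the contour of the face to its right. *)
Definition face x : M := node (edge x).

Definition connected : Prop :=
  forall x y, connect [rel u v | (v == node u) || (v == edge u)] x y.

Definition nb_vertices : nat := fcard (@node M) M.
Definition nb_edges : nat := fcard (@edge M) M.
Definition nb_faces : nat := fcard face M.

(* Genus 0, by Euler's formula. *)
Definition planar_map : Prop :=
  connected /\ nb_vertices + nb_faces = nb_edges + 2.

Definition planar_triangulation : Prop :=
  planar_map /\ forall x, order face x = 3.

Definition same_vertex x y : bool := fconnect (@node M) x y.

Definition loopless : Prop := forall x, ~~ same_vertex x (edge x).

(* [c] lists the oriented edges of a cycle of the underlying multigraph: its
   vertices are pairwise distinct, and so are its (unoriented) edges.  The
   length of the cycle is [size c]; a loop is a cycle of length 1. *)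
Definition graph_cycle c : Prop :=
  [/\ c != [::],
      cycle (fun x y => same_vertex (edge x) y) c,
      uniq [seq froot (@node M) x | x <- c]
    & uniq [seq froot (@edge M) x | x <- c]].

Definition in_2cycle x : Prop :=
  exists c, [/\ graph_cycle c, size c = 2 & (x \in c) || (edge x \in c)].

(* A set of edges is given by a set of darts stable under [edge]. *)
Definition edge_set T : Prop := forall x, (edge x \in T) = (x \in T).

Definition acyclic T : Prop := forall c, {subset c <= T} -> ~ graph_cycle c.

Definition spanning_tree T : Prop :=
  [/\ edge_set T,
      forall x y,
        connect [rel u v | (v == node u) || (u \in T) && (v == edge u)] x y
    & acyclic T].

End CombinatorialMap.

Definition cmap_morphism (M N : cmap) (f : M -> N) : Prop :=
  (forall x, f (edge x) = edge (f x)) /\ (forall x, f (node x) = node (f x)).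

Definition cmap_iso (M N : cmap) : Prop :=
  exists f : M -> N, bijective f /\ cmap_morphism f.

(* Opening the edge {d, edge d} into a 2-gon and inserting a new vertex v joined
   to the two ends of that edge.  The two ends are indexed by [bool], end b being
   the origin of [edge_end d b].  Each end b contributes three new darts:
   - [twin b], issued from end b; the opened edge becomes the two parallel edges
     {edge_end d b, twin (~~ b)}, for b = false, true;
   - [spoke b], issued from end b towards v, and its opposite [hub b], issued
     from v.
   Counterclockwise around end b, the dart [edge_end d b] is now followed by
   [spoke b] and then [twin b].  The two new faces are the triangles
   twin (~~ b) -> spoke b -> hub (~~ b). *)
Section OpenEdge.

Variables (M : cmap) (d : M).

Definition open_dart : finType := (M + (bool + (bool + bool)))%type.

Definition old (x : M) : open_dart := inl x.
Definition twin (b : bool) : open_dart := inr (inl b).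
Definition spoke (b : bool) : open_dart := inr (inr (inl b)).
Definition hub (b : bool) : open_dart := inr (inr (inr b)).

Definition edge_end (b : bool) : M := if b then edge d else d.

Definition open_edge_fun (u : open_dart) : open_dart :=
  match u with
  | inl x => if x == edge_end false then twin true
             else if x == edge_end true then twin false
             else old (edge x)
  | inr (inl b) => old (edge_end (~~ b))
  | inr (inr (inl b)) => hub b
  | inr (inr (inr b)) => spoke b
  end.

Definition open_node_fun (u : open_dart) : open_dart :=
  match u with
  | inl x => if x == edge_end false then spoke false
             else if x == edge_end true then spoke true
             else old (node x)
  | inr (inl b) => old (node (edge_end b))
  | inr (inr (inl b)) => twin b
  | inr (inr (inr b)) => hub (~~ b)
  end.

Lemma edge_endC b : edge (edge_end b) = edge_end (~~ b).
Proof. by case: b => //=; rewrite edgeK. Qed.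

Lemma open_edgeE b : open_edge_fun (old (edge_end b)) = twin (~~ b).
Proof. by case: b; rewrite /= ?(negbTE (edge_neq d)) eqxx. Qed.

Lemma open_nodeE b : open_node_fun (old (edge_end b)) = spoke b.
Proof. by case: b; rewrite /= ?(negbTE (edge_neq d)) eqxx. Qed.

Variant open_old_spec : M -> Prop :=
| OpenEnd b : open_old_spec (edge_end b)
| OpenOld x of (forall b, x != edge_end b) : open_old_spec x.

Lemma open_oldP x : open_old_spec x.
Proof.
have [->|n0] := eqVneq x (edge_end false); first exact: OpenEnd.
have [->|n1] := eqVneq x (edge_end true); first exact: OpenEnd.
by apply: OpenOld; case.
Qed.

Lemma open_edge_old x : (forall b, x != edge_end b) ->
  open_edge_fun (old x) = old (edge x).
Proof.
by move=> nx; rewrite /= (negbTE (nx false)) (negbTE (nx true)).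
Qed.

Lemma open_node_old x : (forall b, x != edge_end b) ->
  open_node_fun (old x) = old (node x).
Proof.
by move=> nx; rewrite /= (negbTE (nx false)) (negbTE (nx true)).
Qed.

Lemma open_edgeK : involutive open_edge_fun.
Proof.
case=> [x|[b|[b|b]]] //; last by rewrite [X in open_edge_fun X]/= open_edgeE negbK.
case: (open_oldP x) => [b|{}x nx]; first by rewrite open_edgeE /= negbK.
rewrite open_edge_old // open_edge_old // ?edgeK // => b.
by rewrite -(inj_eq (inv_inj (@edgeK M))) edgeK edge_endC nx.
Qed.

Lemma open_edge_neq u : open_edge_fun u != u.
Proof.
case: u => [x|[b|[b|b]]] //; case: (open_oldP x) => [b|{}x nx].
  by rewrite open_edgeE.
by rewrite open_edge_old // (inj_eq inl_inj) edge_neq.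
Qed.

Lemma open_node_inj : injective open_node_fun.
Proof.
pose g (u : open_dart) : open_dart :=
  match u with
  | inl y => let x := finv (@node M) y in
             if x == edge_end false then twin false
             else if x == edge_end true then twin true
             else old x
  | inr (inl b) => spoke b
  | inr (inr (inl b)) => old (edge_end b)
  | inr (inr (inr b)) => hub (~~ b)
  end.
apply: (can_inj (g := g)); case=> [x|[b|[b|b]]] //.
- case: (open_oldP x) => [b|{}x nx]; first by rewrite open_nodeE.
  rewrite open_node_old // /g /= finv_f; last exact: node_inj.
  by rewrite (negbTE (nx false)) (negbTE (nx true)).
- rewrite /= finv_f; last exact: node_inj.
  by case: b; rewrite /= ?(negbTE (edge_neq d)) eqxx.
- by rewrite /= negbK.
Qed.

Definition open_edge : cmap := CMap open_edgeK open_edge_neq open_node_inj.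

End OpenEdge.

(* The base case is the loopless planar triangulation with two triangles, which
   is unique up to isomorphism. *)
Inductive obtained_by_openings : cmap -> Prop :=
| ObtainedBase M of planar_triangulation M & loopless M & nb_faces M = 2 :
    obtained_by_openings M
| ObtainedOpen (M : cmap) (d : M) of obtained_by_openings M :
    obtained_by_openings (open_edge d)
| ObtainedIso M N of obtained_by_openings M & cmap_iso M N :
    obtained_by_openings N.

Definition hierarchical_triangulation (M : cmap) : Prop :=
  planar_triangulation M /\ obtained_by_openings M.

(* A map with a root (distinguished oriented edge) and a set of edges. *)
Record decorated_map := DecoratedMap {
  dmap : cmap;
  droot : dmap;
  dtree : {set dmap} }.

Definition decorated_iso (X Y : decorated_map) : Prop :=
  exists f : dmap X -> dmap Y,
    [/\ bijective f, cmap_morphism f, f (droot X) = droot Y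
      & forall x, (f x \in dtree Y) = (x \in dtree X)].

Definition tree_decorated_hierarchical (n : nat) (X : decorated_map) : Prop :=
  [/\ hierarchical_triangulation (dmap X),
      nb_vertices (dmap X) = n.+1,
      spanning_tree (dtree X),
      droot X \in dtree X
    & forall x, x \in dtree X -> ~ in_2cycle x].

(* [tree_decorated_hierarchical n] has exactly [k] isomorphism classes:
   [X : 'I_k -> decorated_map] is a complete irredundant system of
   representatives.  (Isomorphism classes cannot be collected in a
   [set (set decorated_map)], as [decorated_map] is too large for the universe
   of [set].) *)
Definition Hset_has_card (n k : nat) : Prop :=
  exists X : 'I_k -> decorated_map,
    [/\ forall i, tree_decorated_hierarchical n (X i),
        forall i j, decorated_iso (X i) (X j) -> i = j
      & forall Y, tree_decorated_hierarchical n Y ->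
          exists i, decorated_iso (X i) Y].

(* The unique such k, and 0 by convention if there were infinitely many
   classes. *)
Definition cardH (n : nat) : nat := xget 0 [set k | Hset_has_card n k]%classic.

Definition Cat (R : fieldType) (n : nat) : R :=
  ('C(n.*2, n)%:R / n.+1%:R)%R.

(* Main.v *)
(* A hierarchical triangulation with a distinguished oriented edge is read as a
   ternary tree.  A net is a triangulated 2-gon between two vertices: either a
   single edge ([Leaf]), or an edge followed on its right by a pair of triangles
   glued along two sides, each of which is itself thickened into a net, and then
   by a further net with the same ends ([Node]).  A rooted hierarchical
   triangulation is a net whose two boundary edges are glued; opening an edge
   replaces the corresponding subtree [t] by [Node Leaf Leaf t].  A set of edges
   is a labelling of the tree by booleans, and it is a spanning tree avoiding
   the 2-cycles iff only isolated leaves are labelled and the labels satisfy a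
   local rule at each node, according to whether each subnet joins its ends.
   The generating functions C and D of the nets that join, or do not join,
   their ends satisfy D = 1 + H D and C = 1 + z C^2 D + H (C - 1), where
   H = 2 z C D counts the decorated triangulations, whence 2 H = 4 z + 3 H^2.
   Thus S = 1 - 3 H satisfies S^2 = 1 - 12 z, hence (1 - 12 z) S' = - 6 S, which
   gives the coefficients. *)
From HB Require Import structures.
Require Import Defs.
From mathcomp Require Import all_boot zify.

Set Implicit Arguments.
Unset Strict Implicit.
Unset Printing Implicit Defensive.

(** * Nets *)

(** A hierarchical triangulation comes without a root and any of its edges may be opened, so the
    tree must be readable from every dart: the invariant [stacked] asserts this, and reading from a
    new dart amounts to cutting the sphere along the opened edge. Rather than building a map from a
    tree, the proof checks a tree against a map: [is_net t x] walks through the map from [x]. Two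
    counts make this reading faithful. A presented map has [6 * nodes t] darts, so each dart is met
    exactly once, and [nodes t + 2] vertices, so each node brings a vertex not met before; the
    latter makes the tree unique, because the third vertex of a triangle tells where the chains on
    its sides stop. The local rule for spanning trees is also reached by counting: linking every
    inserted vertex to an end costs one label per node, plus one if the ends are joined, and a
    connected edge set with as few edges as a tree must attain this bound everywhere. Power series
    are handled as polynomials modulo ['X^N]; their sum comes from the same quadratic equation with
    an explicit error term. *)

Inductive net :=
| Leaf of bool
| Node of bool & net & net & net.

Fixpoint nodes (t : net) : nat :=
  if t is Node _ l r s then (nodes l + nodes r + nodes s).+1 else 0.

(** An equation to rewrite with; it also allows faces of degree 1, which [st_face] excludes where
    exact degrees matter. *)
Definition triangular (M : cmap) : Prop :=
  forall x : M, face (face (face x)) = x.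

Section Net.

Variable M : cmap.
Implicit Types (x y z : M) (t : net).

(* If [x] goes from u to v and the face on its right is the triangle u v w, then
   [lside x] goes from u to w and [rside x] from w to v.  A net starts at its
   leftmost edge [x]; [nend t x] is its rightmost edge, with the same ends. *)
Definition lside x : M := edge (face (face x)).
Definition rside x : M := edge (face x).

Fixpoint nend t x : M :=
  if t is Node _ l r s then nend s (edge (face (nend r (rside x)))) else x.

(** The edge parallel to [x] on the far side of the second triangle. It is reached along the right
    side; that the left side ends at the same triangle is checked by [is_net]. *)
Definition snext r x : M := edge (face (nend r (rside x))).

Fixpoint is_net t x : bool :=
  if t is Node _ l r s then
    [&& is_net l (lside x), is_net r (rside x),
        face (nend l (lside x)) == nend r (rside x) & is_net s (snext r x)]
  else true.

Lemma net_Node b l r s x : is_net (Node b l r s) x =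
  [&& is_net l (lside x), is_net r (rside x),
      face (nend l (lside x)) == nend r (rside x) & is_net s (snext r x)].
Proof. by []. Qed.

Lemma nend_Node b l r s x : nend (Node b l r s) x = nend s (snext r x).
Proof. by []. Qed.

Fixpoint pos t x : seq M :=
  x :: (if t is Node _ l r s then
          pos l (lside x) ++ pos r (rside x) ++ pos s (snext r x)
        else [::]).

(** In a closed net the first and last edges coincide, so the last position is dropped to list each
    edge once. *)
Fixpoint posl t x : seq M :=
  if t is Node _ l r s then
    x :: pos l (lside x) ++ pos r (rside x) ++ posl s (snext r x)
  else [::].

Lemma pos_rcons t x : pos t x = rcons (posl t x) (nend t x).
Proof.
by elim: t x => [b|b l _ r _ s IHs] x //=; rewrite IHs -!cats1 -!catA.
Qed.

Lemma pos_head t x : pos t x = x :: behead (pos t x).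
Proof. by case: t. Qed.

Lemma mem_pos_head t x : x \in pos t x.
Proof. by rewrite pos_head inE eqxx. Qed.

Lemma mem_pos_nend t x : nend t x \in pos t x.
Proof. by rewrite pos_rcons mem_rcons inE eqxx. Qed.

Lemma size_pos t x : size (pos t x) = (3 * nodes t).+1.
Proof.
elim: t x => [b|b l IHl r IHr s IHs] x //=.
by rewrite !size_cat IHl IHr IHs; lia.
Qed.

Lemma size_posl t x : size (posl t x) = 3 * nodes t.
Proof. by have := size_pos t x; rewrite pos_rcons size_rcons => -[]. Qed.

Lemma node_face x : node x = face (edge x).
Proof. by rewrite /face edgeK. Qed.

Lemma edge_inj : injective (@edge M).
Proof. exact: inv_inj (@edgeK M). Qed.

Lemma face_inj : injective (@face M).
Proof. by move=> x y /node_inj/edge_inj. Qed.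

Lemma connected_ind (P : pred M) d : connected M ->
  (forall x, P x -> P (edge x)) -> (forall x, P x -> P (node x)) ->
  P d -> forall x, P x.
Proof.
move=> cM Pe Pn Pd x; have /connectP[p] := cM d x.
elim: p d Pd => [|y p IHp] d Pd /= => [_ -> //|].
by case/andP=> /orP[]/eqP-> pth; apply: IHp => //; [apply: Pn | apply: Pe].
Qed.

Section Closed.

Hypothesis tri : triangular M.

Definition darts t x : seq M := posl t x ++ map (@edge M) (posl t x).

(** Both triangles of each node have all their sides in the net, so one can leave it only through
    the right of its last edge or the left of its first edge. *)
Lemma net_faces t x (E := pos t x ++ map (@edge M) (pos t x)) : is_net t x ->
  (forall z, z \in pos t x -> z = nend t x \/ face z \in E) /\
  (forall z, z \in behead (pos t x) -> face (edge z) \in E).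
Proof.
have eE t' x' (E' := pos t' x' ++ map (@edge M) (pos t' x')) z :
    z \in pos t' x' -> edge z \in E'.
  by move=> zp; rewrite mem_cat map_f ?orbT.
have mEl t' x' (E' := pos t' x' ++ map (@edge M) (pos t' x')) z :
    z \in pos t' x' -> z \in E'.
  by move=> zp; rewrite mem_cat zp.
rewrite {}/E; elim: t x => [b|b l IHl r IHr s IHs] x.
  by split=> z //; rewrite inE => /eqP->; left.
rewrite [is_net _ _]/= => /and4P[/IHl[lr ll] /IHr[rr rl] /eqP fl /IHs[sr sl]].
set p := pos (Node b l r s) x; set E := p ++ map (@edge M) p.
have subp q : {subset q <= p} -> {subset q ++ map (@edge M) q <= E}.
  move=> qp z; rewrite mem_cat => /orP[/qp|/mapP[u /qp up ->]].
    exact: mEl.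
  exact: eE.
have sublp : {subset pos l (lside x) <= p}.
  by move=> z; rewrite inE !mem_cat => ->; rewrite orbT.
have subrp : {subset pos r (rside x) <= p}.
  by move=> z; rewrite inE !mem_cat => ->; rewrite !orbT.
have subsp : {subset pos s (snext r x) <= p}.
  by move=> z; rewrite inE !mem_cat => ->; rewrite !orbT.
have fx : face x \in E.
  by rewrite -[face x]edgeK; apply: eE; apply/subrp/mem_pos_head.
have fr : face (nend r (rside x)) \in E.
  by rewrite -[face _]edgeK; apply: eE; apply/subsp/mem_pos_head.
have pE : {subset p <= E} by apply: mEl.
have lE := subp _ sublp; have rE := subp _ subrp; have sE := subp _ subsp.
have eEp z : z \in p -> edge z \in E by apply: eE.
have sub_nend t' x' : {subset pos t' x' <= p} -> nend t' x' \in E.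
  by move=> h; apply/pE/h/mem_pos_nend.
clearbody E; split=> z.
  rewrite inE !mem_cat => /or4P[/eqP->|/lr[->|/lE]|/rr[->|/rE]|
    /sr[->|/sE]]; try by [left|right|move=> ?; right].
  by right; rewrite fl; exact: sub_nend.
have h t' x' : face (edge x') \in E ->
    (forall z, z \in behead (pos t' x') -> face (edge z) \in E) ->
    z \in pos t' x' -> face (edge z) \in E.
  by move=> Px Pb; rewrite pos_head inE => /orP[/eqP->|/Pb].
rewrite /= !mem_cat => /or3P[]; apply: h; try move=> u.
- by rewrite edgeK tri; apply/pE/mem_pos_head.
- by move/ll/lE.
- by rewrite edgeK; rewrite -[face _]edgeK; apply/eEp/sublp/mem_pos_head.
- by move/rl/rE.
- by rewrite edgeK -fl tri; exact: sub_nend.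
- by move/sl/sE.
Qed.

(** Gluing the first edge to the last removes the two exceptions of [net_faces]: the right of the
    last edge is the first triangle, and the left of the first edge is the left of the last one. *)
Lemma darts_stable t d : 0 < nodes t -> is_net t d -> nend t d = d ->
  d \in darts t d /\ forall x, x \in darts t d ->
    edge x \in darts t d /\ node x \in darts t d.
Proof.
move=> t0 tN td; have [rE lE] := net_faces tN.
have din : d \in posl t d by case: (t) t0 => //= *; rewrite inE eqxx.
have Edarts : pos t d ++ map (@edge M) (pos t d) =i darts t d.
  have e : pos t d =i posl t d.
    by move=> z; rewrite pos_rcons mem_rcons inE td; case: eqVneq => // ->.
  by move=> z; rewrite !mem_cat e; congr orb; apply: eq_mem_map.
have dpos z : z \in pos t d -> z \in behead (pos t d).
  rewrite [in X in X -> _]pos_head inE => /orP[/eqP->|//].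
  by rewrite -[X in X \in _]td; case: (t) t0 => //= *; rewrite !mem_cat mem_pos_nend !orbT.
have fd : face d \in darts t d.
  rewrite -Edarts mem_cat; case: (t) t0 => // b l r s _; apply/orP; right.
  by apply/mapP; exists (rside d); rewrite ?edgeK // !(inE, mem_cat) mem_pos_head !orbT.
split=> [|x]; first by rewrite mem_cat din.
rewrite node_face -!Edarts => xE; split.
  move: xE; rewrite !mem_cat; case/orP => [xp|/mapP[y yp ->]]; last by rewrite edgeK yp.
  by rewrite map_f ?orbT.
move: xE; rewrite mem_cat => /orP[/dpos/lE //|/mapP[y yp ->]].
by rewrite edgeK; have [->|//] := rE y yp; rewrite td Edarts.
Qed.

Lemma closed_cover t d : connected M -> 0 < nodes t -> is_net t d ->
  nend t d = d -> forall x, x \in darts t d.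
Proof.
move=> cM t0 tN td; have [din dst] := darts_stable t0 tN td.
by apply: (connected_ind cM _ _ din) => x /dst[].
Qed.

(** A list of [#|M|] darts that meets all of them has no repetition. *)
Lemma closed_uniq t d : connected M -> #|M| = 6 * nodes t -> is_net t d ->
  nend t d = d -> uniq (darts t d).
Proof.
move=> cM sM tN td; have t0 : 0 < nodes t.
  rewrite lt0n; apply: contraTneq (isT : true) => t0.
  by have /card0_eq/(_ d) : #|M| = 0 by rewrite sM t0.
apply: (leq_size_uniq (enum_uniq M)) => [z _|]; first exact: closed_cover.
by rewrite size_cat size_map size_posl -cardE sM -mulnDl.
Qed.

End Closed.
End Net.

Lemma mapfst_functional (A B : eqType) (E : seq (A * B)) x y y' :
  uniq (map fst E) -> (x, y) \in E -> (x, y') \in E -> y = y'.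
Proof.
elim: E => //= -[a b] E IHE /= /andP[aE uE]; rewrite !inE.
have nE u v : (u, v) \in E -> u != a.
  by move=> uv; apply: contraNneq aE => <-; apply: map_f uv.
rewrite !xpair_eqE => /orP[/andP[/eqP xa /eqP->]|xE] /orP[/andP[/eqP xa' /eqP->]|xE'] //.
- by have := nE _ _ xE'; rewrite xa eqxx.
- by have := nE _ _ xE; rewrite xa' eqxx.
- exact: IHE.
Qed.

(** * Nets under morphisms of maps *)

Section Morphism.

Variables (M N : cmap) (f : M -> N).
Hypothesis fM : cmap_morphism f.

Lemma morph_face x : face (f x) = f (face x).
Proof. by case: fM => fe fn; rewrite /face -fe -fn. Qed.

Lemma morph_lside x : lside (f x) = f (lside x).
Proof. by rewrite /lside !morph_face -fM.1. Qed.

Lemma morph_rside x : rside (f x) = f (rside x).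
Proof. by rewrite /rside morph_face -fM.1. Qed.

Lemma morph_nend t x : nend t (f x) = f (nend t x).
Proof.
elim: t x => [b|b l _ r IHr s IHs] x //=.
by rewrite morph_rside IHr morph_face -fM.1 IHs.
Qed.

Lemma morph_snext r x : snext r (f x) = f (snext r x).
Proof. by rewrite /snext morph_rside morph_nend morph_face -fM.1. Qed.

Lemma morph_pos t x : pos t (f x) = map f (pos t x).
Proof.
elim: t x => [b|b l IHl r IHr s IHs] x //=.
by rewrite morph_lside morph_rside morph_snext IHl IHr IHs !map_cat.
Qed.

Lemma morph_posl t x : posl t (f x) = map f (posl t x).
Proof.
elim: t x => [b|b l IHl r IHr s IHs] x //=.
by rewrite morph_lside morph_rside morph_snext !morph_pos IHs !map_cat.
Qed.

Lemma morph_darts t x : darts t (f x) = map f (darts t x).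
Proof.
rewrite /darts morph_posl map_cat -!map_comp; congr (_ ++ _).
by apply: eq_map => y /=; rewrite fM.1.
Qed.

Lemma morph_net t x : is_net t x -> is_net t (f x).
Proof.
elim: t x => [b|b l IHl r IHr s IHs] x //= /and4P[/IHl ln /IHr rn /eqP e /IHs sn].
by rewrite morph_lside morph_rside morph_snext ln rn sn !morph_nend morph_face e eqxx.
Qed.

End Morphism.

Section Product.

Variables M N : cmap.

Definition prod_edge (u : M * N) := (edge u.1, edge u.2).
Definition prod_node (u : M * N) := (node u.1, node u.2).

Lemma prod_edgeK : involutive prod_edge.
Proof. by case=> x y; rewrite /prod_edge /= !edgeK. Qed.

Lemma prod_edge_neq u : prod_edge u != u.
Proof. by case: u => x y; rewrite xpair_eqE negb_and edge_neq. Qed.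

Lemma prod_node_inj : injective prod_node.
Proof. by case=> x y [x' y'] [/node_inj-> /node_inj->]. Qed.

(** Used to build isomorphisms: the darts met by a net read from a pair of roots form the graph of
    the map sending one root to the other. *)
Definition prod_map : cmap := CMap prod_edgeK prod_edge_neq prod_node_inj.

Lemma fst_morphism : cmap_morphism (fst : prod_map -> M).
Proof. by []. Qed.

Lemma snd_morphism : cmap_morphism (snd : prod_map -> N).
Proof. by []. Qed.

Lemma prod_nend t (x : M) (y : N) :
  nend t ((x, y) : prod_map) = (nend t x, nend t y).
Proof.
rewrite [LHS]surjective_pairing; congr (_, _).
  by rewrite -(morph_nend fst_morphism).
by rewrite -(morph_nend snd_morphism).
Qed.

Lemma prod_net t (x : M) (y : N) :
  is_net t x -> is_net t y -> is_net t ((x, y) : prod_map).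
Proof.
elim: t x y => [b|b l IHl r IHr s IHs] x y //; rewrite !net_Node.
move=> /and4P[lx rx /eqP ex sx] /and4P[ly ry /eqP ey sy].
have el : lside ((x, y) : prod_map) = (lside x, lside y) by [].
have er : rside ((x, y) : prod_map) = (rside x, rside y) by [].
have ef u v : face ((u, v) : prod_map) = (face u, face v) by [].
rewrite /snext el er (IHl _ _ lx ly) (IHr _ _ rx ry) !prod_nend ef ex ey eqxx.
by rewrite ef; apply: IHs.
Qed.

Lemma prod_triangular : triangular M -> triangular N -> triangular prod_map.
Proof. by move=> tM tN [x y]; congr (_, _); [apply: tM | apply: tN]. Qed.

End Product.

(** The tree [t], closed at [d], describes the whole map. The dart count yields [pres_uniq] and the
    vertex count yields [pres_fresh]. *)
Record pres (M : cmap) (d : M) (t : net) : Prop := Pres {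
  pres_connected : connected M;
  pres_tri : triangular M;
  pres_card : #|M| = 6 * nodes t;
  pres_nb_vertices : nb_vertices M = nodes t + 2;
  pres_net : is_net t d;
  pres_nend : nend t d = d }.

Lemma pres_nodes_gt0 (M : cmap) (d : M) t : pres d t -> 0 < nodes t.
Proof.
move=> P; rewrite lt0n; apply: contraTneq (isT : true) => t0.
by have /card0_eq/(_ d) : #|M| = 0 by rewrite (pres_card P) t0.
Qed.

Lemma pres_uniq (M : cmap) (d : M) t : pres d t -> uniq (darts t d).
Proof. by case=> cM tM sM _ tN td; apply: closed_uniq. Qed.

Lemma pres_cover (M : cmap) (d : M) t : pres d t -> forall x, x \in darts t d.
Proof.
by move=> P; have t0 := pres_nodes_gt0 P; case: P => cM tM _ _ tN td; apply: closed_cover.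
Qed.

(** Keeps the shape of [t] and overwrites its labels by membership in [T]; thus [lab T t x = t] says
    that the labels of [t] describe [T]. *)
Fixpoint lab (M : cmap) (T : {set M}) t (x : M) : net :=
  match t with
  | Leaf _ => Leaf (x \in T)
  | Node _ l r s => Node (x \in T) (lab T l (lside x)) (lab T r (rside x)) (lab T s (snext r x))
  end.

Lemma lab_eq (M N : cmap) (T : {set M}) (S : {set N}) t (x : M) (y : N) :
  lab T t x = lab S t y ->
  forall u, u \in pos t ((x, y) : prod_map M N) -> (u.1 \in T) = (u.2 \in S).
Proof.
elim: t x y => [b|b l IHl r IHr s IHs] x y /=.
  by case=> e u; rewrite inE => /eqP->.
case=> e /IHl el /IHr er /IHs es u; rewrite inE !mem_cat => /or4P[/eqP->//| | |].
- exact: el.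
- exact: er.
- by rewrite /snext prod_nend; apply: es.
Qed.

(** Reading [t] in the product map gives a set of pairs stable under [edge] and [node]. Each
    projection lists every dart exactly once, so this set is the graph of a bijective morphism. *)
Lemma pres_iso (X Y : decorated_map) t :
  edge_set (dtree X) -> edge_set (dtree Y) ->
  pres (droot X) t -> pres (droot Y) t ->
  lab (dtree X) t (droot X) = lab (dtree Y) t (droot Y) -> decorated_iso X Y.
Proof.
case: X Y => M d T [N c S] /= eT eS PM PN eL.
pose r : prod_map M N := (d, c); pose E := darts t r.
have rn : is_net t r := prod_net (pres_net PM) (pres_net PN).
have [rE Est] : r \in E /\ forall x, x \in E -> edge x \in E /\ node x \in E.
  apply: darts_stable => //; first exact: prod_triangular (pres_tri PM) (pres_tri PN).
    exact: pres_nodes_gt0 PM.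
  by rewrite prod_nend (pres_nend PM) (pres_nend PN).
have E1 : map fst E = darts t d by rewrite -(morph_darts (fst_morphism _ _)).
have E2 : map snd E = darts t c by rewrite -(morph_darts (snd_morphism _ _)).
have u1 : uniq (map fst E) by rewrite E1 pres_uniq.
have u2 : uniq (map fst (map (fun u => (u.2, u.1)) E)).
  by rewrite -map_comp E2 pres_uniq.
have ex1 x : exists y, (x, y) \in E.
  by have := pres_cover PM x; rewrite -E1 => /mapP[[a b] ab ->]; exists b.
have ex2 y : exists x, (x, y) \in E.
  by have := pres_cover PN y; rewrite -E2 => /mapP[[a b] ab ->]; exists a.
pose f x := xchoose (ex1 x); pose g y := xchoose (ex2 y).
have fP x : (x, f x) \in E by apply: (xchooseP (ex1 x)).
have gP y : (g y, y) \in E by apply: (xchooseP (ex2 y)).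
have fE x y : (x, y) \in E -> f x = y by apply: mapfst_functional u1 _.
have gE x y : (x, y) \in E -> g y = x.
  move=> xy; apply: (mapfst_functional u2 (x := y)).
    by apply/mapP; exists (g y, y).
  by apply/mapP; exists (x, y).
exists f; split.
- by exists g => z; [apply: gE | apply: fE].
- by split=> x; apply: fE; have [] := Est _ (fP x).
- exact: fE.
move=> x; have : (x, f x) \in E := fP x.
have posl_pos z : z \in posl t r -> z \in pos t r.
  by rewrite pos_rcons mem_rcons inE => ->; rewrite orbT.
have TS := lab_eq eL.
rewrite mem_cat => /orP[/posl_pos/TS/= -> //|/mapP[[a b] /posl_pos/TS/= ab [-> ->]]].
by rewrite eT eS ab.
Qed.

(** * Vertices of a net *)

Section Vertices.

Variable M : cmap.
Implicit Types (x y z : M) (t l r s : net).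

(** A vertex is represented by the canonical dart of its [node] orbit. *)
Definition org x : M := froot (@node M) x.
Definition tgt x : M := org (edge x).
Definition apex x : M := org (face (face x)).

Lemma same_vertexE x y : same_vertex x y = (org x == org y).
Proof. by rewrite /same_vertex root_connect //; apply: fconnect_sym; apply: node_inj. Qed.

Lemma org_node x : org (node x) = org x.
Proof. by apply/eqP; rewrite -same_vertexE /same_vertex fconnect_sym ?fconnect1 //; apply: node_inj. Qed.

Lemma org_org x : org (org x) = org x.
Proof. by apply: root_root; apply: fconnect_sym; apply: node_inj. Qed.

Lemma org_edge x : org (edge x) = tgt x. Proof. by []. Qed.

Lemma tgt_edge x : tgt (edge x) = org x.
Proof. by rewrite /tgt edgeK. Qed.

Lemma org_face x : org (face x) = tgt x.
Proof. exact: org_node. Qed.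

Fixpoint apices t x : seq M :=
  if t is Node _ l r s then
    apex x :: apices l (lside x) ++ apices r (rside x) ++ apices s (snext r x)
  else [::].

Lemma size_apices t x : size (apices t x) = nodes t.
Proof. by elim: t x => //= b l IHl r IHr s IHs x; rewrite !size_cat IHl IHr IHs addnA. Qed.

Definition hull t x : seq M := org x :: tgt x :: apices t x.

(** The two ends and the vertices inserted at the nodes are pairwise distinct; hence sibling subnets
    share only a common end ([freshP]). *)
Definition fresh t x := uniq (hull t x).

Hypothesis tri : triangular M.

Lemma org_lside x : org (lside x) = org x.
Proof. by rewrite /lside org_edge -org_face tri. Qed.

Lemma tgt_lside x : tgt (lside x) = apex x.
Proof. by rewrite /lside tgt_edge. Qed.

Lemma org_rside x : org (rside x) = apex x.
Proof. by rewrite /rside org_edge -org_face. Qed.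

Lemma tgt_rside x : tgt (rside x) = tgt x.
Proof. by rewrite /rside tgt_edge org_face. Qed.

Lemma net_ends t x : is_net t x ->
  org (nend t x) = org x /\ tgt (nend t x) = tgt x.
Proof.
elim: t x => // b l IHl r IHr s IHs x /and4P[/IHl[ol tl] /IHr[or tr] /eqP e /IHs[os ts]].
rewrite nend_Node os ts /snext org_edge tgt_edge org_face tr tgt_rside; split=> //.
by rewrite -e -org_face tri ol org_lside.
Qed.

Lemma snext_ends b l r s x : is_net (Node b l r s) x ->
  org (snext r x) = org x /\ tgt (snext r x) = tgt x.
Proof.
move=> tN; have [oN eN] := net_ends tN.
have [_ _ _ sN] := and4P tN; have [os ts] := net_ends sN.
by rewrite -os -ts -oN -eN.
Qed.

Lemma apex_lend b l r s x : is_net (Node b l r s) x ->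
  apex (nend l (lside x)) = tgt x.
Proof.
case/and4P=> _ rN /eqP e _; rewrite /apex e org_face.
by rewrite (net_ends rN).2 tgt_rside.
Qed.

Lemma apex_rend b l r s x : is_net (Node b l r s) x ->
  apex (nend r (rside x)) = org x.
Proof. by move=> /snext_ends[<- _]; rewrite /apex org_face. Qed.

Lemma hull_lside l x : hull l (lside x) = org x :: apex x :: apices l (lside x).
Proof. by rewrite /hull org_lside tgt_lside. Qed.

Lemma hull_rside r x : hull r (rside x) = apex x :: tgt x :: apices r (rside x).
Proof. by rewrite /hull org_rside tgt_rside. Qed.

Lemma hull_snext b l r s x : is_net (Node b l r s) x ->
  hull s (snext r x) = org x :: tgt x :: apices s (snext r x).
Proof. by move=> tN; have [os ts] := snext_ends tN; rewrite /hull os ts. Qed.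

Lemma pos_hull t x z : is_net t x -> z \in pos t x ->
  org z \in hull t x /\ tgt z \in hull t x.
Proof.
elim: t x => [b|b l IHl r IHr s IHs] x; first by rewrite !inE => _ /eqP->; rewrite !eqxx orbT.
move=> tN; have eS := hull_snext tN; case/and4P: tN => /IHl{}IHl /IHr{}IHr _ /IHs{}IHs.
have sub (a : seq M) : {subset a <= hull (Node b l r s) x} ->
  org z \in a /\ tgt z \in a -> org z \in hull (Node b l r s) x /\ tgt z \in hull (Node b l r s) x.
  by move=> ah [/ah-> /ah->].
rewrite [pos _ _]/= inE !mem_cat => /or4P[/eqP->|/IHl|/IHr|/IHs].
- by rewrite !inE !eqxx orbT.
- by apply: sub => u; rewrite hull_lside !(inE, mem_cat) => /or3P[]->; rewrite ?orbT.
- by apply: sub => u; rewrite hull_rside !(inE, mem_cat) => /or3P[]->; rewrite ?orbT.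
- by apply: sub => u; rewrite eS !(inE, mem_cat) => /or3P[]->; rewrite ?orbT.
Qed.

Record fresh_spec l r s x : Prop := FreshSpec {
  fresh_l : fresh l (lside x);
  fresh_r : fresh r (rside x);
  fresh_s : fresh s (snext r x);
  fresh_ends : org x != tgt x;
  fresh_lr : forall u, u \in hull l (lside x) -> u \in hull r (rside x) -> u = apex x;
  fresh_ls : forall u, u \in hull l (lside x) -> u \in hull s (snext r x) -> u = org x;
  fresh_rs : forall u, u \in hull r (rside x) -> u \in hull s (snext r x) -> u = tgt x;
  fresh_tl : tgt x \notin hull l (lside x);
  fresh_or : org x \notin hull r (rside x);
  fresh_as : apex x \notin hull s (snext r x) }.

Lemma freshP b l r s x :
  is_net (Node b l r s) x -> fresh (Node b l r s) x -> fresh_spec l r s x.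
Proof.
move=> tN; have eS := hull_snext tN.
rewrite /fresh /hull [apices _ _]/= !cons_uniq cat_uniq cat_uniq !in_cons !mem_cat !negb_or has_cat negb_or.
case/and3P=> /and5P[ot oa ol or' os] /and4P[ta tl tr ts].
case/and3P=> /and3P[al ar as'] ul /and4P[/andP[hlr hls] ur hr us].
have lr u : u \in apices l (lside x) -> u \in apices r (rside x) -> false.
  by move=> ul' ur'; case/hasP: hlr; exists u.
have ls u : u \in apices l (lside x) -> u \in apices s (snext r x) -> false.
  by move=> ul' us'; case/hasP: hls; exists u.
have rs u : u \in apices r (rside x) -> u \in apices s (snext r x) -> false.
  by move=> ur' us'; case/hasP: hr; exists u.
have Ni u v (a : seq M) : v \notin a -> u = v -> u \in a -> false.
  by move=> h e; rewrite e (negbTE h).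
have Nq u v : u != v -> u = v -> false by move=> h e; rewrite e eqxx in h.
split; rewrite /fresh ?eS ?hull_lside ?hull_rside //=.
- by rewrite !inE !negb_or oa ol al.
- by rewrite !inE !negb_or ar tr eq_sym ta ur.
- by rewrite !inE !negb_or ot os ts us.
- move=> u; rewrite !inE => /or3P[/eqP h|/eqP->//|h] /or3P[/eqP h'|/eqP h'|h'] //; exfalso.
  + by apply: notF; apply: Nq ot _; rewrite -h -h'.
  + by apply: notF; apply: Ni or' h h'.
  + by apply: notF; apply: Ni tl h' h.
  + by apply: notF; apply: lr h h'.
- move=> u; rewrite !inE => /or3P[/eqP->//|/eqP h|h] /or3P[/eqP h'|/eqP h'|h'] //; exfalso.
  + by apply: notF; apply: Nq ta _; rewrite -h -h'.
  + by apply: notF; apply: Ni as' h h'.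
  + by apply: notF; apply: Ni tl h' h.
  + by apply: notF; apply: ls h h'.
- move=> u; rewrite !inE => /or3P[/eqP h|/eqP->//|h] /or3P[/eqP h'|/eqP h'|h'] //; exfalso.
  + by apply: notF; apply: Nq oa _; rewrite -h -h'.
  + by apply: notF; apply: Ni as' h h'.
  + by apply: notF; apply: Ni or' h' h.
  + by apply: notF; apply: rs h h'.
- by rewrite !inE !negb_or eq_sym ot ta tl.
- by rewrite !inE !negb_or oa ot or'.
- by rewrite !inE !negb_or eq_sym oa eq_sym ta as'.
Qed.

(** The chain of parallel edges along the third children, without its last edge. *)
Fixpoint cinit t x : seq M :=
  if t is Node _ l r s then x :: cinit s (snext r x) else [::].

Lemma cinit_apex t x z : z \in cinit t x -> apex z \in apices t x.
Proof.
elim: t x => //= b l _ r _ s IHs x; rewrite !inE => /orP[/eqP->|/IHs h].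
  by rewrite eqxx.
by rewrite !mem_cat h !orbT.
Qed.

Fixpoint same_shape t t' : bool :=
  match t, t' with
  | Leaf _, Leaf _ => true
  | Node _ l r s, Node _ l' r' s' =>
    [&& same_shape l l', same_shape r r' & same_shape s s']
  | _, _ => false
  end.

(* [Q] tells where a chain of parallel edges stops: for the two sides of a
   triangle, at the dart whose right-hand face has the third vertex of that
   triangle as its apex. *)
Lemma net_shape t t' x (Q : pred M) :
  is_net t x -> is_net t' x -> fresh t x -> fresh t' x ->
  {in cinit t x, forall z, ~~ Q z} -> {in cinit t' x, forall z, ~~ Q z} ->
  Q (nend t x) -> Q (nend t' x) -> same_shape t t' /\ nend t x = nend t' x.
Proof.
elim: t t' x Q => [b|b l IHl r IHr s IHs] [b'|b' l' r' s'] x Q //.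
- by move=> _ _ _ _ _ /(_ x (mem_head _ _))/negbTE->.
- by move=> _ _ _ _ /(_ x (mem_head _ _))/negbTE->.
move=> tN tN' fN fN'; have F := freshP tN fN; have F' := freshP tN' fN'.
have [lN rN eN sN] := and4P tN; have [lN' rN' eN' sN'] := and4P tN'.
move=> Qi Qi' Qe Qe'.
have out l0 : tgt x \notin hull l0 (lside x) ->
    {in cinit l0 (lside x), forall z, ~~ (apex z == tgt x)}.
  move=> h z /cinit_apex az; apply: contraNneq h => <-.
  by rewrite !inE az !orbT.
have outr r0 : org x \notin hull r0 (rside x) ->
    {in cinit r0 (rside x), forall z, ~~ (apex z == org x)}.
  move=> h z /cinit_apex az; apply: contraNneq h => <-.
  by rewrite !inE az !orbT.
(* Freshness keeps [tgt x] out of the left hull, so only the last edge of the left chain faces it;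
   symmetrically for [org x] and the right chain. *)
have [el _] := IHl l' _ (fun z => apex z == tgt x) lN lN' (fresh_l F) (fresh_l F')
  (out _ (fresh_tl F)) (out _ (fresh_tl F')) (introT eqP (apex_lend tN))
  (introT eqP (apex_lend tN')).
have [er er'] := IHr r' _ (fun z => apex z == org x) rN rN' (fresh_r F) (fresh_r F')
  (outr _ (fresh_or F)) (outr _ (fresh_or F')) (introT eqP (apex_rend tN))
  (introT eqP (apex_rend tN')).
have es : snext r' x = snext r x by rewrite /snext er'.
move: sN' Qi' Qe' (fresh_s F'); rewrite nend_Node [cinit _ _]/= es => sN' Qi' Qe' fs'.
have [||ess ess'] := IHs s' _ Q sN sN' (fresh_s F) fs' _ _ Qe Qe'.
- by move=> z zs; apply: Qi; rewrite /= inE zs orbT.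
- by move=> z zs; apply: Qi'; rewrite inE zs orbT.
by split; [rewrite /= el er ess | rewrite [RHS](_ : _ = nend s' (snext r' x)) // es].
Qed.

End Vertices.

(** Every dart lies in the net, so the hull contains every vertex; having exactly as many entries as
    there are vertices, it has no repetition. *)
Lemma pres_fresh (M : cmap) (d : M) t : pres d t -> fresh t d.
Proof.
move=> P; have cM := pres_connected P; have tM := pres_tri P.
have Sn := fconnect_sym (@node_inj M).
apply: (leq_size_uniq (enum_uniq (froots (@node M)))) => [z|].
  rewrite mem_enum => /eqP z_root; have zO : z = org z by [].
  have : z \in darts t d := pres_cover P z.
  have h u : u \in posl t d -> org u \in hull t d /\ tgt u \in hull t d.
    by move=> up; apply: pos_hull (pres_net P) _ => //; rewrite pos_rcons mem_rcons inE up orbT.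
  rewrite mem_cat => /orP[/h[]|/mapP[u /h[_ tu] e]]; first by rewrite -zO.
  by rewrite zO e.
have := pres_nb_vertices P; rewrite /= size_apices addn2 => <-.
rewrite -cardE /nb_vertices /n_comp_mem; apply: subset_leq_card.
by apply/subsetP => z; rewrite !inE andbT.
Qed.

(** * Opening an edge *)

Section Step.

Variable M : cmap.
Implicit Types (T : {set M}) (x y : M).

Definition step T : rel M := [rel u v | (v == node u) || (u \in T) && (v == edge u)].

Lemma step_sym T : edge_set T -> connect_sym (step T).
Proof.
move=> eT; set e := [rel u v | (u \in T) && (v == edge u)].
have se : symmetric e.
  move=> x y /=; apply/andP/andP=> -[xT /eqP->]; first by rewrite edgeK eqxx eT.
  by rewrite edgeK eqxx eT.
have E : connect (step T) =2 connect (relU (frel (@node M)) e).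
  by apply: eq_connect => x y; congr orb; apply: eq_sym.
move=> x y; rewrite !E; apply: relU_sym; last exact: sym_connect_sym.
by apply: fconnect_sym; apply: node_inj.
Qed.

Lemma connectedE : connected M <-> forall x y, connect (step setT) x y.
Proof.
have E : connect [rel u v : M | (v == node u) || (v == edge u)] =2 connect (step setT).
  by apply: eq_connect => x y; rewrite /step /= in_setT.
by split=> c x y; [rewrite -E; apply: c | rewrite E; apply: c].
Qed.

Lemma step_from T d : edge_set T ->
  (forall x, connect (step T) d x) -> forall x y, connect (step T) x y.
Proof.
by move=> eT dT x y; apply: connect_trans (dT y); rewrite step_sym.
Qed.

Lemma connect_node T d x : connect (step T) d x -> connect (step T) d (node x).
Proof. by move/connect_trans; apply; apply: connect1; rewrite /step /= eqxx. Qed.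

Lemma connect_edge T d x : x \in T -> connect (step T) d x -> connect (step T) d (edge x).
Proof. by move=> xT /connect_trans; apply; apply: connect1; rewrite /step /= xT eqxx orbT. Qed.

End Step.

Definition closed_net (M : cmap) (d : M) t := is_net t d /\ nend t d = d.

Section Opening.

Variables (M : cmap) (e : M).
Implicit Types (x y z : M) (t l r s : net) (c : bool).

Local Notation N := (open_edge e).

(* An edge of [M] becomes one or two edges of [open_edge e]: [keep x] is the
   copy of [x] bordering the face that was on the right of [x], [copy x] is the
   other one. *)
Definition keep x : N := old x.
Definition copy x : N := edge (keep (edge x)).

Definition spk c : N := spoke M c.
Definition hb c : N := hub M c.
Definition twn c : N := twin M c.

Definition opened x := (x == e) || (x == edge e).

Lemma openedP x : reflect (exists c, x = edge_end e c) (opened x).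
Proof.
apply: (iffP orP) => [[/eqP->|/eqP->]|[[] ->]]; first by exists false.
- by exists true.
- by right.
- by left.
Qed.

Lemma not_opened x : ~~ opened x -> forall c, x != edge_end e c.
Proof. by rewrite negb_or => /andP[h1 h2] []. Qed.

Lemma opened_edge x : opened (edge x) = opened x.
Proof. by rewrite /opened -{1}[e]edgeK !(inj_eq (@edge_inj M)) orbC. Qed.

Lemma edge_keep x : edge (keep x) = copy (edge x).
Proof. by rewrite /copy edgeK. Qed.

Lemma copy_end c : copy (edge_end e c) = twn c.
Proof. by rewrite /copy edge_endC -[c in RHS]negbK; apply: open_edgeE. Qed.

Lemma copy_old x : ~~ opened x -> copy x = keep x.
Proof.
by rewrite -opened_edge => /not_opened h; rewrite /copy -[x in RHS]edgeK; apply: open_edge_old.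
Qed.

(** Opening leaves the old faces intact, and the darts [keep x] are those that border them. *)
Lemma face_keep x : face (keep x) = keep (face x).
Proof.
rewrite /face edge_keep; have [/openedP[c ->]|nx] := boolP (opened x).
  by rewrite edge_endC copy_end.
have /not_opened ne : ~~ opened (edge x) by rewrite opened_edge.
by rewrite copy_old ?opened_edge //; apply: open_node_old.
Qed.

Lemma lside_keep x : lside (keep x) = copy (lside x).
Proof. by rewrite /lside !face_keep edge_keep. Qed.

Lemma rside_keep x : rside (keep x) = copy (rside x).
Proof. by rewrite /rside !face_keep edge_keep. Qed.

Lemma edge_twn c : edge (twn c) = keep (edge_end e (~~ c)).
Proof. by []. Qed.

Lemma edge_spk c : edge (spk c) = hb c. Proof. by []. Qed.
Lemma edge_hb c : edge (hb c) = spk c. Proof. by []. Qed.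

Lemma face_twn c : face (twn c) = spk (~~ c).
Proof. exact: open_nodeE. Qed.

Lemma face_spk c : face (spk c) = hb (~~ c). Proof. by []. Qed.
Lemma face_hb c : face (hb c) = twn c. Proof. by []. Qed.

Lemma triangular_open : triangular M -> triangular N.
Proof.
move=> tM [x|[b|[b|b]]].
- by rewrite -[inl x]/(keep x) !face_keep tM.
- by rewrite -[inr _]/(twn b) face_twn face_spk face_hb negbK.
- by rewrite -[inr _]/(spk b) face_spk face_hb face_twn negbK.
- by rewrite -[inr _]/(hb b) face_hb face_twn face_spk negbK.
Qed.

Lemma card_open : #|N| = #|M| + 6.
Proof. by rewrite /= card_sum !card_sum card_bool. Qed.

(** The common induction step for all transports below. The two old triangles at [x] survive, so
    each subnet of the new map must run from the copy of its first edge that looks away from the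
    first triangle to the copy of its last edge that borders the second one. *)
Lemma net_Node_keep b l r s b' l' r' s' x :
  is_net (Node b l r s) x ->
  is_net l' (copy (lside x)) -> nend l' (copy (lside x)) = keep (nend l (lside x)) ->
  is_net r' (copy (rside x)) -> nend r' (copy (rside x)) = keep (nend r (rside x)) ->
  is_net s' (copy (snext r x)) ->
  is_net (Node b' l' r' s') (keep x) /\
  nend (Node b' l' r' s') (keep x) = nend s' (copy (snext r x)).
Proof.
case/and4P=> _ _ /eqP eM _ lN lE rN rE sN.
have es : snext r' (keep x) = copy (snext r x).
  by rewrite /snext rside_keep rE face_keep edge_keep.
rewrite net_Node nend_Node es lside_keep rside_keep lN rN sN lE rE face_keep eM eqxx.
by [].
Qed.

(** Between the two copies of the opened edge lies exactly the inserted pair of triangles, whose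
    sides are plain edges. *)
Lemma net_triangle c b1 b2 b t : is_net t (keep (edge_end e c)) ->
  is_net (Node b (Leaf b1) (Leaf b2) t) (twn c) /\
  nend (Node b (Leaf b1) (Leaf b2) t) (twn c) = nend t (keep (edge_end e c)).
Proof.
have es : snext (Leaf b2) (twn c) = keep (edge_end e c).
  by rewrite /snext /rside face_twn edge_spk face_hb edge_twn negbK.
move=> tN; rewrite net_Node nend_Node es tN andbT; split=> //; apply/eqP.
rewrite -[nend (Leaf b1) _]/(lside (twn c)) -[nend _ _]/(rside (twn c)).
by rewrite /lside /rside !(face_twn, face_spk, face_hb, edge_spk, edge_hb, negbK).
Qed.

(** The tree read in the opened map from [copy x] to the [keep] copy of the last edge: each position
    on the opened edge gets one more node in front. Labels of new nodes are placeholders, to be set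
    by [lab]. *)
Fixpoint up t x : net :=
  let core := match t with
    | Leaf b => Leaf b
    | Node b l r s => Node b (up l (lside x)) (up r (rside x)) (up s (snext r x))
    end in
  if opened x then Node false (Leaf false) (Leaf false) core else core.

Definition up_core t x : net :=
  match t with
  | Leaf b => Leaf b
  | Node b l r s => Node b (up l (lside x)) (up r (rside x)) (up s (snext r x))
  end.

Lemma upE t x : up t x =
  if opened x then Node false (Leaf false) (Leaf false) (up_core t x) else up_core t x.
Proof. by case: t. Qed.

Lemma net_copy t x : is_net t (keep x) ->
  let t' := if opened x then Node false (Leaf false) (Leaf false) t else t in
  is_net t' (copy x) /\ nend t' (copy x) = nend t (keep x).
Proof.
case: ifP => [/openedP[c ->] tN | /negbT/copy_old-> //].
by rewrite copy_end; apply: net_triangle tN.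
Qed.

Lemma up_core_net t x : is_net t x ->
  is_net (up_core t x) (keep x) /\ nend (up_core t x) (keep x) = keep (nend t x).
Proof.
elim: t x => // b l IHl r IHr s IHs x tN; have [lN rN _ sN] := and4P tN.
have IH t' x' : is_net t' x' -> (is_net t' x' ->
    is_net (up_core t' x') (keep x') /\
    nend (up_core t' x') (keep x') = keep (nend t' x')) ->
  is_net (up t' x') (copy x') /\ nend (up t' x') (copy x') = keep (nend t' x').
  by move=> tN' /(_ tN')[tU eU]; rewrite upE -eU; apply: net_copy.
have [lU lE] := IH _ _ lN (IHl _); have [rU rE] := IH _ _ rN (IHr _).
have [sU sE] := IH _ _ sN (IHs _).
by have [? ->] := net_Node_keep b tN lU lE rU rE sU; rewrite sE.
Qed.

Lemma up_net t x : is_net t x ->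
  is_net (up t x) (copy x) /\ nend (up t x) (copy x) = keep (nend t x).
Proof. by move=> /up_core_net[tU eU]; rewrite upE -eU; apply: net_copy. Qed.

(** Variant of [up] that stops at the [copy] side of the last edge, so that edge is not doubled;
    used to cut the map along an edge. *)
Fixpoint upl t x : net :=
  match t with
  | Leaf b => Leaf b
  | Node b l r s =>
    let core := Node b (up l (lside x)) (up r (rside x)) (upl s (snext r x)) in
    if opened x then Node false (Leaf false) (Leaf false) core else core
  end.

Lemma upl_net t x : is_net t x ->
  is_net (upl t x) (copy x) /\ nend (upl t x) (copy x) = copy (nend t x).
Proof.
elim: t x => // b l _ r _ s IHs x tN; have [/up_net[lU lE] /up_net[rU rE] _ sN] := and4P tN.
have [sU sE] := IHs _ sN.
have [cN cE] := net_Node_keep b tN lU lE rU rE sU.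
by have [tU eU] := net_copy cN; split; [exact: tU | rewrite [LHS]eU cE sE].
Qed.

Lemma upl_core b l r s x : is_net (Node b l r s) x ->
  let t := Node b (up l (lside x)) (up r (rside x)) (upl s (snext r x)) in
  is_net t (keep x) /\ nend t (keep x) = copy (nend s (snext r x)).
Proof.
move=> tN; have [/up_net[lU lE] /up_net[rU rE] _ /upl_net[sU sE]] := and4P tN.
by have [cN cE] := net_Node_keep b tN lU lE rU rE sU; split; rewrite ?cE ?sE.
Qed.

Lemma nodes_up t x : nodes (up t x) = nodes t + count opened (pos t x).
Proof.
elim: t x => [b|b l IHl r IHr s IHs] x /=; first by case: (opened x).
have -> b' l' r' s' : nodes (if opened x then Node false (Leaf false) (Leaf false)
  (Node b' l' r' s') else Node b' l' r' s') = opened x + nodes (Node b' l' r' s').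
  by case: (opened x).
rewrite /= IHl IHr IHs -/(snext r x) !count_cat; lia.
Qed.

Lemma nodes_upl t x : nodes (upl t x) = nodes t + count opened (posl t x).
Proof.
elim: t x => [b|b l _ r _ s IHs] x //=.
have -> b' l' r' s' : nodes (if opened x then Node false (Leaf false) (Leaf false)
  (Node b' l' r' s') else Node b' l' r' s') = opened x + nodes (Node b' l' r' s').
  by case: (opened x).
rewrite /= !nodes_up IHs -/(snext r x) !count_cat; lia.
Qed.

Lemma up_id t x : ~~ has opened (pos t x) -> up t x = t.
Proof.
elim: t x => [b|b l IHl r IHr s IHs] x /=; first by case: (opened x).
rewrite !has_cat -/(snext r x); case: (opened x) => //=.
by rewrite !negb_or => /and3P[hl hr hs]; rewrite IHl ?IHr ?IHs.
Qed.

Lemma connected_open : connected M -> connected N.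
Proof.
move=> cM; apply/connectedE; apply: (step_from (d := keep e)); first by move=> x; rewrite !inE.
set P := connect _ _.
have Pn u : P u -> P (node u) by apply: connect_node.
have Pe u : P u -> P (edge u) by apply: connect_edge; rewrite inE.
have Ps c : P (keep (edge_end e c)) -> P (spk c).
  by move/Pn; rewrite (_ : node _ = spk c) //; apply: open_nodeE.
have Pt c : P (spk c) -> P (twn c) by move/Pn.
have ke x : P (keep x) -> P (keep (edge x)).
  have [/openedP[c ->]|nx] := boolP (opened x).
    by move/Ps/Pt/Pe; rewrite edge_twn edge_endC.
  by move/Pe; rewrite edge_keep copy_old ?opened_edge.
have Pk x : P (keep x).
  apply: (@connected_ind _ (fun y => P (keep y)) e cM) => [y|y|]; [exact: ke | | exact: connect0].
  by move=> /ke/Pe/Pn; rewrite node_face edgeK face_keep -node_face.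
case=> [x|[b|[b|b]]]; [exact: Pk | exact: Pt (Ps _ (Pk _)) | exact: Ps _ (Pk _) |].
exact: Pe _ (Ps b (Pk _)).
Qed.

(** The two hubs form the orbit of the new vertex. On the other darts, [keep] puts the orbits in
    correspondence with those of [M]: spokes and twins are merely inserted in the rotation around
    the ends. *)
Lemma nb_vertices_open : nb_vertices N = (nb_vertices M).+1.
Proof.
have sN := fconnect_sym (@node_inj N); have sM := fconnect_sym (@node_inj M).
pose a : {pred N} := [pred u : N | if u is inr (inr (inr _)) then false else true].
have cl_a : fclosed (@node N) a.
  apply: intro_closed => // u v /eqP <-; case: u => [x|[b|[b|b]]] //=.
  by case: ifP => // _; case: ifP.
pose h' (u : N) (_ : u \in a) : M := match u with
  | inl x => x
  | inr (inl b) => edge_end e b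
  | inr (inr (inl b)) => edge_end e b
  | inr (inr (inr b)) => e
  end.
have nk c : node (keep (edge_end e c)) = spk c by apply: open_nodeE.
have nk' x : ~~ opened x -> node (keep x) = keep (node x).
  by move/not_opened; apply: open_node_old.
have c1 c : fconnect (@node N) (keep (edge_end e c)) (spk c) by rewrite -nk; apply: fconnect1.
have c2 c : fconnect (@node N) (spk c) (twn c) by apply: fconnect1.
have adj : fun_adjunction keep (@node N) (@node M) a.
  apply: (intro_adjunction (h := keep) sM cl_a h').
    case=> [x|[b|[b|b]]] au //; split; rewrite ?connect0 //.
    - move=> v av /eqP ev; move: av; rewrite -ev -[inl x]/(keep x).
      have [/openedP[c ->]|nx] := boolP (opened x); first by rewrite nk => ?; apply: connect0.
      by rewrite nk' //= => ?; apply: fconnect1.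
    - by rewrite sN; apply: connect_trans (c1 b) (c2 b).
    - move=> v av /eqP ev; move: av; rewrite -ev -[inr _]/(twn b).
      by move=> av; apply: (fconnect1 (@node M) (edge_end e b)).
    - by rewrite sN; apply: c1.
    - by move=> v av /eqP ev; move: av; rewrite -ev -[inr _]/(spk b) => av; apply: connect0.
  move=> x ax; split; first exact: connect0.
  move=> y /eqP <-; have [/openedP[c ->]|nx] := boolP (opened x); last first.
    by rewrite -nk' //; apply: fconnect1.
  apply: connect_trans (c1 c) _; apply: connect_trans (c2 c) _.
  by rewrite -[keep _]/(node (twn c)); apply: fconnect1.
rewrite /nb_vertices (n_compC a) (adjunction_n_comp _ sN sM cl_a adj) -addn1.
have -> : fcard (@node M) [preim keep of a] = fcard (@node M) M by apply: eq_n_comp_r.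
congr (_ + _); rewrite -(n_comp_connect sN (hb true)); apply: eq_card => u; rewrite !inE; congr andb.
have ca : fclosed (@node N) [predC a] := predC_closed cl_a.
have [h|h] := boolP (fconnect _ _ _).
  by have := closed_connect ca h; rewrite !inE => <-.
case: u h => [x|[b|[b|[]]]] //=; first by rewrite connect0.
by move/negP; case; apply: (fconnect1 (@node N) (hb true)).
Qed.

(** [darts t d] lists [e] once, either as a position or as the reverse of one. *)
Lemma count_opened d t : pres d t -> count opened (posl t d) = 1.
Proof.
move=> P; have : count_mem e (darts t d) = 1.
  by rewrite count_uniq_mem ?(pres_uniq P) // (pres_cover P).
rewrite count_cat count_map => <-.
rewrite -[RHS]addn0 -(@count_predUI _ (pred1 e) (preim (@edge M) (pred1 e))) /=.
rewrite (_ : count (predI _ _) _ = 0) ?addn0.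
  by apply: eq_count => x /=; rewrite /opened -[e in RHS]edgeK (inj_eq (@edge_inj M)) edgeK.
rewrite (eq_count (a2 := pred0)) ?count_pred0 // => x /=.
by apply/negP => /andP[/eqP-> ]; rewrite (negbTE (edge_neq e)).
Qed.

Lemma count_opened_behead d t : pres d t -> count opened (behead (pos t d)) = 1.
Proof.
move=> P; rewrite -(count_opened P); have := congr1 (count opened) (pos_rcons t d).
by rewrite {1}pos_head (pres_nend P) -cats1 count_cat /= addn0 addnC => /addIn.
Qed.

Lemma keep_root d t : pres d t -> exists2 t', closed_net (keep d) t' & nodes t' = (nodes t).+1.
Proof.
move=> P; exists (up_core t d).
  by have [? e'] := up_core_net (pres_net P); split; rewrite // e' (pres_nend P).
have := pres_nodes_gt0 P; have := count_opened_behead P.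
case: (t) => //= b l r s; rewrite !nodes_up !count_cat -/(snext r d); lia.
Qed.

(* Cut open along [edge_end e c], [M] becomes a net between the two copies. *)
Lemma cut_net c t : pres (edge_end e c) t ->
  exists t', [/\ is_net t' (keep (edge_end e c)),
                 nend t' (keep (edge_end e c)) = twn c & nodes t' = nodes t].
Proof.
move=> P; have := pres_nodes_gt0 P; have := pres_net P; have := pres_nend P.
have := count_opened P; case: (t) => //= b l r s; rewrite -/(snext r _) => cnt eE tN _.
have [cN cE] := upl_core (tN : is_net (Node b l r s) _).
exists (Node b (up l (lside (edge_end e c))) (up r (rside (edge_end e c)))
          (upl s (snext r (edge_end e c)))); split=> //.
  by rewrite cE eE copy_end.
have oc : opened (edge_end e c) by apply/openedP; exists c.
by move: cnt; rewrite /= !nodes_up !nodes_upl !count_cat oc; lia.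
Qed.

(** From a new dart one sees the two inserted triangles with one side thickened by the cut map: it
    is the third child from a twin, the first from a spoke and the second from a hub. *)
Lemma twn_root c t : pres (edge_end e c) t ->
  exists2 t', closed_net (twn c) t' & nodes t' = (nodes t).+1.
Proof.
case/cut_net=> t' [tN tE <-].
have [tN' tE'] := net_triangle false false false tN.
by exists (Node false (Leaf false) (Leaf false) t'); rewrite // /closed_net tE' tE.
Qed.

Lemma spk_root c t : pres (edge_end e c) t ->
  exists2 t', closed_net (spk c) t' & nodes t' = (nodes t).+1.
Proof.
case/cut_net=> t' [tN tE <-]; exists (Node false t' (Leaf false) (Leaf false)); last first.
  by rewrite /= !addn0.
have el : lside (spk c) = keep (edge_end e c).
  by rewrite /lside face_spk face_hb edge_twn negbK.
have er : rside (spk c) = spk (~~ c) by rewrite /rside face_spk edge_hb.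
have es : snext (Leaf false) (spk c) = spk c.
  by rewrite /snext er -[nend _ _]/(spk (~~ c)) face_spk edge_hb negbK.
by split; rewrite ?nend_Node ?es // net_Node el er tN tE face_twn /= eqxx.
Qed.

Lemma hb_root c t : pres (edge_end e (~~ c)) t ->
  exists2 t', closed_net (hb c) t' & nodes t' = (nodes t).+1.
Proof.
case/cut_net=> t' [tN tE <-]; exists (Node false (Leaf false) t' (Leaf false)); last first.
  by rewrite /= !addn0.
have el : lside (hb c) = hb (~~ c) by rewrite /lside face_hb face_twn edge_spk.
have er : rside (hb c) = keep (edge_end e (~~ c)) by rewrite /rside face_hb edge_twn.
have es : snext t' (hb c) = hb c.
  by rewrite /snext er tE face_twn negbK edge_spk.
split; rewrite ?nend_Node ?es // net_Node el er tN tE.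
by rewrite [nend (Leaf false) _]/= face_hb eqxx.
Qed.

End Opening.

(** * Every map obtained by openings is a closed net *)

(** The invariant of a map obtained by [k] openings. A net is required at every dart, since reading
    from the new darts after an opening uses nets rooted at the opened edge. *)
Record stacked (M : cmap) (k : nat) : Prop := Stacked {
  st_connected : connected M;
  st_tri : triangular M;
  st_face : forall x : M, face x != x;
  st_card : #|M| = 6 * k.+1;
  st_vertices : nb_vertices M = k + 3;
  st_net : forall d : M, exists2 t, closed_net d t & nodes t = k.+1 }.

Lemma stacked_pres (M : cmap) k (d : M) t : stacked M k -> closed_net d t ->
  nodes t = k.+1 -> pres d t.
Proof. by case=> cM tM _ sM vM _ [tN td] tk; split=> //; rewrite tk // vM addn2 addn3. Qed.

Lemma stacked_open (M : cmap) (e : M) k : stacked M k -> stacked (open_edge e) k.+1.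
Proof.
move=> S; have [cM tM fM sM vM nM] := S; split.
- exact: connected_open.
- exact: triangular_open.
- case=> [x|[b|[b|b]]] //.
    by rewrite -[inl x]/(keep e x) face_keep (inj_eq inl_inj).
  by rewrite -[inr _]/(twn e b) face_twn.
- by rewrite card_open sM; lia.
- by rewrite nb_vertices_open vM.
have pM (x : M) : exists2 t, pres x t & nodes t = k.+1.
  by have [t tx tk] := nM x; exists t => //; apply: stacked_pres tx tk.
case=> [x|[b|[b|b]]].
- by have [t /(keep_root e)[t' tN' e'] tk] := pM x; exists t'; rewrite // e' tk.
- by have [t /twn_root[t' tN' e'] tk] := pM (edge_end e b); exists t'; rewrite // e' tk.
- by have [t /spk_root[t' tN' e'] tk] := pM (edge_end e b); exists t'; rewrite // e' tk.
- by have [t /hb_root[t' tN' e'] tk] := pM (edge_end e (~~ b)); exists t'; rewrite // e' tk.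
Qed.

Lemma stacked_iso (M N : cmap) k : stacked M k -> cmap_iso M N -> stacked N k.
Proof.
move=> [cM tM fM sM vM nM] [f [[g fK gK] fm]]; have [fe fn] := fm.
have f_inj := can_inj fK; split.
- apply/connectedE; move/connectedE in cM => x y.
  rewrite -[x]gK -[y]gK; have /connectP[p] := cM (g x) (g y).
  elim: p (g x) => [|u p IHp] z /=; first by move=> _ ->; apply: connect0.
  case/andP=> zu /IHp{}IHp /IHp; apply: connect_trans; apply: connect1.
  by move: zu; rewrite /step /= !inE -fe -fn !(inj_eq f_inj).
- by move=> x; rewrite -[x]gK !(morph_face fm) tM.
- by move=> x; rewrite -[x]gK (morph_face fm) (inj_eq f_inj) fM.
- by rewrite -sM; apply: esym; apply: (bij_eq_card (f := f)); exists g.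
- rewrite -vM; have sN := fconnect_sym (@node_inj N); have sym := fconnect_sym (@node_inj M).
  have adj : fun_adjunction f (@node N) (@node M) N.
    apply: strict_adjunction => //.
      by apply/subsetP => y _; rewrite -[y]gK codom_f.
    by move=> x y _; rewrite /= -fn (inj_eq f_inj).
  by rewrite /nb_vertices (adjunction_n_comp _ sN sym _ adj).
move=> d; have [t [tN td] tk] := nM (g d); exists t => //.
by rewrite -[d]gK; split; [apply: morph_net | rewrite morph_nend // td].
Qed.

Lemma order2 (T : finType) (f : T -> T) x : injective f -> f x != x -> f (f x) = x -> order f x = 2.
Proof.
move=> fI fx ffx; apply: (order_cycle (p := [:: x; f x])); rewrite /= ?mem_head //.
  by rewrite ffx !eqxx.
by rewrite inE eq_sym fx.
Qed.

Lemma order3 (T : finType) (f : T -> T) x : injective f -> f x != x ->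
  f (f (f x)) = x -> order f x = 3.
Proof.
move=> fI fx ffx; apply: (order_cycle (p := [:: x; f x; f (f x)])); rewrite /= ?mem_head //.
  by rewrite ffx !eqxx.
rewrite !inE negb_or !(eq_sym x) fx inj_eq // (eq_sym x) fx !andbT /=.
by apply: contraNneq fx => e; rewrite -{2}ffx e.
Qed.

Lemma nb_edges2 (M : cmap) : nb_edges M * 2 = #|M|.
Proof.
apply: fcard_order_set => //; first exact: edge_inj.
by apply/subsetP => x _; rewrite inE order2 ?edgeK ?edge_neq //; apply: edge_inj.
Qed.

Lemma nb_faces3 (M : cmap) : (forall x : M, order (@face M) x = 3) -> nb_faces M * 3 = #|M|.
Proof.
move=> o3; apply: fcard_order_set => //; first exact: face_inj.
by apply/subsetP => x _; rewrite inE o3.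
Qed.

(** Euler's formula is read off the counts: [k + 3] vertices, [3 (k + 1)] edges and [2 (k + 1)]
    faces. *)
Lemma stacked_planar (M : cmap) k : stacked M k -> planar_triangulation M.
Proof.
case=> cM tM fM sM vM _; have o3 x : order (@face M) x = 3.
  by apply: order3; [apply: face_inj | apply: fM | apply: tM].
split=> //; split=> //; rewrite vM.
by have := nb_edges2 M; have := nb_faces3 o3; lia.
Qed.

(** Without loops no edge has both sides on the same triangle, so each edge separates the two
    triangles; it remains to see that the sides are matched in mirror order. *)
Lemma dihedron (M : cmap) : planar_triangulation M -> loopless M -> nb_faces M = 2 ->
  forall x : M, face (edge x) = lside x.
Proof.
case=> [[cM euler] o3] ll f2.
have tM : triangular M by move=> x; rewrite -[RHS](iter_order (@face_inj M)) o3.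
have lle (x : M) : org x != tgt x by rewrite -same_vertexE ll.
have c6 : #|M| = 6 by rewrite -nb_faces3 ?f2.
pose fo (x : M) := [:: x; face x; face (face x)].
have fx (x : M) : face x != x.
  by apply: contraNneq (lle x) => e; rewrite -(org_face x) e.
have ufo x : uniq (fo x).
  rewrite /= !inE negb_or !(eq_sym x) fx (inj_eq (@face_inj M)) (eq_sym x) fx !andbT /=.
  by apply: contraNneq (fx x) => e; rewrite -{2}(tM x) e.
have fo_face x y : y \in fo x -> face y \in fo x.
  by rewrite !inE => /or3P[]/eqP->; rewrite ?tM ?eqxx ?orbT.
have out x : edge x \notin fo x.
  rewrite !inE !negb_or edge_neq /=; apply/andP; split.
    apply: contraNneq (lle (face (face x))) => e.
    by rewrite -[tgt _]org_face tM org_face /tgt -e edgeK.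
  apply: contraNneq (lle (face x)) => e.
  by rewrite org_face -(org_face (face x)) -e.
have dis x : uniq (fo x ++ fo (edge x)).
  rewrite cat_uniq !ufo andbT; apply/hasPn => y ye; apply/negP => yx.
  have : edge x \in fo x.
    have : [|| y == edge x, y == face (edge x) | y == face (face (edge x))].
      by move: ye; rewrite !inE.
    case/or3P=> /eqP ey.
    - by rewrite ey in yx.
    - by move: (fo_face _ _ (fo_face _ _ yx)); rewrite ey tM.
    - by move: (fo_face _ _ yx); rewrite ey tM.
  by rewrite (negbTE (out x)).
have cov x y : y \in fo x ++ fo (edge x).
  have h : #|fo x ++ fo (edge x)| = #|M|.
    by rewrite (card_uniqP (dis x)) c6.
  by rewrite (subset_cardP h (subset_predT _)).
have inq x y : y \in fo x -> edge y \in fo (edge x).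
  move=> yx; have := cov x (edge y); rewrite mem_cat => /orP[ey|//].
  case/negP: (out y); move: ey yx; rewrite !inE.
  case/or3P=> /eqP-> /or3P[]/eqP->; rewrite ?tM ?eqxx ?orbT //.
move=> x; have := inq x (face (face x)); rewrite !inE eqxx !orbT => /(_ isT).
rewrite (inj_eq (@edge_inj M)) => /or3P[/eqP e|/eqP e|/eqP e].
- by have := ufo x; rewrite /= e !inE eqxx orbT.
- by rewrite -e.
(* The remaining matching rotates the second triangle; it identifies the two ends of
   [face (face x)], which would be a loop. *)
have := inq x (face x); rewrite !inE eqxx !orbT => /(_ isT).
rewrite (inj_eq (@edge_inj M)) (negbTE (fx x)) -e (inj_eq (@edge_inj M)).
rewrite [face x == _]eq_sym (negbTE (fx (face x))) orbF /= => /eqP e'.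
have := lle (face (face x)); rewrite -[tgt (face _)]org_face tM org_face.
by rewrite /tgt e' org_face tgt_edge eqxx.
Qed.

Lemma stacked_base (M : cmap) : planar_triangulation M -> loopless M -> nb_faces M = 2 ->
  stacked M 0.
Proof.
move=> pM ll f2; have dM := dihedron pM ll f2; have [[cM euler] o3] := pM.
have tM : triangular M by move=> x; rewrite -[RHS](iter_order (@face_inj M)) o3.
have c6 : #|M| = 6 by rewrite -nb_faces3 ?f2.
split=> //.
- move=> x; apply/negP => /eqP e; have /negP[] := ll x.
  by rewrite same_vertexE org_edge -org_face e.
- by have := nb_edges2 M; lia.
move=> d; exists (Node false (Leaf false) (Leaf false) (Leaf false)) => //.
have er : face (rside d) = edge d by rewrite dM /lside tM.
split; rewrite /= ?er ?edgeK // andbT.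
by rewrite /lside dM /lside tM.
Qed.

Lemma obtained_stacked (M : cmap) : obtained_by_openings M -> exists k, stacked M k.
Proof.
elim=> {M} [M pM lM fM|M d _ [k S]|M N _ [k S] iMN].
- by exists 0; apply: stacked_base.
- by exists k.+1; apply: stacked_open.
- by exists k; apply: stacked_iso iMN.
Qed.

(** * Every net is realised *)

(** The boolean chooses one of the two triangles and the index one of the three shared edges; every
    vertex has degree 2. *)
Definition base_edge (u : bool * 'I_3) := (~~ u.1, u.2).
Definition base_node (u : bool * 'I_3) :=
  if u.1 then (false, ordS u.2) else (true, ord_pred u.2).

Lemma base_edgeK : involutive base_edge.
Proof. by case=> b i; rewrite /base_edge negbK. Qed.

Lemma base_edge_neq u : base_edge u != u.
Proof. by case: u => [[] i]. Qed.

Lemma base_nodeK : involutive base_node.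
Proof. by case=> [[] i]; rewrite /base_node /= ?ordSK ?ord_predK. Qed.

Definition base_map : cmap := CMap base_edgeK base_edge_neq (inv_inj base_nodeK).

Lemma ord3P (P : 'I_3 -> Prop) :
  (forall i, P i -> P (ordS i)) -> P ord0 -> forall i, P i.
Proof.
move=> PS P0 [i lti]; elim: i lti => [|i IHi] lti.
  by rewrite (_ : Ordinal lti = ord0) //; apply: val_inj.
have lti' := ltnW lti; rewrite (_ : Ordinal lti = ordS (Ordinal lti')); first exact/PS/IHi.
by apply: val_inj; rewrite /= modn_small.
Qed.

Lemma base_planar : [/\ planar_triangulation base_map, loopless base_map & nb_faces base_map = 2].
Proof.
have c6 : #|base_map| = 6 by rewrite card_prod card_bool card_ord.
have nS i : ordS i != i :> 'I_3 by case: i => [[|[|[|]]]].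
have fE (b : bool) (i : 'I_3) : face ((b, i) : base_map) =
    if b then (true, ord_pred i) else (false, ordS i) by case: b.
have f3 (u : base_map) : face (face (face u)) = u.
  case: u => [[] i]; rewrite !fE; congr (_, _); apply: val_inj.
    by case: i => [[|[|[|]]]].
  by case: i => [[|[|[|]]]].
have fn (u : base_map) : face u != u.
  case: u => [[] i]; rewrite fE xpair_eqE /=; last exact: nS.
  by rewrite -{2}[i]ord_predK eq_sym nS.
have o3 (u : base_map) : order (@face base_map) u = 3.
  by apply: order3; [apply: face_inj | apply: fn | apply: f3].
have o2 (u : base_map) : order (@node base_map) u = 2.
  by apply: order2; [apply: node_inj | case: u => [[] i] | apply: base_nodeK].
have V3 : nb_vertices base_map * 2 = #|base_map|.
  by apply: fcard_order_set; [apply: node_inj | apply/subsetP => u _; rewrite inE o2 | ].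
have F := nb_faces3 o3; have E := nb_edges2 base_map.
have cM : connected base_map.
  apply/connectedE; apply: (step_from (d := (false, ord0) : base_map)); first by move=> u; rewrite !inE.
  set P := connect _ _.
  have Pn (u : base_map) : P u -> P (node u) by apply: connect_node.
  have Pe (u : base_map) : P u -> P (edge u) by apply: connect_edge; rewrite inE.
  have Pf i : P ((false, i) : base_map).
    by apply: (@ord3P (fun i => P ((false, i) : base_map))) => [j /Pe/Pn|]; last exact: connect0.
  by case=> [[] i]; [apply: (Pe (false, i)) |].
split; last by lia.
  by split=> //; split=> //; lia.
move=> u; apply/negP; rewrite /same_vertex (fconnect_cycle (p := [:: u; node u])) ?mem_head //.
  rewrite !inE (negbTE (edge_neq u)) /=; apply/negP.
  case: u => [[] i]; rewrite xpair_eqE /= ?[i == ordS i]eq_sym ?(negbTE (nS i)) //.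
  by rewrite -{1}[i]ord_predK (negbTE (nS _)).
have nn : node (node u) = u := base_nodeK u.
by rewrite (_ : fcycle _ _ = [&& node u == node u, node (node u) == u & true]) // nn !eqxx.
Qed.

Lemma base_obtained : obtained_by_openings base_map.
Proof. by case: base_planar => *; apply: ObtainedBase. Qed.

(** Opening an edge at a leaf. This restricted move already reaches every tree with a node, because
    a deepest node has three leaves ([grow_ex]). *)
Inductive grow : net -> net -> Prop :=
| GrowLeaf b b0 b1 b2 b3 : grow (Leaf b) (Node b0 (Leaf b1) (Leaf b2) (Leaf b3))
| GrowL b l l' r s of grow l l' : grow (Node b l r s) (Node b l' r s)
| GrowR b l r r' s of grow r r' : grow (Node b l r s) (Node b l r' s)
| GrowS b l r s s' of grow s s' : grow (Node b l r s) (Node b l r s').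

Lemma grow_ex t : 0 < nodes t -> exists t0, grow t0 t.
Proof.
elim: t => // b l IHl r IHr s IHs _.
have [l0|/IHl[l0 lg]] := posnP (nodes l); last by exists (Node b l0 r s); apply: GrowL.
have [r0|/IHr[r0 rg]] := posnP (nodes r); last by exists (Node b l r0 s); apply: GrowR.
have [s0|/IHs[s0 sg]] := posnP (nodes s); last by exists (Node b l r s0); apply: GrowS.
case: l r s l0 r0 s0 {IHl IHr IHs} => [bl|] // [br|] // [bs|] // _ _ _.
by exists (Leaf b); constructor.
Qed.

Lemma grow_nodes t0 t : grow t0 t -> nodes t = (nodes t0).+1.
Proof. by elim=> //= *; lia. Qed.

Section Grow.

Variable M : cmap.
Implicit Types (x y e : M) (p : seq M).

(** No edge is listed twice, in either orientation; hence opening an edge at one position leaves the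
    subtrees elsewhere unchanged. *)
Definition edge_uniq p := uniq (p ++ map (@edge M) p).

Lemma edge_uniq_sub p q : subseq q p -> edge_uniq p -> edge_uniq q.
Proof.
by move=> qp; apply: subseq_uniq; apply: cat_subseq => //; apply: map_subseq.
Qed.

Lemma edge_uniq_perm p q : perm_eq p q -> edge_uniq p -> edge_uniq q.
Proof.
by move=> pq; rewrite /edge_uniq (perm_uniq (perm_cat pq (perm_map (@edge M) pq))).
Qed.

Lemma edge_uniq_opened p e x : edge_uniq p -> e \in p -> x \in p -> opened e x -> x = e.
Proof.
rewrite /edge_uniq cat_uniq => /and3P[_ /hasPn h _] ep xp /orP[/eqP//|/eqP xe].
by have := h x; rewrite xp xe map_f // => /(_ isT).
Qed.

Lemma grow_unopened p q e : edge_uniq (p ++ q) -> e \in p -> ~~ has (opened e) q.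
Proof.
move=> u ep; apply/hasPn => x xq; apply/negP => ox.
have xe : x = e by apply: (edge_uniq_opened u) => //; rewrite mem_cat (ep, xq) ?orbT.
move: u; rewrite /edge_uniq cat_uniq => /andP[]; rewrite cat_uniq => /and3P[_ /hasPn/(_ x xq)].
by rewrite xe /= ep.
Qed.

Lemma up_net_unopened e t x : is_net t x -> ~~ has (opened e) (pos t x) ->
  is_net t (copy e x) /\ nend t (copy e x) = keep e (nend t x).
Proof. by move=> /(up_net e)+ nt; rewrite up_id. Qed.

(** The first form, starting at [copy e x], is what a subnet needs inside [net_Node_keep]. The
    second is for the root, where the first and last positions are the same dart, so that only
    [behead] can be free of repetition. *)
Lemma grow_net t0 t : grow t0 t -> forall x, is_net t0 x ->
  (edge_uniq (pos t0 x) -> exists e, [/\ e \in pos t0 x, is_net t (copy e x)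
     & nend t (copy e x) = keep e (nend t0 x)]) /\
  (0 < nodes t0 -> edge_uniq (behead (pos t0 x)) -> exists e,
     [/\ e \in behead (pos t0 x), is_net t (keep e x)
     & nend t (keep e x) = keep e (nend t0 x)]).
Proof.
have half t1 t2 x : 0 < nodes t1 ->
    (0 < nodes t1 -> edge_uniq (behead (pos t1 x)) -> exists e,
     [/\ e \in behead (pos t1 x), is_net t2 (keep e x)
     & nend t2 (keep e x) = keep e (nend t1 x)]) ->
    edge_uniq (pos t1 x) -> exists e, [/\ e \in pos t1 x, is_net t2 (copy e x)
     & nend t2 (copy e x) = keep e (nend t1 x)].
  move=> t10 /(_ t10) h u; have ub : edge_uniq (behead (pos t1 x)).
    by apply: edge_uniq_sub u; rewrite [X in subseq _ X]pos_head subseq_cons.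
  have [e [ep eN eE]] := h ub; exists e.
  have ep' : e \in pos t1 x by rewrite pos_head inE ep orbT.
  rewrite copy_old //; apply/negP => /(edge_uniq_opened u ep' (mem_pos_head _ _)) xe.
  move: u; rewrite /edge_uniq cat_uniq => /andP[].
  by rewrite -xe in ep; rewrite pos_head /= ep.
elim=> {t0 t} [b b0 b1 b2 b3|b l l' r s _ IH|b l r r' s _ IH|b l r s s' _ IH] x.
(* The growing leaf is the edge to open: [copy x x] is the twin from which the inserted triangles
   are read. *)
- move=> _; split=> // _; exists x; rewrite inE eqxx; split=> //;
  have -> : copy x x = twn x false by rewrite -[x in copy _ x]/(edge_end x false) copy_end.
    by have [] := @net_triangle _ x false b1 b2 b0 (Leaf b3).
  by have [_ ->] := @net_triangle _ x false b1 b2 b0 (Leaf b3) isT.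
- move=> tN; have [lN rN _ sN] := and4P tN; have [IHl _] := IH _ lN.
  suff h : 0 < nodes (Node b l r s) -> edge_uniq (behead (pos (Node b l r s) x)) -> exists e,
      [/\ e \in behead (pos (Node b l r s) x), is_net (Node b l' r s) (keep e x)
      & nend (Node b l' r s) (keep e x) = keep e (nend (Node b l r s) x)].
    by split=> //; apply: half.
  move=> _; rewrite [behead _]/= => u.
  have [|e [ep lU lE]] := IHl; first by apply: edge_uniq_sub u; apply: prefix_subseq.
  exists e; have := grow_unopened u ep; rewrite has_cat negb_or => /andP[nr ns].
  have [rU rE] := up_net_unopened rN nr; have [sU sE] := up_net_unopened sN ns.
  have [? eE] := net_Node_keep b tN lU lE rU rE sU.
  by rewrite mem_cat ep eE sE.
- move=> tN; have [lN rN _ sN] := and4P tN; have [IHr _] := IH _ rN.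
  suff h : 0 < nodes (Node b l r s) -> edge_uniq (behead (pos (Node b l r s) x)) -> exists e,
      [/\ e \in behead (pos (Node b l r s) x), is_net (Node b l r' s) (keep e x)
      & nend (Node b l r' s) (keep e x) = keep e (nend (Node b l r s) x)].
    by split=> //; apply: half.
  move=> _; rewrite [behead _]/= => u.
  have [|e [ep rU rE]] := IHr.
    apply: edge_uniq_sub u; apply: subseq_trans (suffix_subseq _ _); apply: prefix_subseq.
  exists e; have := grow_unopened (p := pos r (rside x)) (q := pos l (lside x) ++ pos s (snext r x)).
  have pu : edge_uniq (pos r (rside x) ++ pos l (lside x) ++ pos s (snext r x)).
    by apply: edge_uniq_perm u; rewrite perm_catCA.
  move=> /(_ _ pu ep); rewrite has_cat negb_or => /andP[nl ns].
  have [lU lE] := up_net_unopened lN nl; have [sU sE] := up_net_unopened sN ns.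
  have [? eE] := net_Node_keep b tN lU lE rU rE sU.
  by rewrite !mem_cat ep orbT eE sE.
- move=> tN; have [lN rN _ sN] := and4P tN; have [IHs _] := IH _ sN.
  suff h : 0 < nodes (Node b l r s) -> edge_uniq (behead (pos (Node b l r s) x)) -> exists e,
      [/\ e \in behead (pos (Node b l r s) x), is_net (Node b l r s') (keep e x)
      & nend (Node b l r s') (keep e x) = keep e (nend (Node b l r s) x)].
    by split=> //; apply: half.
  move=> _; rewrite [behead _]/= => u.
  have [|e [ep sU sE]] := IHs.
    by apply: edge_uniq_sub u; apply: subseq_trans (suffix_subseq _ _); apply: suffix_subseq.
  exists e; have := grow_unopened (p := pos s (snext r x)) (q := pos l (lside x) ++ pos r (rside x)).
  have pu : edge_uniq (pos s (snext r x) ++ pos l (lside x) ++ pos r (rside x)).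
    by apply: edge_uniq_perm u; rewrite catA perm_catC.
  move=> /(_ _ pu ep); rewrite has_cat negb_or => /andP[nl nr].
  have [lU lE] := up_net_unopened lN nl; have [rU rE] := up_net_unopened rN nr.
  have [? eE] := net_Node_keep b tN lU lE rU rE sU.
  by rewrite !mem_cat ep !orbT eE sE.
Qed.

End Grow.

Lemma behead_posl_perm (M : cmap) (d : M) t : nend t d = d ->
  perm_eq (behead (pos t d)) (posl t d).
Proof.
move=> td; have := perm_refl (pos t d).
by rewrite {1}pos_head pos_rcons td -cats1 perm_sym perm_catC /= perm_cons perm_sym.
Qed.

Lemma same_shape_net (M : cmap) t t' (x : M) : same_shape t t' ->
  is_net t x = is_net t' x /\ nend t x = nend t' x.
Proof.
elim: t t' x => [b|b l IHl r IHr s IHs] [b'|b' l' r' s'] x //=.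
case/and3P=> /IHl el /IHr er /IHs es.
have [-> ->] := el (lside x); have [-> ->] := er (rside x).
have sE : snext r x = snext r' x by rewrite /snext (er _).2.
by rewrite sE; have [-> ->] := es (snext r' x).
Qed.

Lemma net_obtained t : 0 < nodes t -> exists (M : cmap) (d : M),
  [/\ obtained_by_openings M, closed_net d t & stacked M (nodes t).-1].
Proof.
have [k] := ubnP (nodes t); elim: k t => // k IHk t tk t_gt0.
have [t0 t0t] := grow_ex t_gt0; have tE := grow_nodes t0t.
have [t00|t0_gt0] := posnP (nodes t0).
  have [pM lM fM] := base_planar; have S := stacked_base pM lM fM.
  pose d : base_map := (false, ord0); exists base_map, d; rewrite tE t00.
  have [t' [tN td] t'1] := st_net S d; split=> //; first exact: base_obtained.
  have /(same_shape_net d)[eN eE] : same_shape t t'.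
    move: tE t'1; rewrite t00; case: (t) (t') => [?|b l r s] [?|b' l' r' s'] //= tE t'E.
    have l0 : nodes l = 0 by lia.
    have r0 : nodes r = 0 by lia.
    have s0 : nodes s = 0 by lia.
    have l'0 : nodes l' = 0 by lia.
    have r'0 : nodes r' = 0 by lia.
    have s'0 : nodes s' = 0 by lia.
    by case: l r s l' r' s' l0 r0 s0 l'0 r'0 s'0 {tE t'E} => [?|//] [?|//] [?|//] [?|//] [?|//] [?|//].
  by split; rewrite ?eN ?eE.
have [M [d [oM [tN td] sM]]] : exists (M : cmap) (d : M),
    [/\ obtained_by_openings M, closed_net d t0 & stacked M (nodes t0).-1].
  by apply: IHk => //; rewrite -ltnS -tE.
have P : pres d t0 by apply: stacked_pres sM _ _ => //; rewrite prednK.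
have u : edge_uniq (behead (pos t0 d)).
  by apply: edge_uniq_perm (pres_uniq P); rewrite perm_sym behead_posl_perm.
have [_ /(_ t0_gt0 u)[e [_ eN eE]]] := grow_net t0t tN.
exists (open_edge e), (keep e d); split; first exact: ObtainedOpen.
  by split; rewrite // eE td.
by rewrite tE /= -[X in stacked _ X](prednK t0_gt0); apply: stacked_open.
Qed.

Lemma net_exists t : 0 < nodes t ->
  exists (M : cmap) (d : M), hierarchical_triangulation M /\ pres d t.
Proof.
move=> t0; have [M [d [oM tN sM]]] := net_obtained t0; exists M, d.
split; first by split=> //; apply: stacked_planar sM.
by apply: stacked_pres sM tN _; rewrite prednK.
Qed.

(** * Spanning trees *)

Section Trees.

Variable M : cmap.
Implicit Types (T : {set M}) (x y z u v : M) (c p : seq M).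

Definition comps T := n_comp (step T) M.

Lemma comps0 : comps set0 = nb_vertices M.
Proof.
apply: eq_n_comp => x y; apply: eq_connect => u v.
by rewrite /step /= in_set0 orbF eq_sym.
Qed.

Definition cut T x : {set M} := T :\: [set x; edge x].

Lemma in_cut T x y : (y \in cut T x) = [&& y != x, y != edge x & y \in T].
Proof. by rewrite !inE negb_or andbA. Qed.

Lemma edge_set_cut T x : edge_set T -> edge_set (cut T x).
Proof.
move=> eT y; rewrite !in_cut eT (inj_eq (@edge_inj M)) andbCA; congr (_ && (_ && _)).
by rewrite -{1}[x]edgeK (inj_eq (@edge_inj M)).
Qed.

Lemma card_cut T x : edge_set T -> x \in T -> #|T| = #|cut T x| + 2.
Proof.
move=> eT xT; rewrite -(cardsID [set x; edge x] T) addnC; congr (_ + _).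
rewrite (setIidPr _) ?cards2 1?eq_sym ?edge_neq //.
by apply/subsetP => y; rewrite !inE => /orP[]/eqP-> //; rewrite eT.
Qed.

Lemma sub_connect T T' : T \subset T' -> forall x y,
  connect (step T) x y -> connect (step T') x y.
Proof.
move/subsetP=> TT'; apply: connect_sub => x y /orP[xy|/andP[/TT' xT xy]].
  by apply: connect1; rewrite /step /= xy.
by apply: connect1; rewrite /step /= xT xy orbT.
Qed.

Lemma connect_org T x y : org x = org y -> connect (step T) x y.
Proof.
move/eqP; rewrite -same_vertexE; apply: connect_sub => u v /eqP <-.
by apply: connect1; rewrite /step /= eqxx.
Qed.

(** A path can be shortened so as to cross the removed edge at most once, in one of its two
    directions. *)
Lemma connect_cut T x u v : edge_set T -> x \in T ->
  connect (step T) u v =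
  [|| connect (step (cut T x)) u v,
      connect (step (cut T x)) u x && connect (step (cut T x)) (edge x) v
    | connect (step (cut T x)) u (edge x) && connect (step (cut T x)) x v].
Proof.
move=> eT xT; set e := connect (step (cut T x)).
have eeT : subrel e (connect (step T)) by apply: sub_connect; apply: subsetDl.
have exT : connect (step T) x (edge x) by apply: connect_edge.
have exT' : connect (step T) (edge x) x by rewrite step_sym.
apply/idP/idP; last first.
  case/or3P=> [/eeT //|/andP[/eeT ux /eeT xv]|/andP[/eeT ux /eeT xv]].
    by apply: connect_trans ux (connect_trans exT xv).
  by apply: connect_trans ux (connect_trans exT' xv).
have e1 y z : step (cut T x) y z -> e y z by apply: connect1.
have et y z w : e y z -> e z w -> e y w by apply: connect_trans.
have e0 y : e y y by apply: connect0.
case/connectP=> p; elim: p u => [|w p IHp] u.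
  by move=> _ ->; apply/or3P; constructor 1; apply: e0.
rewrite [path _ _ _]/= [last _ _]/= => /andP[uw pw] /(IHp _ pw){IHp pw}IHp.
have [/e1 euw|] := boolP (step (cut T x) u w).
  case/or3P: IHp => [h|/andP[h h']|/andP[h h']]; apply/or3P.
  - by constructor 1; apply: et h.
  - by constructor 2; rewrite h' andbT; apply: et h.
  - by constructor 3; rewrite h' andbT; apply: et h.
move: uw; rewrite /step /= in_cut; case: eqP => //= _ /andP[uT /eqP wu].
rewrite uT wu eqxx !andbT negb_and !negbK => /orP[]/eqP ux.
  move: IHp; rewrite wu ux => /or3P[h|/andP[h h']|/andP[h h']]; apply/or3P.
  - by constructor 2; rewrite e0.
  - by constructor 2; rewrite e0.
  - by constructor 1.
move: IHp; rewrite wu ux edgeK => /or3P[h|/andP[h h']|/andP[h h']]; apply/or3P.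
- by constructor 3; rewrite e0.
- by constructor 1.
- by constructor 3; rewrite e0.
Qed.

Lemma comps_cut T x : edge_set T -> x \in T ->
  comps (cut T x) = comps T + ~~ connect (step (cut T x)) x (edge x).
Proof.
move=> eT xT; have C u v := connect_cut u v eT xT.
have eT' := edge_set_cut x eT; have s' := step_sym eT'; have s := step_sym eT.
set e' := step (cut T x) in C s' *; set e := step T in C s *.
have [h|h] := boolP (connect e' x (edge x)); rewrite /= ?addn0 ?addn1.
  apply: eq_n_comp => u v; rewrite C; case: (boolP (connect e' u v)) => //= nuv.
  apply/esym/negbTE; apply: contra nuv => /orP[]/andP[ux xv].
    exact: connect_trans ux (connect_trans h xv).
  by apply: connect_trans ux _; rewrite s' in h; apply: connect_trans h xv.
have sub u v : connect e' u v -> connect e u v by rewrite C => ->.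
(* Restoring the edge merges only the components of [x] and [edge x]; once the root of the latter is
   dropped, [root e] is a bijection from the other roots of [e'] onto those of [e]. *)
pose r := root e' (edge x); pose A := [predD1 (roots e') & r].
have rR y : root e' y \in roots e' by apply: roots_root.
rewrite /comps /n_comp_mem; transitivity #|A|.+1.
  have rr : r \in predI (roots e') M by apply/andP; split=> //; apply: rR.
  by rewrite (cardD1 r) rr add1n; congr _.+1; apply: eq_card => y; rewrite !inE ?andbT.
congr _.+1; rewrite -(card_in_image (f := root e) (A := A)).
  apply: eq_card => y; rewrite [RHS]inE /= ?andbT; apply/imageP/idP => [[z _ ->]|yR].
    exact: roots_root.
  have yE : y = root e y by apply/esym/eqP.
  have [er|ner] := eqVneq (root e' y) r; last first.
    exists (root e' y); first by rewrite inE /= ner; apply: rR.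
    by rewrite {1}yE; apply/(rootP s)/sub/connect_root.
  exists (root e' x).
    rewrite inE /=; apply/andP; split; last exact: rR.
    by apply: contra h => /eqP h; apply/(rootP s').
  rewrite {1}yE; apply/(rootP s).
  apply: (connect_trans (y := edge x)); first by apply/sub/(rootP s').
  apply: (connect_trans (y := x)); last exact/sub/connect_root.
  by rewrite C !connect0 !orbT.
move=> u v; rewrite !inE => /andP[ur /eqP uR] /andP[vr /eqP vR] /(rootP s).
rewrite C => /or3P[/(rootP s')|/andP[_ /(rootP s')]|/andP[/(rootP s') e1 _]].
- by rewrite uR vR.
- by rewrite vR => e1; rewrite -e1 eqxx in vr.
- by rewrite uR in e1; rewrite e1 eqxx in ur.
Qed.

Lemma edge_set_ind (P : {set M} -> Prop) : P set0 ->
  (forall T x, edge_set T -> x \in T -> P (cut T x) -> P T) ->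
  forall T, edge_set T -> P T.
Proof.
move=> P0 Pc T; have [k] := ubnP #|T|; elim: k T => // k IHk T Tk eT.
have [->//|[x xT]] := set_0Vmem T.
apply: (Pc _ x) => //; apply: IHk; last exact: edge_set_cut.
by move: Tk; rewrite (card_cut eT xT); lia.
Qed.

Lemma comps_ge T : edge_set T -> 2 * nb_vertices M <= 2 * comps T + #|T|.
Proof.
move: T; apply: edge_set_ind; first by rewrite comps0 cards0 addn0.
move=> T x eT xT; rewrite comps_cut // (card_cut eT xT).
by case: (connect _ _ _); lia.
Qed.

(** Distinct vertices force distinct edges: a later dart on the edge of the first one would have the
    starting vertex [u] among its ends. *)
Lemma path_darts T u p : edge_set T ->
  path [rel a b | [exists d in T, (org d == a) && (tgt d == b)]] u p -> uniq (u :: p) ->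
  exists c, [/\ {subset c <= T}, map (@org M) c = belast u p, map (@tgt M) c = p
    & uniq [seq froot (@edge M) x | x <- c]].
Proof.
move=> eT; elim: p u => [|v p IHp] u; first by exists [::].
rewrite [path _ _ _]/= => /andP[/exists_inP[d dT /andP[/eqP du /eqP dv]] pv].
rewrite [uniq _]/= => /andP[uvp uvp']; have [c [cT co ct uc]] := IHp _ pv uvp'.
exists (d :: c); split.
- by move=> y; rewrite inE => /orP[/eqP->|/cT].
- by rewrite /= du co.
- by rewrite /= dv ct.
rewrite /= uc andbT; apply/mapP => -[z zc /eqP].
rewrite root_connect; last by apply: fconnect_sym; apply: edge_inj.
have zo : org z \in v :: p by rewrite lastI mem_rcons inE -co map_f ?orbT.
have zt : tgt z \in v :: p by rewrite inE -ct map_f ?orbT.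
have dz y : fconnect (@edge M) d y -> y = d \/ y = edge d.
  rewrite (fconnect_cycle (p := [:: d; edge d])) ?mem_head //; last by rewrite /= edgeK !eqxx.
  by rewrite !inE => /orP[]/eqP; [left|right].
by case/dz=> zd; move: zo zt; rewrite zd ?tgt_edge du (negbTE uvp).
Qed.

(** The connection is projected to a walk on vertices, shortened to a simple path, lifted back to
    darts and closed by [x]. *)
Lemma cycle_of_connect T x : edge_set T -> x \notin T -> connect (step T) (edge x) x ->
  exists c, graph_cycle (x :: c) /\ {subset c <= T}.
Proof.
move=> eT xT; set adj := [rel a b | [exists d in T, (org d == a) && (tgt d == b)]].
have C u v : connect (step T) u v -> connect adj (org u) (org v).
  case/connectP=> p; elim: p u => [|w p IHp] u /=; first by move=> _ ->; apply: connect0.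
  case/andP=> uw /IHp{}IHp /IHp; apply: connect_trans.
  move: uw; rewrite /step /= => /orP[/eqP->|/andP[uT /eqP->]].
    by rewrite org_node connect0.
  by apply: connect1; apply/exists_inP; exists u; rewrite // !eqxx.
case/C/connectP=> p0 /shortenP[p pp up _] pl.
have [c [cT co ct uc]] := path_darts eT pp up; exists c; split=> //; split=> //.
- rewrite [cycle _ _]/=.
  suff h : forall y u q c', tgt y = u -> map (@org M) c' = belast u q ->
      map (@tgt M) c' = q -> last u q = org x ->
      path (fun a b => same_vertex (edge a) b) y (rcons c' x).
    exact: h co ct (esym pl).
  move=> y u q c'; elim: c' q y u => [|d c' IHc] q y u yu.
    by case: q => //= _ _ xu; rewrite same_vertexE org_edge yu xu eqxx.
  case: q => [|v q] //= [du co'] [dv ct'] xl.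
  by rewrite same_vertexE org_edge yu du eqxx; apply: IHc ct' xl.
- rewrite -[map _ _]/(org x :: map (@org M) c) co pl cons_uniq -rcons_uniq.
  by rewrite -lastI.
rewrite /= uc andbT; apply/mapP => -[z /cT zT /eqP].
rewrite root_connect; last by apply: fconnect_sym; apply: edge_inj.
rewrite (fconnect_cycle (p := [:: x; edge x])) ?mem_head //; last by rewrite /= edgeK !eqxx.
by rewrite !inE => /orP[]/eqP zx; move: zT; rewrite zx ?eT (negbTE xT).
Qed.

(** In a forest each edge removed creates a component. Everything is doubled because [#|T|] counts
    darts, two per edge. *)
Lemma acyclic_comps T : edge_set T -> acyclic T -> 2 * comps T + #|T| = 2 * nb_vertices M.
Proof.
move: T; apply: edge_set_ind; first by rewrite comps0 cards0 addn0.
move=> T x eT xT IH aT; have eT' := edge_set_cut x eT.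
have {}IH : 2 * comps (cut T x) + #|cut T x| = 2 * nb_vertices M.
  apply: IH => c cT; apply: aT => y /cT; rewrite in_cut; by case/and3P.
move: IH; rewrite comps_cut // (card_cut eT xT).
suff /negbTE-> : ~~ connect (step (cut T x)) x (edge x) by lia.
apply/negP; rewrite step_sym // => /(cycle_of_connect eT')[|c [cc cT]].
  by rewrite in_cut eqxx.
apply: aT cc => y; rewrite inE => /orP[/eqP->//|/cT]; rewrite in_cut; by case/and3P.
Qed.

Lemma connect_cycle T x c : edge_set T -> {subset x :: c <= T} -> graph_cycle (x :: c) ->
  connect (step (cut T x)) (edge x) x.
Proof.
move=> eT cT [_ + _]; rewrite [cycle _ _]/= => pc /= /andP[xc _].
have {xc cT}cT z : z \in c -> z \in cut T x.
  move=> zc; rewrite in_cut cT ?inE ?zc ?orbT // andbT.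
  have h : froot (@edge M) x != froot (@edge M) z.
    by apply: contraNneq xc => ->; apply: map_f.
  apply/andP; split; apply: contraNneq h => -> //.
  rewrite root_connect; first exact: fconnect1.
  by apply: fconnect_sym; apply: edge_inj.
move: pc; move: {1 4}x => y; elim: c y cT => [|z c IHc] y cT /=.
  by rewrite andbT same_vertexE => /eqP; apply: connect_org.
rewrite same_vertexE => /andP[/eqP yz pc]; apply: connect_trans (connect_org _ yz) _.
apply: (connect_trans (y := edge z)); first by apply: connect_edge; rewrite ?connect0 ?cT ?mem_head.
by apply: IHc => // u uc; apply: cT; rewrite inE uc orbT.
Qed.

Lemma comps1 T (d : M) : edge_set T -> (forall x y, connect (step T) x y) -> comps T = 1.
Proof.
move=> eT cT; rewrite -(n_comp_connect (step_sym eT) d).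
by apply: eq_card => x; rewrite !inE cT.
Qed.

(** Conversely, if a cycle existed, removing one of its edges would keep the set connected with too
    few edges for [comps_ge]. *)
Lemma spanning_treeP T (d : M) : spanning_tree T <->
  [/\ edge_set T, forall x y, connect (step T) x y & #|T| + 2 = 2 * nb_vertices M].
Proof.
split=> [[eT cT aT]|[eT cT sT]]; split=> //.
  by rewrite -(acyclic_comps eT aT) (comps1 d) // addnC.
case=> [|x c] cc; first by case.
move=> gc; have xT : x \in T by apply: cc; rewrite mem_head.
have := comps_ge (edge_set_cut x eT).
rewrite comps_cut // (comps1 d) // step_sym ?(connect_cycle eT cc gc) //; last exact: edge_set_cut.
by rewrite -sT (card_cut eT xT); lia.
Qed.

End Trees.

(** * Spanning trees in nets *)

Fixpoint conn t : bool :=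
  match t with
  | Leaf b => b
  | Node b l r s => [|| b, conn l && conn r | conn s]
  end.

Definition leaf_true t : bool := if t is Leaf b then b else false.

(** Each inserted vertex is linked to at least one end of its net. *)
Fixpoint ok t : bool :=
  if t is Node _ l r s then [&& conn l || conn r, ok l, ok r & ok s] else true.

Fixpoint simple_lab t : bool :=
  if t is Node b l r s then
    [&& ~~ b, ~~ leaf_true s, simple_lab l, simple_lab r & simple_lab s]
  else true.

Fixpoint labs t : nat :=
  match t with Leaf b => b | Node b l r s => b + labs l + labs r + labs s end.

(** The edge of a node and a leaf ending its chain have a parallel edge, hence no label; the
    inserted vertex must be linked to an end; joining the ends both through it and through the tail
    would close a cycle. *)
Fixpoint good t : bool :=
  if t is Node b l r s then
    [&& ~~ b, ~~ leaf_true s, conn l || conn r, ~~ [&& conn l, conn r & conn s],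
        good l, good r & good s]
  else true.

(** In a closed net the final leaf is the root edge itself, hence the two equal labels, and a longer
    root chain would put the root on a 2-cycle. Since the root already joins the ends, the inserted
    vertex hangs from exactly one of them. *)
Definition root_good t : bool :=
  if t is Node true l r (Leaf true) then [&& good l, good r & conn l (+) conn r]
  else false.

Lemma ok_labs t : ok t -> nodes t + conn t <= labs t.
Proof.
elim: t => //= b l IHl r IHr s IHs /and4P[c /IHl{}IHl /IHr{}IHr /IHs{}IHs].
by move: c IHl IHr IHs; case: b (conn l) (conn r) (conn s) => [] [] [] [] //=; lia.
Qed.

(** Equality in the bound of [ok_labs] for the whole net forces equality in each subnet and excludes
    the redundant links, that is, the cycles. *)
Lemma goodP t : good t = [&& ok t, simple_lab t & labs t == nodes t + conn t].
Proof.
elim: t => [b|b l IHl r IHr s IHs] /=; first by rewrite add0n eqxx.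
rewrite IHl IHr IHs; move: (@ok_labs l) (@ok_labs r) (@ok_labs s).
case: (ok l) (ok r) (ok s) => [] [] [] /= hl hr hs; rewrite ?andbF //=.
case: b (leaf_true s) (simple_lab l) (simple_lab r) (simple_lab s) => [] [] [] [] []; rewrite ?andbF //=.
move: {hl hr hs} (hl isT) (hr isT) (hs isT) => hl hr hs; rewrite add0n.
move: (nodes l) (nodes r) (nodes s) (labs l) (labs r) (labs s) hl hr hs => nl nr ns ll lr ls hl hr hs.
clear IHl IHr IHs; rewrite andbT; apply/idP/andP => [/and5P[c1 c2 /eqP-> /eqP-> /eqP->]|[c1 /eqP e]].
  split=> //; apply/eqP; clear hl hr hs; move: c1 c2.
  by case: (conn l) (conn r) (conn s) => [] [] [] //= _ _; lia.
rewrite c1 /=; move: (conn l) (conn r) (conn s) hl hr hs e c1 => cl cr cs hl hr hs e c1; clear l r s.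
by move: cl cr cs c1 hl hr hs e => [] [] [] //= _ hl hr hs e;
  try (exfalso; lia); apply/and3P; split; apply/eqP; lia.
Qed.

Section Labels.

Variables (M : cmap) (T : {set M}).
Hypothesis tri : triangular M.
Implicit Types (x y z p q : M) (t l r s : net) (g : M -> bool).

Local Notation labelled t x := (lab T t x = t).

Lemma labelled_Node b l r s x : labelled (Node b l r s) x ->
  [/\ (x \in T) = b, labelled l (lside x), labelled r (rside x) & labelled s (snext r x)].
Proof. by case. Qed.

Lemma labsE t x : labelled t x -> labs t = count (mem T) (pos t x).
Proof.
elim: t x => [b|b l IHl r IHr s IHs] x; first by case=> <- /=; rewrite addn0.
case/labelled_Node=> <- /IHl el /IHr er /IHs es /=.
by rewrite !count_cat -/(snext r x) -el -er -es !addnA.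
Qed.

(* A two-colouring of the vertices that is constant along the edges of [T]
   witnesses that [T] is not connected. *)
Definition respects g (p : seq M) := {in p, forall z, z \in T -> g (org z) = g (tgt z)}.

(** [g0] prescribes the colours outside the inserted vertices, in particular at the ends. *)
Definition colors t x g0 g :=
  (forall u, u \notin apices t x -> g u = g0 u) /\ respects g (pos t x).

Lemma fresh_org t x : fresh t x -> org x \notin apices t x.
Proof. by rewrite /fresh /hull /= inE negb_or => /and3P[/andP[]]. Qed.

Lemma fresh_tgt t x : fresh t x -> tgt x \notin apices t x.
Proof. by rewrite /fresh /hull /= => /and3P[]. Qed.

Lemma respects_eq t x g g' : is_net t x -> {in hull t x, g =1 g'} ->
  respects g (pos t x) -> respects g' (pos t x).
Proof.
move=> tN e h z zp zT; have [oz tz] := pos_hull tri tN zp.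
by rewrite -(e _ oz) -(e _ tz) h.
Qed.

(** Sibling hulls meet only at [org x], [tgt x] and [apex x], where all three colourings agree with
    [g0]; so they can be patched together. *)
Lemma glue b l r s x g0 gl gr gs :
  is_net (Node b l r s) x -> fresh (Node b l r s) x ->
  colors l (lside x) g0 gl -> colors r (rside x) g0 gr -> colors s (snext r x) g0 gs ->
  (x \in T -> g0 (org x) = g0 (tgt x)) ->
  exists g, [/\ colors (Node b l r s) x g0 g, g (apex x) = g0 (apex x),
    {in apices l (lside x), g =1 gl}, {in apices r (rside x), g =1 gr}
    & {in apices s (snext r x), g =1 gs}].
Proof.
move=> tN tF [ol rl] [or rr] [os rs] xT; have F := freshP tri tN tF.
have [lN rN _ sN] := and4P tN.
pose al := apices l (lside x); pose ar := apices r (rside x); pose a_s := apices s (snext r x).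
pose g u := if u \in al then gl u else if u \in ar then gr u else if u \in a_s then gs u else g0 u.
have sub t' x' u : u \in apices t' x' -> u \in hull t' x' by move=> h; rewrite !inE h !orbT.
have apl : apex x \notin al.
  by have := fresh_tgt (fresh_l F); rewrite tgt_lside.
have apr : apex x \notin ar.
  by have := fresh_org (fresh_r F); rewrite org_rside.
have aps : apex x \notin a_s by apply: contra (fresh_as F) => /sub.
have [sO sT] := snext_ends tri tN.
have orl : org x \notin al by have := fresh_org (fresh_l F); rewrite org_lside.
have tgr : tgt x \notin ar by have := fresh_tgt (fresh_r F); rewrite tgt_rside.
have ors : org x \notin a_s by have := fresh_org (fresh_s F); rewrite sO.
have tgs : tgt x \notin a_s by have := fresh_tgt (fresh_s F); rewrite sT.
have orr : org x \notin ar by apply: contra (fresh_or F) => /sub.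
have tgl : tgt x \notin al by apply: contra (fresh_tl F) => /sub.
have gE u : u \notin al -> u \notin ar -> u \notin a_s -> g u = g0 u.
  by rewrite /g => /negbTE-> /negbTE-> /negbTE->.
have hl : {in hull l (lside x), gl =1 g}.
  move=> u ul; rewrite /g; case: ifP => // /negbT nul; rewrite ol //.
  have [ur|_] := boolP (u \in ar).
    by have := fresh_lr F ul (sub _ _ _ ur) => ue; rewrite ue (negbTE apr) in ur.
  have [us|//] := boolP (u \in a_s).
  by have := fresh_ls F ul (sub _ _ _ us) => ue; rewrite ue (negbTE ors) in us.
have hr : {in hull r (rside x), gr =1 g}.
  move=> u ur; rewrite /g; have [ul|_] := boolP (u \in al).
    by have := fresh_lr F (sub _ _ _ ul) ur => ue; rewrite ue (negbTE apl) in ul.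
  case: ifP => // /negbT nur; rewrite or //.
  have [us|//] := boolP (u \in a_s).
  by have := fresh_rs F ur (sub _ _ _ us) => ue; rewrite ue (negbTE tgs) in us.
have hs : {in hull s (snext r x), gs =1 g}.
  move=> u us; rewrite /g; have [ul|_] := boolP (u \in al).
    by have := fresh_ls F (sub _ _ _ ul) us => ue; rewrite ue (negbTE orl) in ul.
  have [ur|_] := boolP (u \in ar).
    by have := fresh_rs F (sub _ _ _ ur) us => ue; rewrite ue (negbTE tgr) in ur.
  by case: ifP => // /negbT nus; rewrite os.
exists g; split.
- split=> [u|z]; first by rewrite [apices _ _]/= inE !mem_cat !negb_or => /and4P[_ *]; apply: gE.
  rewrite [pos _ _]/= inE !mem_cat => /or4P[/eqP->|zp|zp|zp].
  + by move/xT; rewrite !gE.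
  + exact: (respects_eq lN hl rl zp).
  + exact: (respects_eq rN hr rr zp).
  + exact: (respects_eq sN hs rs zp).
- exact: gE.
- by move=> u /sub/hl.
- by move=> u /sub/hr.
- by move=> u /sub/hs.
Qed.

(** Any colouring of the ends extends inwards unless the labels join the ends; this is what makes
    [conn] a criterion for separation. *)
Lemma coloring t x g0 : is_net t x -> fresh t x -> labelled t x ->
  (conn t -> g0 (org x) = g0 (tgt x)) -> exists g, colors t x g0 g.
Proof.
elim: t x g0 => [b|b l IHl r IHr s IHs] x g0.
  move=> _ _ [bT] cb; exists g0; split=> // z; rewrite inE => /eqP-> xT.
  by apply: cb; rewrite /= -bT.
move=> tN tF /labelled_Node[bT Ll Lr Ls] tc.
have F := freshP tri tN tF; have [lN rN _ sN] := and4P tN.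
have [sO sT] := snext_ends tri tN.
have [oa ta] : org x != apex x /\ tgt x != apex x.
  split; apply: contraNneq (fresh_as F) => <-; by rewrite /hull sO sT !inE eqxx ?orbT.
(* The inserted vertex takes the colour of an end it is linked to; if it is linked to both, [tc]
   says that their colours agree. *)
pose c := if conn l then g0 (org x) else g0 (tgt x).
pose g1 u := if u == apex x then c else g0 u.
have g1o : g1 (org x) = g0 (org x) by rewrite /g1 (negbTE oa).
have g1t : g1 (tgt x) = g0 (tgt x) by rewrite /g1 (negbTE ta).
have g1a : g1 (apex x) = c by rewrite /g1 eqxx.
have [|gl cl] := IHl _ g1 lN (fresh_l F) Ll.
  by rewrite org_lside // tgt_lside // g1o g1a /c => ->.
have [|gr cr] := IHr _ g1 rN (fresh_r F) Lr.
  rewrite org_rside // tgt_rside // g1t g1a /c => rc; case: ifP => // lc.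
  by apply: tc; rewrite /= lc rc orbT.
have [|gs cs] := IHs _ g1 sN (fresh_s F) Ls.
  by rewrite sO sT g1t g1o => sc; apply: tc; rewrite /= sc !orbT.
have [|g [[gE gr'] _ _ _ _]] := glue tN tF cl cr cs.
  by rewrite g1o g1t bT => bt; apply: tc; rewrite /= bt.
exists g; split=> // u un; rewrite gE // /g1; case: eqP => // ue.
by move: un; rewrite ue inE eqxx.
Qed.

(** At a node violating [ok], neither side links the inserted vertex to an end, so it can be
    coloured apart from both. *)
Lemma not_ok_coloring t x : is_net t x -> fresh t x -> labelled t x -> ~~ ok t ->
  exists g, colors t x xpred0 g /\ exists2 w, w \in apices t x & g w.
Proof.
elim: t x => // b l IHl r IHr s IHs x tN tF /labelled_Node[bT Ll Lr Ls].
have F := freshP tri tN tF; have [lN rN _ sN] := and4P tN.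
have [sO sT] := snext_ends tri tN.
have [oa ta] : org x != apex x /\ tgt x != apex x.
  split; apply: contraNneq (fresh_as F) => <-; by rewrite /hull sO sT !inE eqxx ?orbT.
have c0 t' x' : colors t' x' xpred0 xpred0 by [].
rewrite [ok _]/= !negb_and => /or4P[|nl|nr|ns].
- rewrite negb_or => /andP[lc rc]; pose g1 u := u == apex x.
  have g1o : g1 (org x) = false by apply/negbTE.
  have g1t : g1 (tgt x) = false by apply/negbTE.
  have [|gl cl] := coloring (g0 := g1) lN (fresh_l F) Ll; first by rewrite (negbTE lc).
  have [|gr cr] := coloring (g0 := g1) rN (fresh_r F) Lr; first by rewrite (negbTE rc).
  have [|gs cs] := coloring (g0 := g1) sN (fresh_s F) Ls; first by rewrite sO sT g1o g1t.
  have [|g [[gE gr'] ga _ _ _]] := glue tN tF cl cr cs; first by rewrite g1o g1t.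
  exists g; split; last by exists (apex x); rewrite ?inE ?eqxx // ga /g1 eqxx.
  split=> // u un; rewrite gE // /g1; apply/negbTE; apply: contraNneq un => ->.
  by rewrite inE eqxx.
- have [gl [cl [w wl gw]]] := IHl _ lN (fresh_l F) Ll nl.
  have [//|g [cg _ gE _ _]] := glue tN tF cl (c0 _ _) (c0 _ _).
  by exists g; split=> //; exists w; rewrite ?gE // inE !mem_cat wl !orbT.
- have [gr [cr [w wr gw]]] := IHr _ rN (fresh_r F) Lr nr.
  have [//|g [cg _ _ gE _]] := glue tN tF (c0 _ _) cr (c0 _ _).
  by exists g; split=> //; exists w; rewrite ?gE // inE !mem_cat wr !orbT.
- have [gs [cs [w ws gw]]] := IHs _ sN (fresh_s F) Ls ns.
  have [//|g [cg _ _ _ gE]] := glue tN tF (c0 _ _) (c0 _ _) cs.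
  by exists g; split=> //; exists w; rewrite ?gE // inE !mem_cat ws !orbT.
Qed.

Lemma apices_org t x u : u \in apices t x -> org u = u.
Proof.
elim: t x => //= b l IHl r IHr s IHs x; rewrite inE !mem_cat.
by case/or4P=> [/eqP->|/IHl|/IHr|/IHs] //; apply: org_org.
Qed.

Lemma connected_ok t d : pres d t -> edge_set T -> labelled t d ->
  (forall x y, connect (step T) x y) -> ok t.
Proof.
move=> P eT Lt cT; apply/negPn/negP => /(not_ok_coloring (pres_net P) (pres_fresh P) Lt).
case=> g [[gE gr] [w wt gw]].
have gT z : z \in T -> g (org z) = g (tgt z).
  have posl_pos y : y \in posl t d -> y \in pos t d.
    by rewrite pos_rcons mem_rcons inE => ->; rewrite orbT.
  move=> zT; have := pres_cover P z; rewrite mem_cat => /orP[/posl_pos/gr-> //|].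
  by case/mapP=> y /posl_pos/gr gy zy; rewrite zy tgt_edge -gy // -eT -zy.
have inv x y : connect (step T) x y -> g (org x) = g (org y).
  case/connectP=> p; elim: p x => [|z p IHp] x /=; first by move=> _ ->.
  case/andP=> xz /IHp{}IHp /IHp <-; move: xz => /orP[/eqP->|/andP[xT /eqP->]].
    by rewrite org_node.
  by rewrite gT.
have := inv _ _ (cT w d); rewrite (apices_org wt) gw gE //.
exact: fresh_org (pres_fresh P).
Qed.

(** By induction every vertex of a subnet is linked to one of its ends; [ok] then carries the
    inserted vertex on to [org x] or [tgt x]. *)
Lemma ok_connected t x (C := connect (step T)) : edge_set T -> is_net t x -> labelled t x -> ok t ->
  (forall z, z \in pos t x -> (C z x \/ C z (edge x)) /\ (C (edge z) x \/ C (edge z) (edge x))) /\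
  (conn t -> C x (edge x)).
Proof.
move=> eT; have cO u v : org u = org v -> C u v by apply: connect_org.
have cT u v w : C u v -> C v w -> C u w by apply: connect_trans.
have cS u v : C u v -> C v u by rewrite /C step_sym.
have c1 u : u \in T -> C u (edge u) by move=> uT; apply: connect_edge.
clearbody C; elim: t x => [b|b l IHl r IHr s IHs] x.
  move=> _ [bT] _; split; last by rewrite /= -bT; apply: c1.
  by move=> z; rewrite inE => /eqP->; split; [left|right]; apply: cO.
move=> tN /labelled_Node[bT Ll Lr Ls] /and4P[olr okl okr oks].
have [lN rN _ sN] := and4P tN; have [sO sT] := snext_ends tri tN.
have [pl cl] := IHl _ lN Ll okl; have [pr cr] := IHr _ rN Lr okr.
have [ps cs] := IHs _ sN Ls oks.
have xl : C (lside x) x by apply: cO; rewrite org_lside.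
have lr : C (edge (lside x)) (rside x) by apply: cO; rewrite org_edge tgt_lside // org_rside.
have rx : C (edge (rside x)) (edge x) by apply: cO; rewrite !org_edge tgt_rside.
have sx : C (snext r x) x by apply: cO.
have sx' : C (edge (snext r x)) (edge x) by apply: cO.
have ca : C (rside x) x \/ C (rside x) (edge x).
  case/orP: olr => [/cl lc|/cr rc]; [left|right]; last exact: cT rc rx.
  exact: cT (cS _ _ lr) (cT _ _ _ (cS _ _ lc) xl).
have ca' : C (edge (lside x)) x \/ C (edge (lside x)) (edge x).
  by case: ca => h; [left|right]; apply: cT lr h.
have sub u a b' : C u a \/ C u b' -> (C a x \/ C a (edge x)) -> (C b' x \/ C b' (edge x)) ->
    C u x \/ C u (edge x).
  by case=> [ua [ax|ax] _|ub _ [bx|bx]]; [left|right|left|right]; apply: cT; eassumption.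
split.
  move=> z; rewrite inE !mem_cat => /or4P[/eqP->|/pl[h h']|/pr[h h']|/ps[h h']].
  - by split; [left|right]; apply: cO.
  - by split; [apply: sub h _ ca' | apply: sub h' _ ca']; left.
  - by split; [apply: sub h ca _ | apply: sub h' ca _]; right.
  - by split; [apply: sub h _ _ | apply: sub h' _ _]; by [left|right].
case/or3P=> [bt|/andP[/cl lc /cr rc]|/cs sc]; first by apply: c1; rewrite bT.
  exact: cT (cS _ _ xl) (cT _ _ _ lc (cT _ _ _ lr (cT _ _ _ rc rx))).
exact: cT (cS _ _ sx) (cT _ _ _ sc sx').
Qed.

End Labels.

(** * Cycles of length two *)

Section Simple.

Variables (M : cmap) (T : {set M}).
Implicit Types (x y z p q : M) (t l r s : net).

Local Notation labelled t x := (lab T t x = t).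

Lemma eq_edge_orbit x y : (froot (@edge M) x == froot (@edge M) y) = (y == x) || (y == edge x).
Proof.
rewrite root_connect; last by apply: fconnect_sym; apply: edge_inj.
rewrite (fconnect_cycle (p := [:: x; edge x])) ?mem_head ?inE //.
by rewrite /= edgeK !eqxx.
Qed.

(** A cycle of length 2 is a pair of distinct parallel edges that are not loops. *)
Lemma in_2cycleP x : in_2cycle x <->
  exists y, [/\ y != x, y != edge x, org y = org x, tgt y = tgt x & org x != tgt x].
Proof.
split=> [[c [gc sc xc]]|[y [yx yex oy ty ox]]].
  case: c gc sc xc => [|p [|q []]] // [_ + + +] _ xc.
  rewrite /= !inE !same_vertexE !org_edge !andbT -!/(org _) => /andP[/eqP pq /eqP qp] ov.
  rewrite eq_edge_orbit negb_or => /andP[nqp nqep].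
  have n1 : edge p != q by rewrite eq_sym.
  have n2 : p != edge q by rewrite -(inj_eq (@edge_inj M)) edgeK.
  have n3 : edge q != p by rewrite eq_sym.
  have n4 : p != q by rewrite eq_sym.
  have n5 : edge p != edge q by rewrite (inj_eq (@edge_inj M)).
  have n6 : edge q != edge p by rewrite (inj_eq (@edge_inj M)).
  have ep : tgt p = org q := pq; have eq : tgt q = org p := qp.
  have ovt : org p != tgt p by rewrite ep.
  have ovt' : org q != tgt q by rewrite eq eq_sym.
  have ovt1 : tgt p != org p by rewrite eq_sym.
  have ovt1' : tgt q != org q by rewrite eq_sym.
  move: xc; rewrite !inE -orbA => /or4P[/eqP->|/eqP->|/eqP e|/eqP e].
  - by exists (edge q); rewrite org_edge tgt_edge.
  - by exists (edge p); rewrite org_edge tgt_edge.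
  - have -> : x = edge p by rewrite -e edgeK.
    by exists q; rewrite org_edge tgt_edge edgeK.
  - have -> : x = edge q by rewrite -e edgeK.
    by exists p; rewrite org_edge tgt_edge edgeK.
exists [:: x; edge y]; split; rewrite ?inE ?eqxx //; split=> //.
- by rewrite /= !same_vertexE !org_edge tgt_edge ty oy !eqxx.
- by rewrite /= !inE andbT -!/(org _) org_edge ty.
rewrite /= !inE andbT eq_edge_orbit negb_or (inj_eq (@edge_inj M)) yx andbT.
by rewrite -(inj_eq (@edge_inj M)) edgeK yex.
Qed.

Hypothesis tri : triangular M.

Definition parallel p q := org p != tgt p /\
  ((org p = org q /\ tgt p = tgt q) \/ (org p = tgt q /\ tgt p = org q)).

Lemma parallelC p q : parallel p q -> parallel q p.
Proof. by case=> np [[e1 e2]|[e1 e2]]; split; rewrite -?e1 -?e2 // 1?eq_sym //; [left|right]. Qed.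

(** Parallel edges share two distinct vertices, so they cannot lie in two parts that meet in a
    single vertex. *)
Lemma parallel_sep p q u (A B : pred M) :
  (forall w, A w -> B w -> w = u) -> A (org p) -> A (tgt p) -> B (org q) -> B (tgt q) ->
  ~ parallel p q.
Proof.
move=> AB Ao At Bo Bt [/eqP np H]; apply: np.
have [Bo' Bt'] : B (org p) /\ B (tgt p) by case: H => -[-> ->].
by rewrite (AB _ Ao Bo') (AB _ At Bt').
Qed.

Lemma parallel_cross b l r s x p q :
  is_net (Node b l r s) x -> fresh (Node b l r s) x -> parallel p q ->
  [/\ p \in pos l (lside x) -> q \in pos r (rside x) -> False,
      p \in pos l (lside x) -> q \in x :: pos s (snext r x) -> False
    & p \in pos r (rside x) -> q \in x :: pos s (snext r x) -> False].
Proof.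
move=> tN tF pq; have F := freshP tri tN tF; have [lN rN _ sN] := and4P tN.
have [sO sT] := snext_ends tri tN.
have hs z : z \in x :: pos s (snext r x) ->
    org z \in hull s (snext r x) /\ tgt z \in hull s (snext r x).
  rewrite inE => /orP[/eqP->|/(pos_hull tri sN)//].
  by rewrite /hull sO sT !inE !eqxx orbT.
split.
- move=> /(pos_hull tri lN)[po pt] /(pos_hull tri rN)[qo qt].
  exact: (@parallel_sep p q _ [in hull l (lside x)] [in hull r (rside x)] (fresh_lr F)).
- move=> /(pos_hull tri lN)[po pt] /hs[qo qt].
  exact: (@parallel_sep p q _ [in hull l (lside x)] [in hull s (snext r x)] (fresh_ls F)).
- move=> /(pos_hull tri rN)[po pt] /hs[qo qt].
  exact: (@parallel_sep p q _ [in hull r (rside x)] [in hull s (snext r x)] (fresh_rs F)).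
Qed.

Lemma parallel_classes b l r s x p q :
  is_net (Node b l r s) x -> fresh (Node b l r s) x -> parallel p q ->
  p \in pos (Node b l r s) x -> q \in pos (Node b l r s) x ->
  [\/ p \in pos l (lside x) /\ q \in pos l (lside x),
      p \in pos r (rside x) /\ q \in pos r (rside x)
    | p \in x :: pos s (snext r x) /\ q \in x :: pos s (snext r x)].
Proof.
move=> tN tF pq; have [lr ls rs] := parallel_cross tN tF pq.
have [lr' ls' rs'] := parallel_cross tN tF (parallelC pq).
have C z : z \in pos (Node b l r s) x -> [|| z \in pos l (lside x), z \in pos r (rside x)
    | z \in x :: pos s (snext r x)].
  by rewrite [pos _ _]/= !inE !mem_cat; case/or4P=> ->; rewrite ?orbT.
move=> /C/or3P[]hp /C/or3P[]hq; try by [constructor 1|constructor 2|constructor 3].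
- by case: (lr hp hq).
- by case: (ls hp hq).
- by case: (lr' hq hp).
- by case: (rs hp hq).
- by case: (ls' hq hp).
- by case: (rs' hq hp).
Qed.

Lemma parallel_eq t x p q : is_net t x -> fresh t x -> labelled t x -> simple_lab t ->
  p \in pos t x -> q \in pos t x -> p \in T -> parallel p q -> p = q.
Proof.
elim: t x p q => [b|b l IHl r IHr s IHs] x p q.
  by rewrite !inE => _ _ _ _ /eqP-> /eqP->.
move=> tN tF /labelled_Node[bT Ll Lr Ls] /and5P[nb nls sl sr ss] pt qt pT pq.
have F := freshP tri tN tF; have [lN rN _ sN] := and4P tN.
have [sO sT] := snext_ends tri tN.
case: (parallel_classes tN tF pq pt qt) => -[hp hq].
- exact: IHl lN (fresh_l F) Ll sl hp hq pT pq.
- exact: IHr rN (fresh_r F) Lr sr hp hq pT pq.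
have px : p \in pos s (snext r x).
  by move: hp; rewrite inE => /orP[/eqP px|//]; rewrite -px pT in bT; rewrite -bT in nb.
have IH q' := IHs _ _ q' sN (fresh_s F) Ls ss px.
move: hq; rewrite inE => /orP[/eqP qx|hq]; last exact: IH.
(* As [x] is parallel to [snext r x], induction identifies [p] with the first edge of [s], which
   [simple_lab] leaves unlabelled whether [s] is a leaf or a node. *)
have pn : parallel p (snext r x).
  by case: pq => np; rewrite qx => h; split; rewrite ?sO ?sT.
have := IH _ (mem_pos_head _ _) pT pn => pE.
case: s nls Ls ss {IHs IH tN tF F sN qt pt hp px} => [b'|b' l' r' s'] /= nls.
  by case=> bT'; rewrite -bT' -pE pT in nls.
by case=> bT' _ _ _; rewrite -pE pT in bT' *; rewrite -bT'.
Qed.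

Lemma chain_2cycle b l r s x : is_net (Node b l r s) x -> fresh (Node b l r s) x ->
  snext r x != x -> snext r x != edge x -> in_2cycle x /\ in_2cycle (snext r x).
Proof.
move=> tN tF nx nex; have F := freshP tri tN tF; have [sO sT] := snext_ends tri tN.
have ot := fresh_ends F.
split; apply/in_2cycleP; first by exists (snext r x).
exists x; rewrite sO sT; split=> //; first by rewrite eq_sym.
by rewrite -(inj_eq (@edge_inj M)) edgeK eq_sym.
Qed.

Lemma edge_uniq_head p ps : edge_uniq (p :: ps) -> forall q, q \in ps -> q != p /\ q != edge p.
Proof.
move=> u q qp; have qq : q \in p :: ps by rewrite inE qp orbT.
have pp : p \in p :: ps by rewrite mem_head.
have nqp : q != p.
  by move: u; rewrite /edge_uniq /= => /andP[]; rewrite mem_cat negb_or => /andP[/(memPn)h _] _; apply: h.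
split=> //; apply: contra nqp => /eqP qe; apply/eqP.
by apply: (edge_uniq_opened u pp qq); rewrite /opened qe eqxx orbT.
Qed.

Lemma simple_labP t x : is_net t x -> fresh t x -> edge_uniq (pos t x) ->
  labelled t x -> (forall z, z \in T -> ~ in_2cycle z) -> simple_lab t.
Proof.
move=> + + + + Ts; elim: t x => // b l IHl r IHr s IHs x tN tF tu.
case/labelled_Node=> bT Ll Lr Ls; have F := freshP tri tN tF; have [lN rN _ sN] := and4P tN.
have sub t' x' : subseq (pos t' x') (pos l (lside x) ++ pos r (rside x) ++ pos s (snext r x)) ->
    edge_uniq (pos t' x').
  by move=> h; apply: edge_uniq_sub tu; apply: subseq_trans h (subseq_cons _ _).
have lu : edge_uniq (pos l (lside x)) by apply/sub/prefix_subseq.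
have ru : edge_uniq (pos r (rside x)).
  by apply/sub/(subseq_trans (prefix_subseq _ _))/suffix_subseq.
have su : edge_uniq (pos s (snext r x)).
  by apply/sub/(subseq_trans (suffix_subseq _ _))/suffix_subseq.
have [nx nex] : snext r x != x /\ snext r x != edge x.
  by apply: (edge_uniq_head tu); rewrite !mem_cat mem_pos_head !orbT.
have [c1 c2] := chain_2cycle tN tF nx nex.
rewrite /= (IHl _ lN (fresh_l F) lu Ll) (IHr _ rN (fresh_r F) ru Lr) (IHs _ sN (fresh_s F) su Ls).
rewrite !andbT; apply/andP; split; first by apply/negP; rewrite -bT => /Ts.
case: (s) Ls => //= b' [<-]; by apply/negP => /Ts.
Qed.

Lemma mem_posl_pos t x z : z \in posl t x -> z \in pos t x.
Proof. by rewrite pos_rcons mem_rcons inE => ->; rewrite orbT. Qed.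

Lemma card_labels t d : pres d t -> edge_set T -> #|T| = 2 * count (mem T) (posl t d).
Proof.
move=> P eT; have e : enum M =i darts t d by move=> z; rewrite mem_enum (pres_cover P).
have /permP/(_ (mem T)) : perm_eq (enum M) (darts t d).
  by apply: uniq_perm => //; [apply: enum_uniq | apply: pres_uniq].
have -> : count (mem T) (enum M) = #|T| by rewrite cardE -size_filter; congr size; rewrite enumT.
have eq : count (preim (@edge M) (mem T)) (posl t d) = count (mem T) (posl t d).
  by apply: eq_count => z; apply: eT.
by rewrite count_cat count_map eq addnn mul2n.
Qed.

(** Connectedness corresponds to [ok], absence of 2-cycles to [simple_lab], and acyclicity to the
    number of labels; [goodP] combines the three. *)
Lemma decorated_good t d : pres d t -> labelled t d ->
  [/\ spanning_tree T, d \in T & forall x, x \in T -> ~ in_2cycle x] <->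
  edge_set T /\ root_good t.
Proof.
move=> P Lt; have tN := pres_net P; have tF := pres_fresh P; have td := pres_nend P.
have := card_labels P; have V := pres_nb_vertices P; have t0 := pres_nodes_gt0 P.
have okT eT := connected_ok tri P eT Lt; have C := pres_cover P.
have ub : edge_uniq (behead (pos t d)).
  by apply: edge_uniq_perm (pres_uniq P); rewrite perm_sym behead_posl_perm.
have ul : edge_uniq (posl t d) := pres_uniq P.
case: t t0 tN tF td Lt V ub ul okT C {P} => // b l r s _ tN tF td Lt V ub ul okT C sT.
have [bT Ll Lr Ls] := labelled_Node Lt.
have F := freshP tri tN tF; have [lN rN _ sN] := and4P tN.
have lE := labsE Ll; have rE := labsE Lr.
have lu : edge_uniq (pos l (lside d)).
  by apply: edge_uniq_sub ub; apply: prefix_subseq.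
have ru : edge_uniq (pos r (rside d)).
  by apply: edge_uniq_sub ub; apply: subseq_trans (suffix_subseq _ _); apply: prefix_subseq.
split.
  case=> /(spanning_treeP _ d)[eT cT kT] dT Ts; split=> //.
  have {}sT := sT eT; have /and4P[olr okl okr _] := okT eT cT.
  rewrite -/(ok l) in okl; rewrite -/(ok r) in okr.
  have sl := simple_labP lN (fresh_l F) lu Ll Ts.
  have sr := simple_labP rN (fresh_r F) ru Lr Ts.
  (* If the root chain had a further edge, the root would lie on a 2-cycle. *)
  case: s tN tF td Lt V ub ul okT sT {Ls F sN C} => [b'|b' l' r' s'] tN tF td Lt V ub ul okT sT; last first.
    have [||c _] := chain_2cycle tN tF; last by case: (Ts _ dT).
      by apply: (edge_uniq_head ul _).1; rewrite !mem_cat mem_head !orbT.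
    by apply: (edge_uniq_head ul _).2; rewrite !mem_cat mem_head !orbT.
  have b'T : b' = true.
    case: Lt => _ _ _ <-.
    by rewrite -[X in X \in T]/(nend (Leaf b') (snext r d)) -(nend_Node b l) td.
  rewrite -bT dT b'T /=.
  have := ok_labs okl; have := ok_labs okr.
  move: kT sT V; rewrite /= cats0 count_cat dT -lE -rE => kT sT V ol or.
  (* The tree has [nodes l + nodes r + 2] edges, one being the root. With the bounds of [ok_labs],
     exactly one of [conn l] and [conn r] holds and both bounds are attained. *)
  have e : labs l + labs r = nodes l + nodes r + 1 by move: kT; rewrite sT V; clear; lia.
  rewrite !goodP okl okr sl sr /=; move: olr ol or e; clear.
  case: (conn l) (conn r) => [] [] //= _ ol or e; try (exfalso; lia).
    by apply/and3P; split=> //; apply/eqP; lia.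
  by apply/and3P; split=> //; apply/eqP; lia.
case=> eT; case: b tN tF td Lt V ub ul okT bT sT C => // tN tF td Lt V ub ul okT dT sT C.
case: s tN tF td Lt V ub ul okT sT Ls F sN C => [[]|//] // tN tF td Lt V ub ul okT sT Ls F sN C.
case/and3P=> gl gr glr; move: (gl) (gr); rewrite !goodP.
case/and3P=> okl sl /eqP ll /and3P[okr sr /eqP lr].
have okt : ok (Node true l r (Leaf true)) by rewrite /= okl okr !andbT; case: (conn l) (conn r) glr => [] [].
have [cp _] := ok_connected tri eT tN Lt okt.
have ded : connect (step T) d (edge d) by apply: connect_edge.
have cd z : connect (step T) z d \/ connect (step T) z (edge d) -> connect (step T) d z.
  case=> h; first by rewrite step_sym.
  by apply: connect_trans ded _; rewrite step_sym.
have cT : forall x y, connect (step T) x y.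
  apply: (step_from (d := d) eT) => z; apply: cd; have := C z.
  rewrite mem_cat => /orP[/mem_posl_pos/cp[]//|/mapP[u /mem_posl_pos/cp[_ h] ->]//].
split=> //.
  apply/(spanning_treeP _ d); split=> //; rewrite sT // V /= cats0 count_cat -lE -rE ll lr dT.
  by move: glr; clear; case: (conn l) (conn r) => [] [] //= _; lia.
move=> x xT /in_2cycleP[y [yx yex oy ty ox]].
have rep z : exists2 p, p \in posl (Node true l r (Leaf true)) d & z = p \/ z = edge p.
  have := C z; rewrite mem_cat => /orP[zp|/mapP[u up ->]]; first by exists z; [|left].
  by exists u; [|right].
have [p pt xp] := rep x; have [q qt yq] := rep y.
have pT : p \in T by case: xp xT => ->; rewrite ?eT.
have pq : parallel p q.
  have xy : parallel x y by split=> //; left.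
  case: xp => xp; case: yq => yq; move: xy; rewrite xp yq /parallel ?org_edge ?tgt_edge.
  - by [].
  - by case=> ? [[? ?]|[? ?]]; split=> //; [right|left].
  - by case=> ? [[? ?]|[? ?]]; split=> //; rewrite 1?eq_sym //; [right|left].
  - by case=> ? [[? ?]|[? ?]]; split=> //; rewrite 1?eq_sym //; [left|right].
suff e : p = q.
  by move: yx yex; case: xp => ->; case: yq => ->; rewrite e ?edgeK ?eqxx.
case: (parallel_classes tN tF pq (mem_posl_pos pt) (mem_posl_pos qt)) => -[hp hq].
- exact: parallel_eq lN (fresh_l F) Ll sl hp hq pT pq.
- exact: parallel_eq rN (fresh_r F) Lr sr hp hq pT pq.
move: hp hq; rewrite -[snext r d]/(nend (Node true l r (Leaf true)) d) td !inE !orbb.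
by move=> /eqP-> /eqP->.
Qed.

End Simple.

(** * Enumeration of the good nets *)

Fixpoint net_eqb t t' : bool :=
  match t, t' with
  | Leaf b, Leaf b' => b == b'
  | Node b l r s, Node b' l' r' s' =>
    [&& b == b', net_eqb l l', net_eqb r r' & net_eqb s s']
  | _, _ => false
  end.

Lemma net_eqP : Equality.axiom net_eqb.
Proof.
elim=> [b|b l IHl r IHr s IHs] [b'|b' l' r' s'] /=; try by constructor.
  by apply: (iffP eqP) => [->|[]].
apply: (iffP and4P) => [[/eqP-> /IHl-> /IHr-> /IHs->] //|[<- <- <- <-]].
by split; [apply: eqxx | apply/IHl | apply/IHr | apply/IHs].
Qed.

HB.instance Definition _ := hasDecEq.Build net net_eqP.

Definition enumerates (A : eqType) k (sz : A -> nat) (P : pred A) (f : nat -> seq A) :=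
  forall i, i < k -> uniq (f i) /\ forall x, (x \in f i) = P x && (sz x == i).

Section Enumeration.

Variables A B : eqType.
Implicit Types (f : nat -> seq A) (g : nat -> seq B).

Definition conv f g m : seq (A * B) :=
  flatten [seq [seq (x, y) | x <- f i, y <- g (m - i)] | i <- iota 0 m.+1].

Lemma size_conv f g m : size (conv f g m) = \sum_(i < m.+1) size (f i) * size (g (m - i)).
Proof.
rewrite size_flatten /shape -map_comp sumnE big_map.
rewrite (_ : iota 0 m.+1 = index_iota 0 m.+1) ?big_mkord; last by rewrite /index_iota subn0.
by apply: eq_bigr => i _ /=; rewrite size_allpairs.
Qed.

Lemma conv_enumerates k szA PA f szB PB g :
  enumerates k szA PA f -> enumerates k szB PB g ->
  enumerates k (fun u => szA u.1 + szB u.2) (fun u => PA u.1 && PB u.2) (conv f g).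
Proof.
move=> fP gP m mk; split=> [|[x y]].
  have : {in iota 0 m.+1, forall i, i < k} by move=> i; rewrite mem_iota; lia.
  rewrite /conv; have := iota_uniq 0 m.+1; elim: (iota 0 m.+1) => //= i s IHs /andP[nis us] sk.
  have ik : i < k by apply: sk; rewrite mem_head.
  have [fu fE] := fP _ ik; rewrite cat_uniq IHs ?andbT //; last first.
    by move=> j js; apply: sk; rewrite inE js orbT.
  rewrite allpairs_uniq //; last by case=> ? ? [? ?].
    apply/hasPn => [[x y]] /flattenP[_ /mapP[j js ->] /allpairsP[[x' y'] [/= xj _ [-> _]]]].
    apply/negP => /allpairsP[[x2 y2] [/= xi _ [e _]]].
    have [|_ fjE] := fP j; first by apply: sk; rewrite inE js orbT.
    move: xj xi; rewrite fjE -e fE => /andP[_ /eqP->] /andP[_ /eqP ij].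
    by rewrite ij (negbTE nis) in js.
  by have [] := gP (m - i); rewrite ?(leq_ltn_trans (leq_subr _ _)).
apply/flattenP/andP => [[_ /mapP[i im ->] /allpairsP[[x' y'] [/= xi yi [-> ->]]]]|].
  rewrite mem_iota in im; have [ik mik] : i < k /\ m - i < k by lia.
  have [_ fE] := fP _ ik; have [_ gE] := gP _ mik.
  by move: xi yi; rewrite fE gE => /andP[-> /eqP->] /andP[-> /eqP->]; split=> //; lia.
case=> /andP[Px Py] /eqP e; rewrite /= in Px Py e; exists [seq (x, y) | x <- f (szA x), y <- g (szB y)].
  apply/mapP; exists (szA x); first by rewrite mem_iota; lia.
  by rewrite (_ : m - _ = szB y) //; lia.
apply/allpairsP; exists (x, y); split=> //=.
  by have [|_ ->] := fP (szA x); [lia | rewrite Px eqxx].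
by have [|_ ->] := gP (szB y); [lia | rewrite Py eqxx].
Qed.

Lemma cat_enumerates k sz (P Q : pred A) f f' : (forall x : A, P x -> ~~ Q x) ->
  enumerates k sz P f -> enumerates k sz Q f' ->
  enumerates k sz (predU P Q) (fun m => f m ++ f' m).
Proof.
move=> PQ fP fQ m mk; have [fu fE] := fP m mk; have [fu' fE'] := fQ m mk.
split=> [|x]; last by rewrite mem_cat fE fE' /= andb_orl.
rewrite cat_uniq fu fu' andbT; apply/hasPn => x; rewrite fE' fE => /andP[Qx _].
by apply/negP => /andP[/PQ]; rewrite Qx.
Qed.

Lemma enumerates_size k sz (P : pred A) f f' m : enumerates k sz P f -> enumerates k sz P f' -> m < k ->
  size (f m) = size (f' m).
Proof.
move=> fP fP' mk; have [fu fE] := fP m mk; have [fu' fE'] := fP' m mk.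
by apply/eqP; rewrite -uniq_size_uniq // => x; rewrite fE fE'.
Qed.

End Enumeration.

Definition mk_node (u : net * net * net) : net := Node false u.1.1 u.1.2 u.2.

Definition mixed (f : bool -> nat -> seq net) m :=
  conv (f true) (f false) m ++ conv (f false) (f true) m.

(* The nets that may end a chain of at least two parallel edges. *)
Definition tails (f : bool -> nat -> seq net) c m :=
  if c && (m == 0) then [::] else f c m.

(** The ends are joined either through the inserted vertex, with both sides joined and the tail not,
    or through the tail, with one side joined to attach that vertex. *)
Definition next_nets (f : bool -> nat -> seq net) c m : seq net :=
  if m is m'.+1 then
    map mk_node (if c then conv (conv (f true) (f true)) (f false) m' ++
                           conv (mixed f) (tails f true) m'
                 else conv (mixed f) (f false) m')
  else [:: Leaf c].

(** After [k] rounds the lists of nets with fewer than [k] nodes are final; hence the bound [k] in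
    [enumerates]. *)
Definition nets k := iter k next_nets (fun _ _ => [::]).

Definition good_net c t := good t && (conn t == c).

Lemma mixed_enumerates_of k f : enumerates k nodes (good_net true) (f true) ->
  enumerates k nodes (good_net false) (f false) ->
  enumerates k (fun u : net * net => nodes u.1 + nodes u.2)
    (fun u => [&& good u.1, good u.2 & conn u.1 (+) conn u.2]) (mixed f).
Proof.
move=> ft ff m mk.
have H := cat_enumerates _ (conv_enumerates ft ff) (conv_enumerates ff ft).
have [|mu mE] := H _ m mk.
  by move=> u /andP[/andP[_ /eqP e] _]; rewrite /good_net e andbF.
split=> // u; rewrite [LHS]mE /good_net /=; congr (_ && _).
by case: (good u.1) (good u.2) (conn u.1) (conn u.2) => [] [] [] [].
Qed.

Lemma nets_enumerates k c : enumerates k nodes (good_net c) (nets k c).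
Proof.
elim: k c => [|k IHk] c; first by [].
have IHt : enumerates k nodes (good_net true) (nets k true) := IHk true.
have IHf := IHk false; set f := nets k in IHt IHf *.
have mE := mixed_enumerates_of IHt IHf.
have tE : enumerates k nodes (fun t => good_net true t && ~~ leaf_true t) (tails f true).
  move=> m mk; have [fu fE] := IHt m mk; rewrite /tails; case: eqP => [m0|/eqP m0] /=.
    split=> // t; rewrite m0; case: t => [[]|b l r s] //=.
    by rewrite andbF.
  split=> // t; rewrite fE; case: t => [b|b l r s] /=; last by rewrite andbT.
  by rewrite eq_sym (negbTE m0) !andbF.
case=> [_|m mk]; first (split=> // t; rewrite inE; case: t => [b|b l r s] //=; last by rewrite andbF).
  by rewrite /good_net /= !andbT eq_sym; case: (b) (c) => [] [].
have {}mk : m < k by [].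
have mk_inj : injective mk_node by case=> [[l r] s] [[l' r'] s'] [-> -> ->].
have memE (L : seq (net * net * net)) (P : pred (net * net * net)) :
    (forall u, (u \in L) = P u && (nodes u.1.1 + nodes u.1.2 + nodes u.2 == m)) ->
    (forall b l r s, good_net c (Node b l r s) = ~~ b && P (l, r, s)) ->
    forall t, (t \in map mk_node L) = good_net c t && (nodes t == m.+1).
  move=> LP PE [b|b l r s]; first by rewrite andbF; apply/mapP => -[u _].
  rewrite PE; case: b => /=; first by apply/mapP => -[u _ []].
  by rewrite -[Node _ _ _ _]/(mk_node (l, r, s)) (mem_map mk_inj) LP.
rewrite -[nets k.+1 c m.+1]/(map mk_node (if c
  then conv (conv (f true) (f true)) (f false) m ++ conv (mixed f) (tails f true) m
  else conv (mixed f) (f false) m)).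
case: c memE => memE.
  have ccE := conv_enumerates (conv_enumerates IHt IHt) IHf.
  have mtE := conv_enumerates mE tE.
  have H := cat_enumerates _ ccE mtE; have [|mu HE] := H _ m mk.
    move=> [[l r] s] /=; rewrite /good_net /= => /andP[/andP[/andP[_ /eqP->] /andP[_ /eqP->]] _].
    by rewrite !andbF.
  split; first by rewrite map_inj_uniq.
  apply: memE HE _ => b l r s; rewrite /good_net /=.
  have : leaf_true s -> conn s by case: (s).
  by case: (good l) (good r) (good s) (conn l) (conn r) (conn s) (leaf_true s) b
  => [] [] [] [] [] [] [] [] //= /(_ isT).
have H := conv_enumerates mE IHf; have [mu HE] := H m mk.
split; first by rewrite map_inj_uniq.
apply: memE HE _ => b l r s; rewrite /good_net /=.
have : leaf_true s -> conn s by case: (s).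
by case: (good l) (good r) (good s) (conn l) (conn r) (conn s) (leaf_true s) b
  => [] [] [] [] [] [] [] [] //= /(_ isT).
Qed.

(** * Recurrences for the numbers of nets *)

Definition nb_nets c m := size (nets m.+1 c m).

Definition nb_tails c m := if c && (m == 0) then 0 else nb_nets c m.

Lemma size_nets k c m : m < k -> size (nets k c m) = nb_nets c m.
Proof.
move=> mk; apply: (enumerates_size (k := m.+1) (sz := nodes) (P := good_net c)) => //.
  by move=> i im; apply: nets_enumerates; apply: leq_trans mk.
exact: nets_enumerates.
Qed.

Lemma size_tails k c m : m < k -> size (tails (nets k) c m) = nb_tails c m.
Proof. by move=> mk; rewrite /tails /nb_tails; case: ifP => // _; rewrite size_nets. Qed.

Definition nb_mixed m :=
  \sum_(i < m.+1) nb_nets true i * nb_nets false (m - i) +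
  \sum_(i < m.+1) nb_nets false i * nb_nets true (m - i).

Lemma size_mixed k m : m < k -> size (mixed (nets k) m) = nb_mixed m.
Proof.
move=> mk; rewrite size_cat !size_conv; congr (_ + _); apply: eq_bigr => i _.
  by rewrite !size_nets //; have := ltn_ord i; lia.
by rewrite !size_nets //; have := ltn_ord i; lia.
Qed.

Lemma nb_nets0 c : nb_nets c 0 = 1. Proof. by []. Qed.

Lemma nb_nets_false m :
  nb_nets false m.+1 = \sum_(i < m.+1) nb_mixed i * nb_nets false (m - i).
Proof.
rewrite -[LHS]/(size (map mk_node (conv (mixed (nets m.+1)) (nets m.+1 false) m))).
rewrite size_map size_conv; apply: eq_bigr => i _.
by have im := ltn_ord i; rewrite size_mixed // size_nets //; lia.
Qed.

Lemma nb_nets_true m :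
  nb_nets true m.+1 =
    \sum_(i < m.+1) (\sum_(j < i.+1) nb_nets true j * nb_nets true (i - j)) * nb_nets false (m - i) +
    \sum_(i < m.+1) nb_mixed i * nb_tails true (m - i).
Proof.
rewrite -[LHS]/(size (map mk_node
  (conv (conv (nets m.+1 true) (nets m.+1 true)) (nets m.+1 false) m ++
   conv (mixed (nets m.+1)) (tails (nets m.+1) true) m))).
rewrite size_map size_cat !size_conv; congr (_ + _); apply: eq_bigr => i _.
  have im := ltn_ord i; rewrite size_conv size_nets; last by lia.
  by congr (_ * _); apply: eq_bigr => j _; have jm := ltn_ord j; rewrite !size_nets //; lia.
by have im := ltn_ord i; rewrite size_mixed // size_tails //; lia.
Qed.

Definition codes m : seq net :=
  if m is m'.+1 then [seq Node true u.1 u.2 (Leaf true) | u <- mixed (nets m'.+1) m'] else [::].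

Lemma mixed_enumerates k : enumerates k (fun u : net * net => nodes u.1 + nodes u.2)
  (fun u => [&& good u.1, good u.2 & conn u.1 (+) conn u.2]) (mixed (nets k)).
Proof. by apply: mixed_enumerates_of; apply: nets_enumerates. Qed.

Lemma codesP m : uniq (codes m) /\ forall t, (t \in codes m) = root_good t && (nodes t == m).
Proof.
case: m => [|m]; first by split=> // -[[]|[] l r [[]|? ? ? ?]] //=; rewrite andbF.
have [mu mE] := @mixed_enumerates m.+1 m (ltnSn m).
pose mk (u : net * net) := Node true u.1 u.2 (Leaf true).
have mk_inj : injective mk by case=> [l r] [l' r'] [-> ->].
split; first by rewrite map_inj_uniq.
case=> [b|[] l r [[]|b' l' r' s']]; try by apply/mapP => -[].
rewrite -[Node _ _ _ _]/(mk (l, r)) (mem_map mk_inj) mE /= addn0 eqSS.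
by case: (nodes l + nodes r == m).
Qed.

Lemma size_codes m : size (codes m.+1) = nb_mixed m.
Proof. by rewrite size_map size_mixed. Qed.

(** * Isomorphism classes of decorated triangulations *)

Section Labelling.

Variable M : cmap.
Implicit Types (T : {set M}) (x y z : M) (t l r s : net).

Lemma lab_shape T t x : same_shape (lab T t x) t.
Proof. by elim: t x => //= b l IHl r IHr s IHs x; rewrite IHl IHr IHs. Qed.

Lemma lab_same_shape T t t' x : same_shape t t' -> lab T t x = lab T t' x.
Proof.
elim: t t' x => [b|b l IHl r IHr s IHs] [b'|b' l' r' s'] x //= /and3P[hl hr hs].
have e : snext r x = snext r' x by rewrite /snext (same_shape_net (rside x) hr).2.
by rewrite (IHl l') // (IHr r') // e (IHs s').
Qed.

Lemma lab_idem T t x : lab T (lab T t x) x = lab T t x.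
Proof. by apply: lab_same_shape; apply: lab_shape. Qed.

Lemma nodes_lab T t x : nodes (lab T t x) = nodes t.
Proof. by elim: t x => //= b l IHl r IHr s IHs x; rewrite IHl IHr IHs. Qed.

Lemma pres_lab T t d : pres d t -> pres d (lab T t d).
Proof.
case=> cM tM sM vM tN td; have [eN eE] := same_shape_net d (lab_shape T t d).
by split; rewrite ?nodes_lab ?eN ?eE.
Qed.

Fixpoint true_pos t x : seq M :=
  match t with
  | Leaf b => nseq b x
  | Node b l r s => nseq b x ++ true_pos l (lside x) ++ true_pos r (rside x) ++ true_pos s (snext r x)
  end.

Lemma true_pos_sub t x : {subset true_pos t x <= pos t x}.
Proof.
elim: t x => [b|b l IHl r IHr s IHs] x z.
  by rewrite /= mem_nseq inE => /andP[_].
rewrite /= !(inE, mem_cat, mem_nseq).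
by case/or4P=> [/andP[_ ->]|/IHl->|/IHr->|/IHs->]; rewrite ?orbT.
Qed.

Lemma lab_true_pos T t x : uniq (pos t x) ->
  {in pos t x, forall z, (z \in T) = (z \in true_pos t x)} -> lab T t x = t.
Proof.
elim: t x => [b|b l IHl r IHr s IHs] x.
  by move=> _ /(_ x (mem_head _ _)); rewrite /= mem_nseq eqxx andbT => ->; case: b.
rewrite [pos _ _]/= cons_uniq cat_uniq cat_uniq !mem_cat has_cat !negb_or => /andP[/and3P[xl xr xs]].
case/and5P=> ul /andP[/hasPn hlr /hasPn hls] ur /hasPn hr us H.
have nt t' x' z : z \notin pos t' x' -> z \in true_pos t' x' = false.
  by move=> h; apply: contraNF h; apply: true_pos_sub.
have nx z t' x' : z \in pos t' x' -> x \notin pos t' x' -> z \in nseq b x = false.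
  by move=> zp xp; rewrite mem_nseq; apply: contraNF xp => /andP[_ /eqP <-].
have lr z : z \in pos l (lside x) -> z \notin pos r (rside x).
  by move=> zl; apply/negP => zr; have := hlr z zr; rewrite /= zl.
have ls z : z \in pos l (lside x) -> z \notin pos s (snext r x).
  by move=> zl; apply/negP => zs; have := hls z zs; rewrite /= zl.
have rs z : z \in pos r (rside x) -> z \notin pos s (snext r x).
  by move=> zr; apply/negP => zs; have := hr z zs; rewrite /= zr.
have Hx := H x (mem_head _ _).
rewrite /= -/(snext r x); congr Node.
- by rewrite Hx [true_pos _ _]/= !mem_cat !nt // mem_nseq eqxx; case: (b).
- apply: IHl => // z zl; rewrite H; last by rewrite inE !mem_cat zl ?orbT.
  rewrite [true_pos _ _]/= !mem_cat.
  by rewrite (nx _ _ _ zl xl) (nt _ _ _ (lr _ zl)) (nt _ _ _ (ls _ zl)) !orbF.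
- apply: IHr => // z zr; rewrite H; last by rewrite inE !mem_cat zr ?orbT.
  rewrite [true_pos _ _]/= !mem_cat.
  have nl : z \notin pos l (lside x) by apply: contraL zr => /lr.
  by rewrite (nx _ _ _ zr xr) (nt _ _ _ (rs _ zr)) !orbF (nt _ _ _ nl).
- apply: IHs => // z zs; rewrite H; last by rewrite inE !mem_cat zs ?orbT.
  rewrite [true_pos _ _]/= !mem_cat.
  have nl : z \notin pos l (lside x) by apply: contraL zs => /ls.
  have nr : z \notin pos r (rside x) by apply: contraL zs => /rs.
  by rewrite (nx _ _ _ zs xs) (nt _ _ _ nl) (nt _ _ _ nr).
Qed.

(** The root and the final leaf are the same dart, so labels can be prescribed freely only if these
    two agree, as [root_good] ensures. Every other edge has a single position. *)
Lemma root_labelling t (d : M) : pres d t -> root_good t ->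
  exists2 T : {set M}, edge_set T & lab T t d = t.
Proof.
move=> P; have td := pres_nend P; have ul : edge_uniq (posl t d) := pres_uniq P.
case: t td ul {P} => [|[] l r [[]|//]] //= dd ul _; rewrite -/(snext r d) in dd.
set p := pos l (lside d) ++ pos r (rside d) in ul.
have {}ul : edge_uniq (d :: p) by rewrite /p -(cats0 (pos r (rside d))).
pose q := d :: true_pos l (lside d) ++ true_pos r (rside d).
have qp : {subset q <= d :: p}.
  move=> z; rewrite !inE !mem_cat => /or3P[->//|/true_pos_sub->|/true_pos_sub->]; rewrite ?orbT //.
(* Closing under [edge] adds no listed position, since no edge is listed in both orientations. *)
pose T := [set z | (z \in q) || (edge z \in q)].
have TE z : z \in d :: p -> (z \in T) = (z \in q).
  move=> zp; rewrite inE; case: (boolP (edge z \in q)) => [eq|]; rewrite ?orbF // orbT.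
  have ez := qp _ eq.
  have e : edge z = z.
    by apply: (edge_uniq_opened ul zp ez); rewrite /opened eqxx orbT.
  by have := edge_neq z; rewrite e eqxx.
have dT : d \in T by rewrite TE ?mem_head.
exists T; first by move=> z; rewrite !inE edgeK orbC.
have [ulr dp] : uniq p /\ d \notin p.
  by move: ul; rewrite /edge_uniq cat_uniq => /andP[/andP[]].
have [up ur lr] : [/\ uniq (pos l (lside d)), uniq (pos r (rside d)) &
    forall z, z \in pos l (lside d) -> z \in pos r (rside d) -> False].
  move: ulr; rewrite cat_uniq => /and3P[? /hasPn h ?]; split=> // z zl zr.
  by have := h _ zr; rewrite zl.
rewrite /= -/(snext r d) dd dT; congr Node.
- apply: lab_true_pos => // z zl; rewrite TE ?inE ?mem_cat ?zl ?orbT //.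
  have -> : z == d = false by apply: contraNF dp => /eqP <-; rewrite mem_cat zl.
  by case: (boolP (z \in true_pos r _)) => [/true_pos_sub/(lr _ zl)//|]; rewrite orbF.
- apply: lab_true_pos => // z zr; rewrite TE ?inE ?mem_cat ?zr ?orbT //.
  have -> : z == d = false by apply: contraNF dp => /eqP <-; rewrite mem_cat zr orbT.
  by case: (boolP (z \in true_pos l _)) => [/true_pos_sub/lr/(_ zr)//|].
Qed.

(** At the root no outer triangle tells where the chain of parallel edges stops, so only the first
    two children are compared; in a [root_good] tree the third is a leaf. *)
Lemma fresh_shape_Node b b' l l' r r' s s' x (t := Node b l r s) (t' := Node b' l' r' s') :
  triangular M -> is_net t x -> is_net t' x -> fresh t x -> fresh t' x ->
  same_shape l l' /\ same_shape r r'.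
Proof.
move=> tri tN tN' fN fN'; have F := freshP tri tN fN; have F' := freshP tri tN' fN'.
have [lN rN _ _] := and4P tN; have [lN' rN' _ _] := and4P tN'.
have out l0 : tgt x \notin hull l0 (lside x) ->
    {in cinit l0 (lside x), forall z, ~~ (apex z == tgt x)}.
  by move=> h z /cinit_apex az; apply: contraNneq h => <-; rewrite !inE az !orbT.
have outr r0 : org x \notin hull r0 (rside x) ->
    {in cinit r0 (rside x), forall z, ~~ (apex z == org x)}.
  by move=> h z /cinit_apex az; apply: contraNneq h => <-; rewrite !inE az !orbT.
have [el _] := net_shape tri (Q := fun z => apex z == tgt x) lN lN' (fresh_l F) (fresh_l F')
  (out _ (fresh_tl F)) (out _ (fresh_tl F')) (introT eqP (apex_lend tri tN))
  (introT eqP (apex_lend tri tN')).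
have [er _] := net_shape tri (Q := fun z => apex z == org x) rN rN' (fresh_r F) (fresh_r F')
  (outr _ (fresh_or F)) (outr _ (fresh_or F')) (introT eqP (apex_rend tri tN))
  (introT eqP (apex_rend tri tN')).
by [].
Qed.

End Labelling.

Definition encodes (Y : decorated_map) t :=
  [/\ pres (droot Y) t, lab (dtree Y) t (droot Y) = t, edge_set (dtree Y) & root_good t].

Lemma encodes_decorated n Y t : encodes Y t -> hierarchical_triangulation (dmap Y) ->
  n = (nodes t).+1 -> tree_decorated_hierarchical n Y.
Proof.
case=> P Lt eT gt hY ->.
have [_ /(_ (conj eT gt))[sT dT Ts]] := decorated_good (pres_tri P) P Lt.
by split=> //; rewrite (pres_nb_vertices P) addn2.
Qed.

Lemma encodes_exists t : root_good t -> exists Y, encodes Y t /\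
  tree_decorated_hierarchical (nodes t).+1 Y.
Proof.
move=> gt; have t0 : 0 < nodes t by case: (t) gt.
have [M [d [hM P]]] := net_exists t0; have [T eT LT] := root_labelling P gt.
have E : encodes (DecoratedMap d T) t by [].
by exists (DecoratedMap d T); split; [apply: E | apply: encodes_decorated E hM erefl].
Qed.

Lemma decorated_encodes n Y : tree_decorated_hierarchical n Y ->
  exists2 t, encodes Y t & n = (nodes t).+1.
Proof.
case: Y => M d T [/= [_ /obtained_stacked[k S]] Vn sT dT Ts].
have [t0 tc tk] := st_net S d; have P0 := stacked_pres S tc tk.
have P := pres_lab T P0; have Lt := lab_idem T t0 d.
have [/(_ (And3 sT dT Ts))[eT gt] _] := decorated_good (pres_tri P) P Lt.
by exists (lab T t0 d) => //; move: (pres_nb_vertices P); rewrite Vn; lia.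
Qed.

Lemma encodes_iso X Y t : encodes X t -> encodes Y t -> decorated_iso X Y.
Proof. by move=> [PX LX eX _] [PY LY eY _]; apply: (pres_iso eX eY PX PY); rewrite LX LY. Qed.

(** The isomorphism carries [t] to the root of [Y], where freshness fixes the shape and the tree set
    fixes the labels. *)
Lemma iso_encodes X Y t t' : decorated_iso X Y -> encodes X t -> encodes Y t' -> t = t'.
Proof.
case: X Y => M d T [N c S] /= [f [bf fm /= fd fT]] [/= PX LX _ gt] [/= PY LY _ gt'].
have cMN : #|M| = #|N| := bij_eq_card bf.
have nE : nodes t = nodes t'.
  by have := pres_card PX; have := pres_card PY; rewrite cMN => ->; lia.
have Pc : pres c t.
  case: PY => cN tN sN vN _ _; split; rewrite ?nE // -fd.
    by apply: morph_net fm _ _ _; apply: pres_net PX.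
  by rewrite morph_nend // (pres_nend PX).
have labf u x : lab S u (f x) = lab T u x.
  elim: u x => [b|b l IHl r IHr s IHs] x /=; first by rewrite fT.
  by rewrite fT morph_lside // morph_rside // morph_snext // IHl IHr IHs.
have tri := pres_tri PY; have fN := pres_fresh Pc; have fN' := pres_fresh PY.
have sh : same_shape t t'.
  move: (pres_net Pc) (pres_net PY) fN fN' gt gt'.
  case: (t) => [|[] l r [[]|//]] //; case: (t') => [|[] l' r' [[]|//]] // tN tN' fN fN' _ _.
  by have [? ?] := fresh_shape_Node tri tN tN' fN fN'; apply/and3P.
by rewrite -LX -LY -labf fd; apply: lab_same_shape.
Qed.

Lemma finite_choice (A : Type) k (P : 'I_k -> A -> Prop) :
  (forall i, exists a, P i a) -> exists f : 'I_k -> A, forall i, P i (f i).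
Proof.
elim: k P => [|k IHk] P PE; first by exists (fun i : 'I_0 => False_rect A (notF (ltn_ord i))) => -[].
have [a Pa] := PE ord0; have [f fP] := IHk (fun i => P (lift ord0 i)) (fun i => PE (lift ord0 i)).
exists (fun i => if unlift ord0 i is Some j then f j else a) => i.
by case: unliftP => [j|] ->.
Qed.

(** The code is a complete invariant of isomorphism classes, and every code is realised. The index
    is [n.-1] because [n + 1] vertices mean [n - 1] nodes. *)
Lemma Hset_cardP n k : 0 < n -> Hset_has_card n k <-> k = size (codes n.-1).
Proof.
move=> n0; have [cu cE] := codesP n.-1; split=> [[X [XP Xiso Xall]]|->].
  have [t tE] : exists t : 'I_k -> net, forall i, encodes (X i) (t i) /\ n = (nodes (t i)).+1.
    apply: (finite_choice (P := fun i u => encodes (X i) u /\ n = (nodes u).+1)) => i.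
    have [t ? ?] := decorated_encodes (XP i).
    by exists t.
  have t_inj : injective t.
    move=> i j e; apply: Xiso; apply: encodes_iso (tE i).1 _; rewrite e.
    exact: (tE j).1.
  have <- : size (codom t) = k by rewrite size_codom card_ord.
  apply/eqP; rewrite -(uniq_size_uniq cu); first by rewrite map_inj_uniq // enum_uniq.
  move=> u; rewrite cE.
  apply/andP/codomP => [[gu /eqP nu]|[i ->]].
    have [Y [EY hY]] := encodes_exists gu; rewrite nu prednK // in hY.
    have [i XY] := Xall _ hY; exists i.
    exact/esym/(iso_encodes XY (tE i).1 EY).
  by have [[_ _ _ gt] nE] := tE i; rewrite nE /= eqxx.
have [X XE] : exists X : 'I_(size (codes n.-1)) -> decorated_map, forall i,
    encodes (X i) (nth (Leaf false) (codes n.-1) i) /\ tree_decorated_hierarchical n (X i).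
  apply: (finite_choice (P := fun i Y => encodes Y (nth (Leaf false) (codes n.-1) i) /\
    tree_decorated_hierarchical n Y)) => i; have := mem_nth (Leaf false) (ltn_ord i); rewrite cE.
  case/andP=> /encodes_exists[Y [EY hY]] /eqP nE; exists Y; split=> //.
  by rewrite nE prednK in hY.
exists X; split=> [i|i j ij|Y hY]; first exact: (XE i).2.
  have e := iso_encodes ij (XE i).1 (XE j).1.
  by apply/val_inj/eqP; rewrite -(nth_uniq (Leaf false) (ltn_ord i) (ltn_ord j) cu) e.
have [t Et nE] := decorated_encodes hY.
have tc : t \in codes n.-1 by rewrite cE nE eqxx andbT; case: Et.
have it : index t (codes n.-1) < size (codes n.-1) by rewrite index_mem.
exists (Ordinal it); apply: encodes_iso (XE _).1 _; rewrite /= nth_index //.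
Qed.

(** * Generating polynomials *)

From mathcomp Require Import all_order all_algebra ring lra.
Import Order.TTheory GRing.Theory Num.Theory.

Definition nb_codes m : nat := if m is m'.+1 then nb_mixed m' else 0%N.

Section GeneratingPolynomials.

Local Open Scope ring_scope.

Variable N : nat.

Local Notation gen f := (\poly_(i < N) ((f i)%:R : rat)).
Let C := gen (nb_nets true).
Let D := gen (nb_nets false).
Let H := gen nb_codes.

Lemma dvdXnP (p : {poly rat}) : ('X^N %| p) <-> forall i, (i < N)%N -> p`_i = 0.
Proof.
split=> [/dvdpP[q ->] i iN|p0]; first by rewrite coefMXn iN.
rewrite -(poly_take_drop N p) (_ : take_poly N p = 0) ?add0r ?dvdp_mull //.
by apply/polyP => i; rewrite coef_take_poly coef0; case: ifP => // /p0.
Qed.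

Lemma coef_gen f i : (i < N)%N -> (gen f)`_i = (f i)%:R.
Proof. by move=> iN; rewrite coef_poly iN. Qed.

Lemma coef_genM f g i : (i < N)%N ->
  (gen f * gen g)`_i = (\sum_(j < i.+1) f j * g (i - j))%N%:R.
Proof.
move=> iN; rewrite coefM natr_sum; apply: eq_bigr => j _; have ji := ltn_ord j.
by rewrite !coef_gen ?natrM //; lia.
Qed.

Lemma coef_mixed i : (i < N)%N -> (nb_mixed i)%:R = 2 * (C * D)`_i.
Proof.
move=> iN; rewrite /nb_mixed natrD -!coef_genM // -/C -/D [D * C]mulrC.
by rewrite mulr_natl.
Qed.

Lemma gf_mixed : 'X^N %| H - 2 *: ('X * (C * D)).
Proof.
apply/dvdXnP => -[|i] iN; rewrite coefB coefZ coefXM coef_gen //=.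
by rewrite coef_mixed ?subrr // ltnW.
Qed.

Lemma gf_false : 'X^N %| D * (1 - H) - 1.
Proof.
apply/dvdXnP => -[|i] iN.
  by rewrite mulrBr mulr1 !coefB coefM big_ord1 !coef_gen // coef1 nb_nets0 mulr0 subr0 subrr.
have N0 : (0 < N)%N by apply: leq_trans iN.
have H0 : H`_0 = 0 by rewrite coef_gen.
rewrite mulrBr mulr1 mulrC !coefB coef1 subr0 coef_gen // coefM big_ord_recl.
rewrite H0 mul0r add0r nb_nets_false natr_sum -sumrB big1 // => j _.
have ji := ltn_ord j; rewrite lift0 subSS !coef_gen ?natrM ?subrr //; lia.
Qed.

(** Subtracting 1 removes the single labelled leaf. *)
Lemma coef_tails i : (i < N)%N -> (C - 1)`_i = (nb_tails true i)%:R.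
Proof.
move=> iN; rewrite coefB coef_gen // coef1 /nb_tails.
by case: i iN => [|i] _ /=; rewrite ?nb_nets0 ?subrr ?subr0.
Qed.

Lemma gf_true : 'X^N %| (C - 1) * (1 - H) - 'X * C ^+ 2 * D.
Proof.
apply/dvdXnP => -[|i] iN.
  rewrite coefB -mulrA coefXM /= subr0 coefM big_ord1 coef_tails //.
  by rewrite /nb_tails /= mul0r.
rewrite mulrBr mulr1 [_ * H]mulrC !coefB -mulrA coefXM /= coefM big_ord_recl.
have N0 : (0 < N)%N by apply: leq_trans iN.
have H0 : H`_0 = 0 by rewrite coef_gen.
rewrite H0 mul0r add0r.
rewrite -coefB coef_tails // /nb_tails /= nb_nets_true natrD.
have -> : (C ^+ 2 * D)`_i = (\sum_(i0 < i.+1)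
   (\sum_(j < i0.+1) nb_nets true j * nb_nets true (i0 - j)) *
   nb_nets false (i - i0))%N%:R.
  rewrite coefM natr_sum; apply: eq_bigr => j _; have ji := ltn_ord j.
  by rewrite natrM expr2 coef_genM ?coef_gen //; lia.
rewrite [X in _ - X - _](_ : _ = (\sum_(j < i.+1) nb_mixed j * nb_tails true (i - j))%N%:R).
  by rewrite addrK subrr.
rewrite natr_sum; apply: eq_bigr => j _; have ji := ltn_ord j.
by rewrite -[bump 0 j]/(j.+1)%N subSS coef_gen ?coef_tails ?natrM //; lia.
Qed.

Lemma gf_quadratic : 'X^N %| 2 *: H - 4 *: 'X - 3 *: H ^+ 2.
Proof.
(* Elimination of [C] and [D]: replacing [X C^2 D] by [C H / 2] gives [C (1 - 3 H / 2) = 1 - H];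
   multiplying by [2 X D] and using [D (1 - H) = 1] gives [H (1 - 3 H / 2) = 2 X]. *)
have -> : 2 *: H - 4 *: 'X - 3 *: H ^+ 2 =
  (2 * (1 - H) - H - 2 *: ('X * (C * D))) * (H - 2 *: ('X * (C * D))) +
  (4%:P * 'X * C - 4%:P * 'X * (C - 1)) * (D * (1 - H) - 1) +
  (4%:P * 'X * D) * ((C - 1) * (1 - H) - 'X * C ^+ 2 * D).
  rewrite -!mul_polyC; move: (C) (D) (H) => c d h; rewrite !polyC_natr; ring.
by rewrite !dvdp_add ?dvdp_mull ?gf_mixed ?gf_false ?gf_true.
Qed.

Lemma codes_convolution m : (1 < m < N)%N ->
  (2 * nb_codes m = 3 * \sum_(j < m.+1) nb_codes j * nb_codes (m - j))%N.
Proof.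
case/andP=> m1 mN; have /dvdXnP/(_ m mN) := gf_quadratic.
rewrite !coefB !coefZ coefX (_ : (m == 1)%N = false) ?mulr0 ?subr0; last by lia.
rewrite expr2 coef_genM // coef_gen // => /eqP; rewrite subr_eq0 -!natrM eqr_nat.
by move/eqP.
Qed.

Lemma codes_recurrence m : (0 < m)%N -> (m.+1 < N)%N ->
  (m.+1 * nb_codes m.+1 = 6 * (2 * m - 1) * nb_codes m)%N.
Proof.
move=> m0 mN; have /dvdpP[F EF] := gf_quadratic.
have [S defS] : exists S : {poly rat}, S = 1 - 3 *: H by eexists.
have [E defE] : exists E : {poly rat}, E = F * 'X^N by eexists.
have SS : S ^+ 2 = 1 - 12 *: 'X - 3 *: E.
  by rewrite defE -EF defS -!mul_polyC !polyC_natr; move: (H) => h; ring.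
have dE : 'X^(N.-1) %| E^`().
  rewrite defE; case: (N) mN => [|n] mN //; rewrite derivM derivXn /= dvdp_add //.
    by rewrite exprS mulrA dvdp_mull.
  by rewrite mulrnAr -mulrnAl dvdp_mull.
have dE' : 'X^(N.-1) %| E.
  by rewrite defE dvdp_mull // dvdp_exp2l // leq_pred.
have dS : 2 * (S * S^`()) = - 12%:P - 3 *: E^`().
  have := congr1 (@deriv _) SS; rewrite expr2 derivM !derivB !derivZ derivX -[1]/(1%:P) derivC.
  move=> e; transitivity (S^`() * S + S * S^`()); first by rewrite [S^`() * S]mulrC -mulr2n mulr_natl.
  by rewrite e -!mul_polyC !polyC_natr; ring.
(* For the exact series [W = 0] is the differential equation of [S]; its product with [S] follows
   from the equation for [S ^+ 2] and its derivative, which costs one order of precision. *)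
pose W := 2 * (S^`() * (1 - 12 *: 'X) + 6 *: S).
have : 'X^(N.-1) %| S * W.
  have -> : S * W = (- 3%:P * (1 - 12 *: 'X)) * E^`() + (- 36%:P) * E.
    have -> : S * W = 2 * (S * S^`()) * (1 - 12 *: 'X) + 12%:P * S ^+ 2.
      by rewrite /W -!mul_polyC !polyC_natr; ring.
    by rewrite dS SS -!mul_polyC !polyC_natr; ring.
  by rewrite dvdp_add ?dvdp_mull.
have S0 : S`_0 = 1.
  by rewrite defS coefB coefZ coef_gen ?mulr0 ?subr0 ?coef1 //; lia.
have SE i : (0 < i < N)%N -> S`_i = - 3 * (nb_codes i)%:R.
  move=> /andP[i0 iN]; rewrite defS coefB coefZ coef_gen // coef1 (negbTE (lt0n_neq0 i0)).
  by rewrite sub0r mulNr.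
(* [S] has constant term 1, so it is prime to ['X] and can be divided out. *)
rewrite Gauss_dvdpr; last first.
  apply: coprimep_expl; rewrite coprimep_sym -['X]subr0 -polyC0 coprimep_XsubC.
  by rewrite rootE horner_coef0 S0 oner_eq0.
case/dvdpP=> G /(congr1 (fun p : {poly rat} => p`_m)).
rewrite coefMXn (_ : (m < N.-1)%N); last by lia.
case: m m0 mN => // m _ mN; rewrite /W mulr_natl coefMn coefD mulrBr mulr1 coefB -scalerAr !coefZ.
rewrite coefMX /= !coef_deriv !SE; [|lia|lia].
move=> e; apply/eqP; rewrite -(eqr_nat rat) !natrM natrB; last by clear; lia.
rewrite natrM; apply/eqP; move: e; rewrite -(mulr_natr (_ * _) m.+2) -(mulr_natr (_ * _) m.+1).
rewrite -[m.+2%:R]natr1 -[m.+1%:R]natr1; clear.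
move: (m%:R) ((nb_codes m.+1)%:R) ((nb_codes m.+2)%:R) => x a b e.
lra.
Qed.

End GeneratingPolynomials.

Lemma nb_codes1 : nb_codes 1 = 2.
Proof. by rewrite /= /nb_mixed !big_ord1 !nb_nets0. Qed.

Lemma nb_codes_rec m : m.+2 * nb_codes m.+2 = 6 * (2 * m).+1 * nb_codes m.+1.
Proof.
rewrite (@codes_recurrence m.+3) // -[nb_codes _.+1]/(nb_codes m.+1).
by congr (_ * _ * _); lia.
Qed.

Lemma nb_codes_conv m : 1 < m ->
  2 * nb_codes m = 3 * \sum_(j < m.+1) nb_codes j * nb_codes (m - j).
Proof. by move=> m1; apply: (@codes_convolution m.+1); rewrite m1 leqnn. Qed.

Lemma central_bin_rec m : m.+1 * 'C(m.+1.*2, m.+1) = 2 * (2 * m).+1 * 'C(m.*2, m).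
Proof.
have e1 := mul_bin_diag m.*2.+1 m; have e2 := mul_bin_diag m.*2.+2 m.
have e3 : 'C(m.*2.+1, m.+1) = 'C(m.*2.+1, m) by rewrite -bin_sub; [congr 'C(_, _)|]; lia.
rewrite /= in e1 e2; rewrite doubleS -e2.
move: e1; rewrite e3; move: 'C(_, _) 'C(_, _) => a b; nia.
Qed.

Lemma nb_codes_bin m : m.+1 * nb_codes m.+1 = 2 * 3 ^ m * 'C(m.*2, m).
Proof.
elim: m => [|m IHm]; first by rewrite nb_codes1 bin0.
apply/eqP; rewrite -(eqn_pmul2l (ltn0Sn m)) nb_codes_rec; apply/eqP.
have := central_bin_rec m; rewrite expnS; move: IHm.
move: (nb_codes _) 'C(_, _) 'C(_, _) (3 ^ m) => a b c e IHm bc.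
have -> : m.+1 * (6 * (2 * m).+1 * a) = 6 * (2 * m).+1 * (m.+1 * a) by ring.
have -> : m.+1 * (2 * (3 * e) * b) = 6 * e * (m.+1 * b) by ring.
by rewrite IHm bc; ring.
Qed.

Lemma nb_codes_Cat (R : numFieldType) m :
  ((nb_codes m.+1)%:R = 2 * 3 ^+ m * Cat R m)%R.
Proof.
have := congr1 (fun n => n%:R : R)%R (nb_codes_bin m); rewrite !natrM natrX => e.
by rewrite /Cat mulrA -e [(_ * (nb_codes _)%:R)%R]mulrC mulfK ?pnatr_eq0.
Qed.

(** * Wallis' product and asymptotics *)

From mathcomp Require Import all_classical all_reals all_analysis.
Import numFieldNormedType.Exports.
Local Open Scope classical_set_scope.
Local Open Scope ring_scope.

Section Wallis.

Variable R : realType.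
Implicit Types (x : R) (n m : nat).

(* The primitive of [cos ^+ n] that vanishes at [0]. *)
Fixpoint cosX_prim n : R -> R :=
  match n with
  | 0 => id
  | 1 => @sin R
  | n'.+2 => fun x => (n'.+2%:R)^-1 * (sin x * cos x ^+ n'.+1 + n'.+1%:R * cosX_prim n' x)
  end.

Lemma is_derive_cosX_prim n x : is_derive x 1 (cosX_prim n) (cos x ^+ n).
Proof.
have [k] := ubnP n; elim: k n => // k IHk [|[|n]] nk; first by rewrite expr0; exact: is_derive_id.
  by rewrite expr1; apply: is_derive_sin.
have IH : is_derive x 1 (cosX_prim n) (cos x ^+ n) by apply: IHk; lia.
have -> : cosX_prim n.+2 = (n.+2%:R)^-1 *: (@sin R * (@cos R) ^+ n.+1 + n.+1%:R *: cosX_prim n).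
  by apply/funext => y; rewrite !fctE.
have D1 := is_deriveM (is_derive_sin x) (is_deriveX n.+1 (is_derive_cos x)).
have D := is_deriveZ (n.+2%:R)^-1 (is_deriveD D1 (is_deriveZ n.+1%:R IH)).
apply: (is_derive_eq D).
rewrite !fctE.
rewrite -![_ *: _]/(_ * _).
have s2 : sin x ^+ 2 = 1 - cos x ^+ 2 by rewrite -[1](cos2Dsin2 x) addrAC subrr add0r.
have -> : sin x * (n.+1%:R * cos x ^+ n * - sin x) = - (n.+1%:R * cos x ^+ n * sin x ^+ 2) by ring.
have : n.+1%:R + 1 != 0 :> R by rewrite natr1 pnatr_eq0.
rewrite s2 !exprS -(natr1 n.+1); move: (cos x ^+ n) (n.+1%:R) => c a a0; field.
exact: a0.
Qed.

Definition wallis n := cosX_prim n (pi / 2).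

Lemma wallis_rec n : wallis n.+2 = n.+1%:R / n.+2%:R * wallis n.
Proof. by rewrite /wallis /= cos_pihalf exprS mul0r mulr0 add0r mulrA [_^-1 * _]mulrC. Qed.

(** Hence [wallis n] is the integral of [cos ^+ n] over [[0, pi / 2]]. *)
Lemma cosX_prim0 n : cosX_prim n 0 = 0.
Proof.
have [k] := ubnP n; elim: k n => // k IHk [|[|n]] nk //; first exact: sin0.
by rewrite /= sin0 mul0r add0r IHk ?mulr0 //; lia.
Qed.

Lemma wallis_le n : wallis n.+1 <= wallis n.
Proof.
pose f : R -> R := cosX_prim n - cosX_prim n.+1.
have df x : is_derive x 1 f (cos x ^+ n - cos x ^+ n.+1).
  by apply: is_deriveB; apply: is_derive_cosX_prim.
have cf : continuous f by move=> x; apply/differentiable_continuous/derivable1_diffP; have [] := df x.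
have pi20 : 0 <= pi / 2 :> R by rewrite divr_ge0 // pi_ge0.
have := @ger0_derive1_le_cc R f 0 (pi / 2).
have h1 x : x \in `]0, pi / 2[%R -> derivable f x 1 by move=> _; have [] := df x.
have h2 x : x \in `]0, pi / 2[%R -> 0 <= derive1 f x.
  rewrite in_itv /= => /andP[x0 x1]; rewrite derive1E (@derive_val _ _ _ _ _ _ _ (df x)).
  rewrite subr_ge0 exprS ler_piMl ?cos_le1 // exprn_ge0 // cos_ge0_pihalf //.
  by rewrite (le_trans _ (ltW x0)) ?oppr_le0 //= ltW.
move=> /(_ h1 h2 (continuous_subspaceT cf) 0 (pi / 2)).
rewrite !in_itv /= !lexx pi20 /= => /(_ isT isT isT).
by rewrite /f !fctE !cosX_prim0 subrr subr_ge0.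
Qed.

End Wallis.

Section CentralBinomial.

Variable R : realType.
Implicit Types (n m : nat).

Definition wbin m : R := 'C(m.*2, m)%:R / 4 ^+ m.

Lemma wbin_gt0 m : 0 < wbin m.
Proof. by rewrite divr_gt0 ?exprn_gt0 // ltr0n bin_gt0; lia. Qed.

Lemma wbin_rec m : wbin m.+1 * (2 * m%:R + 2) = wbin m * (2 * m%:R + 1).
Proof.
have := congr1 (fun k => k%:R : R) (central_bin_rec m); rewrite /wbin !natrM exprS.
rewrite -[m.+1%:R]natr1 -[(2 * m).+1%:R]natr1 natrM.
have : 4 ^+ m != 0 :> R by rewrite expf_neq0.
move: (4 ^+ m) (m%:R) ('C(m.+1.*2, m.+1)%:R) ('C(m.*2, m)%:R) => e x a b e0 h.
have -> : a / (4 * e) * (2 * x + 2) = (x + 1) * a / (2 * e) by field.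
rewrite h; field; exact: e0.
Qed.

Lemma wallisE m : wallis R m.*2 = pi / 2 * wbin m /\ wallis R m.*2.+1 * ((2 * m%:R + 1) * wbin m) = 1.
Proof.
elim: m => [|m [IHe IHo]].
  by rewrite /wallis /= /wbin bin0 sin_pihalf expr0 divr1 mulr0 add0r !mulr1.
have wr := wbin_rec m; have w0 := wbin_gt0 m; have m0 : 0 <= m%:R :> R by rewrite ler0n.
have d2 : (m.*2)%:R = 2 * m%:R :> R by rewrite -muln2 natrM mulrC.
have d3 : (m.*2.+1)%:R = 2 * m%:R + 1 :> R by rewrite -addn1 natrD d2.
have d4 : (m.*2.+2)%:R = 2 * m%:R + 2 :> R by rewrite -addn2 natrD d2.
have d5 : (m.*2.+3)%:R = 2 * m%:R + 3 :> R by rewrite -addn3 natrD d2.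
rewrite doubleS !wallis_rec IHe d3 d4 d5 -[m.+1%:R]natr1; split.
  apply: (@mulIf _ (2 * m%:R + 2)); first by lra.
  by rewrite -[RHS]mulrA wr; field; lra.
move: IHo wr w0 m0; move: (wallis _ _) (wbin m) (wbin m.+1) (m%:R) => W w w' x IHo wr w0 x0.
have -> : (2 * x + 2) / (2 * x + 3) * W * ((2 * (x + 1) + 1) * w') =
  W * (w' * (2 * x + 2)) by field; lra.
by rewrite wr -[RHS]IHo; ring.
Qed.

(** Monotonicity of Wallis' integrals at the indices [2m, 2m + 1] and [2m + 1, 2m + 2], with the odd
    one eliminated by [wallisE]. *)
Lemma wbin_bounds m (p : R := pi * wbin m ^+ 2) :
  2 <= p * (2 * m%:R + 1) /\ p * (2 * m%:R + 1) ^+ 2 <= 4 * (m%:R + 1).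
Proof.
have [e1 o1] := wallisE m; have [e2 _] := wallisE m.+1.
have wr := wbin_rec m; have w0 := wbin_gt0 m; have m0 : 0 <= m%:R :> R by rewrite ler0n.
have h1 := wallis_le R m.*2; have h2 := wallis_le R m.*2.+1.
rewrite -doubleS e2 in h2; rewrite e1 in h1.
have p0 : 0 < pi :> R := pi_gt0 R.
rewrite /p; move: o1 h1 h2 wr w0 m0 p0; clear.
move: (wallis _ _) (wbin m) (wbin m.+1) (m%:R) (pi : R) => W w w' x q o1 h1 h2 wr w0 x0 q0.
have k0 : 0 < (2 * x + 1) * w by rewrite mulr_gt0 //; lra.
split.
  have := ler_wpM2r (ltW k0) h1; rewrite o1.
  have -> : q / 2 * w * ((2 * x + 1) * w) = q * w ^+ 2 * (2 * x + 1) / 2 by field.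
  by lra.
have w'E : w' = w * (2 * x + 1) / (2 * x + 2) by rewrite -wr mulfK //; lra.
have := ler_wpM2r (ltW k0) h2; rewrite o1 w'E.
have -> : q / 2 * (w * (2 * x + 1) / (2 * x + 2)) * ((2 * x + 1) * w) =
  q * w ^+ 2 * (2 * x + 1) ^+ 2 / (4 * (x + 1)) by field; lra.
by rewrite ler_pdivrMr ?mul1r //; lra.
Qed.

Definition asym n : R := (72 * Num.sqrt pi)^-1 * (12 ^+ n / n%:R `^ (3 / 2)).

Lemma asym_gt0 n : (0 < n)%N -> 0 < asym n.
Proof.
move=> n0; apply: mulr_gt0; first by rewrite invr_gt0 mulr_gt0 ?sqrtr_gt0 ?pi_gt0.
by apply: divr_gt0; [apply: exprn_gt0 | apply: powR_gt0; rewrite ltr0n].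
Qed.

Lemma sqr_asym n : (0 < n)%N -> asym n ^+ 2 = 144 ^+ n / (5184 * pi * n%:R ^+ 3).
Proof.
move=> n0; have pw : (n%:R `^ (3 / 2)) ^+ 2 = n%:R ^+ 3 :> R.
  rewrite -powR_mulrn ?powR_ge0 // -powRrM -(@powR_mulrn _ _ 3) ?ler0n //.
  by congr (_ `^ _); field.
rewrite /asym exprMn exprVn exprMn sqr_sqrtr ?pi_ge0 // expr_div_n pw -exprM mulnC exprM.
have -> : 12 ^+ 2 = 144 :> R by ring.
have q0 := pi_gt0 R; have : n%:R ^+ 3 != 0 :> R by rewrite expf_neq0 // pnatr_eq0; lia.
move: (n%:R ^+ 3) (144 ^+ n) (pi : R) q0 => b a q q0 b0; field.
by rewrite b0 gt_eqF.
Qed.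

Lemma sqr_nb_codes m : (nb_codes m.+1)%:R ^+ 2 = 4 * 144 ^+ m * wbin m ^+ 2 / (m%:R + 1) ^+ 2 :> R.
Proof.
rewrite nb_codes_Cat /Cat /wbin -[m.+1%:R]natr1.
have -> : 144 ^+ m = (3 ^+ m) ^+ 2 * (4 ^+ m) ^+ 2 :> R.
  by rewrite -!exprM ![(m * 2)%N]mulnC !exprM -exprMn; congr (_ ^+ _); ring.
have : 4 ^+ m != 0 :> R by rewrite expf_neq0.
have : m%:R + 1 != 0 :> R by rewrite natr1 pnatr_eq0.
move: (m%:R) (3 ^+ m) (4 ^+ m) ('C(_, _)%:R) => x a b c x0 b0; field.
by rewrite x0 b0.
Qed.

(** Compared through squares, which remove the square root of [pi] and the exponent [3 / 2]. The
    squared ratio is [p (m + 2)^3 / (m + 1)^2], and [wbin_bounds] shows that it tends to 1. *)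
Lemma nb_codes_bounds m : (0 < m)%N ->
  asym m.+2 <= (nb_codes m.+1)%:R <= (1 + 12 / (m%:R + 1)) * asym m.+2.
Proof.
move=> m0; have [lo hi] := wbin_bounds m; have x1 : 1 <= m%:R :> R by rewrite ler1n.
have q0 := pi_gt0 R; have a0 := asym_gt0 (ltn0Sn m.+1).
have aE := sqr_asym (ltn0Sn m.+1); have uE := sqr_nb_codes m.
have w0 := wbin_gt0 m; have k0 : 0 < 144 ^+ m :> R by rewrite exprn_gt0.
have u0 : 0 <= (nb_codes m.+1)%:R :> R by rewrite ler0n.
have aE' : asym m.+2 ^+ 2 = 4 * 144 ^+ m / (pi * (m%:R + 2) ^+ 3).
  rewrite aE !exprS -[m.+2%:R]natr1 -[m.+1%:R]natr1 -addrA (_ : 1 + 1 = 2) //.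
  move: x1 q0; clear; move: (m%:R) (144 ^+ m) (pi : R) => x k q x1 q0; field.
  by apply/andP; split; lra.
have d0 : 0 <= 12 / (m%:R + 1) :> R by rewrite divr_ge0 //; lra.
move: lo hi x1 q0 a0 uE w0 k0 u0 aE' d0; clear.
move: (m%:R) (144 ^+ m) (pi : R) (wbin m) (asym _) ((nb_codes _)%:R) => x k q w a u.
move=> lo hi x1 q0 a0 uE w0 k0 u0 aE d0.
have qx : 0 < q * (x + 2) ^+ 3 by rewrite mulr_gt0 // exprn_gt0; lra.
have x1' : 0 < (x + 1) ^+ 2 by rewrite exprn_gt0; lra.
set p := q * w ^+ 2 in lo hi.
have p0 : 0 < p by rewrite mulr_gt0 ?exprn_gt0.
have ratio : u ^+ 2 = a ^+ 2 * (p * (x + 2) ^+ 3 / (x + 1) ^+ 2).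
  by rewrite uE aE /p; field; apply/and3P; split; lra.
have r1 : 1 <= p * (x + 2) ^+ 3 / (x + 1) ^+ 2.
  rewrite ler_pdivlMr // mul1r; have x2 : 0 <= x ^+ 2 by rewrite sqr_ge0.
  have h : (2 * x + 1) * (x + 1) ^+ 2 / 2 <= (x + 2) ^+ 3 by lra.
  apply: le_trans (ler_wpM2l (ltW p0) h).
  by have := ler_wpM2r (ltW x1') lo; lra.
(* The constant 12 is a convenient one making [4 (x + 2)^3 <= (x + 13) (2 x + 1)^2] true for
   [x >= 1]. *)
have r2 : p * (x + 2) ^+ 3 / (x + 1) ^+ 2 <= 1 + 12 / (x + 1).
  have -> : 1 + 12 / (x + 1) = (x + 13) * (x + 1) / (x + 1) ^+ 2 by field; lra.
  rewrite ler_pM2r ?invr_gt0 //.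
  have x2 : 0 < (2 * x + 1) ^+ 2 by rewrite exprn_gt0; lra.
  rewrite -(ler_pM2r x2); have x3 : 1 <= x ^+ 2 := exprn_ege1 2 x1.
  have h : 4 * (x + 2) ^+ 3 <= (x + 13) * (2 * x + 1) ^+ 2 by lra.
  have x0 : 0 <= x + 1 by lra.
  have h2 : 0 <= (x + 2) ^+ 3 by rewrite exprn_ge0; lra.
  by have := ler_wpM2l x0 h; have := ler_wpM2r h2 hi; lra.
apply/andP; split.
  by rewrite -(@ler_pXn2r _ 2) ?nnegrE ?(ltW a0) // ratio ler_peMr // exprn_ge0 ?ltW.
rewrite -(@ler_pXn2r _ 2) ?nnegrE ?mulr_ge0 ?(ltW a0) //; last by lra.
rewrite ratio exprMn mulrC ler_wpM2r ?exprn_ge0 ?(ltW a0) //.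
(* The bound on the squared ratio exceeds 1, so it is at most its own square. *)
by apply: (le_trans r2); rewrite expr2 ler_peMl //; lra.
Qed.

End CentralBinomial.

(** * The generating function *)

Section GeneratingFunction.

Variable R : realType.
Implicit Types (n m N : nat) (z : R).

Definition scaled m : R := (nb_codes m)%:R / 12 ^+ m.

Lemma scaled_ge0 m : 0 <= scaled m.
Proof. by rewrite divr_ge0 ?exprn_ge0. Qed.

(** The recurrence makes the partial sums telescope at [z = 1 / 12], where the square root vanishes
    and the limit is [1 / 3]. *)
Lemma sum_scaled m : \sum_(i < m.+2) scaled i = 3^-1 - (2 * m%:R + 1) * scaled m.+1.
Proof.
elim: m => [|m IHm].
  rewrite !big_ord_recr big_ord0 /= /scaled [nb_codes 1]nb_codes1 expr1 /= mul0r !add0r mulr0 add0r.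
  by field.
rewrite big_ord_recr IHm /= /scaled.
have := congr1 (fun k => k%:R : R) (nb_codes_rec m); rewrite !natrM.
rewrite -[(2 * m).+1%:R]natr1 -[m.+2%:R]natr1 -[m.+1%:R]natr1 natrM [12 ^+ m.+2]exprS.
have : 12 ^+ m.+1 != 0 :> R by rewrite expf_neq0.
move: (12 ^+ m.+1) (m%:R) ((nb_codes m.+1)%:R) ((nb_codes m.+2)%:R) => e x a b e0 h.
have hb : (2 * x + 1) * a = (x + 1 + 1) * b / 6 by rewrite h; field.
rewrite [(2 * x + 1) * (a / e)]mulrA hb; field; exact: e0.
Qed.

Lemma sum_scaled_le N : \sum_(i < N) scaled i <= 3^-1.
Proof.
apply: (@le_trans _ _ (\sum_(i < N.+2) scaled i)).
  by rewrite 2!big_ord_recr /= -addrA lerDl addr_ge0 ?scaled_ge0.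
by rewrite sum_scaled gerBl mulr_ge0 ?scaled_ge0 // addr_ge0 ?mulr_ge0.
Qed.

Definition gpoly N : {poly R} := \poly_(i < N) (nb_codes i)%:R.

Lemma gpolyE N z : (gpoly N).[z] = \sum_(i < N) (nb_codes i)%:R * z ^+ i.
Proof. exact: horner_poly. Qed.

Lemma scaledM z i : (nb_codes i)%:R * z ^+ i = scaled i * (12 * z) ^+ i.
Proof. by rewrite /scaled exprMn; field; rewrite expf_neq0. Qed.

(** Keeps [1 - 3 H] nonnegative, which later selects the branch of the square root. *)
Lemma gpoly_le N z : `|12 * z| < 1 -> (gpoly N).[z] <= 3^-1.
Proof.
move=> z1; apply: le_trans (sum_scaled_le N); rewrite gpolyE; apply: ler_sum => i _.
rewrite scaledM ler_piMr ?scaled_ge0 // (le_trans (ler_norm _)) // normrX.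
by rewrite exprn_ile1 // ltW.
Qed.

Lemma gpoly_12 N : (gpoly N).[12^-1] = \sum_(i < N) scaled i.
Proof.
rewrite gpolyE; apply: eq_bigr => i _; rewrite scaledM mulfV ?expr1n ?mulr1 //.
Qed.

(** Truncation leaves only terms of degree at least [N], all coming from the square; their
    coefficients are nonnegative and controlled by the value of the square at [1 / 12]. *)
Lemma gpoly_quadratic N z : (1 < N)%N -> `|12 * z| < 1 ->
  `|2 * (gpoly N).[z] - 4 * z - 3 * (gpoly N).[z] ^+ 2| <= 3 * `|12 * z| ^+ N.
Proof.
move=> N1 z1; pose P := gpoly N; pose Q : {poly R} := 2 *: P - 4 *: 'X - 3 *: P ^+ 2.
have P2_ge0 i : 0 <= (P ^+ 2)`_i.
  rewrite expr2 coefM sumr_ge0 // => j _; rewrite /P !coef_poly.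
  by apply: mulr_ge0; case: ifP.
have coefP i : (i < N)%N -> P`_i = (nb_codes i)%:R by move=> iN; rewrite coef_poly iN.
have QL i : (i < N)%N -> Q`_i = 0.
  move=> iN; have e : (P ^+ 2)`_i = (\sum_(j < i.+1) nb_codes j * nb_codes (i - j))%N%:R.
    rewrite expr2 coefM natr_sum; apply: eq_bigr => j _; have ji := ltn_ord j.
    by rewrite !coefP ?natrM //; lia.
  rewrite /Q !coefB !coefZ coefX e coefP //; case: i iN e => [|[|i]] iN e.
  - by rewrite big_ord1 !mulr0 !subr0.
  - by rewrite nb_codes1 !big_ord_recr big_ord0 /= !mul0n !muln0 mulr0 subr0 mulr1 -natrM subrr.
  rewrite mulr0 subr0 -!natrM (nb_codes_conv (isT : 1 < i.+2)%N) subrr //.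
have QH i : (N <= i)%N -> `|Q`_i| = 3 * (P ^+ 2)`_i.
  move=> Ni; rewrite /Q !coefB !coefZ coefX [P`_i]coef_poly ltnNge Ni /= mulr0 sub0r.
  rewrite (_ : (i == 1)%N = false) ?mulr0 ?oppr0 ?sub0r ?normrN; last by lia.
  by rewrite ger0_norm // mulr_ge0.
have -> : 2 * P.[z] - 4 * z - 3 * P.[z] ^+ 2 = Q.[z].
  by rewrite /Q !hornerE.
(* One summation range wide enough for both [Q] and [P ^+ 2]. *)
have sQ : (size Q <= size Q + N + N)%N by lia.
rewrite (horner_coef_wide z sQ) (le_trans (ler_norm_sum _ _ _)) //.
apply: (@le_trans _ _ (\sum_(i < size Q + N + N) 3 * `|12 * z| ^+ N * ((P ^+ 2)`_i * 12^-1 ^+ i))).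
  apply: ler_sum => i _; have [iN|Ni] := ltnP i N.
    by rewrite QL // mul0r normr0 !mulr_ge0 ?exprn_ge0.
  rewrite normrM QH // normrX -!mulrA ler_pM2l // mulrCA ler_wpM2l //.
  have -> : `|z| ^+ i = `|12 * z| ^+ i * 12^-1 ^+ i.
    by rewrite -exprMn normrM ger0_norm // mulrAC mulfV ?mul1r.
  by rewrite ler_wpM2r ?exprn_ge0 // ler_wiXn2l // ltW.
rewrite -mulr_sumr ler_piMr ?mulr_ge0 ?exprn_ge0 //.
have sP : (size (P ^+ 2) <= size Q + N + N)%N.
  rewrite (leq_trans (size_polyMleq _ _)) // (leq_trans (leq_pred _)) //.
  by have := size_poly N (fun i => (nb_codes i)%:R : R); rewrite -/(gpoly N) -/P; lia.
rewrite -(horner_coef_wide _ sP) horner_exp gpoly_12.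
have s0 : 0 <= \sum_(i < N) scaled i by rewrite sumr_ge0 // => i _; rewrite scaled_ge0.
rewrite exprn_ile1 // (le_trans (sum_scaled_le N)) // invf_le1 //; lra.
Qed.

(** The squares of [1 - 3 H] converge by the approximate quadratic equation; nonnegativity and
    continuity of the square root give the limit itself, without a separate convergence argument for
    the series. *)
Lemma gpoly_cvg z : `|z| < 12^-1 ->
  (gpoly N).[z] @[N --> \oo] --> (1 - Num.sqrt (1 - 12 * z)) / 3.
Proof.
move=> z12; have z1 : `|12 * z| < 1.
  by rewrite normrM ger0_norm // -[X in _ < X](@mulfV _ 12) // ltr_pM2l.
pose S N := 1 - 3 * (gpoly N).[z].
have S0 N : 0 <= S N by have := gpoly_le N z1; rewrite /S; lra.
have SE N : (1 < N)%N -> `|(1 - 12 * z) - S N ^+ 2| <= 9 * `|12 * z| ^+ N.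
  move=> N1; have := gpoly_quadratic N1 z1; rewrite /S; move: (_.[z]) => p h.
  have -> : 1 - 12 * z - (1 - 3 * p) ^+ 2 = 3 * (2 * p - 4 * z - 3 * p ^+ 2) by ring.
  by rewrite normrM ger0_norm //; lra.
have cS2 : S N ^+ 2 @[N --> \oo] --> 1 - 12 * z.
  apply/cvgrPdist_le => e e0.
  have : (9 * `|12 * z| ^+ N) @[N --> \oo] --> (0 : R).
    rewrite -[0](mulr0 9); apply: cvgMr; apply: cvg_expr; by rewrite normr_id.
  move/cvgrPdist_le => /(_ _ e0) near9; near=> N.
  apply: (le_trans (SE N _)); first by near: N; exists 2%N.
  have : `|0 - 9 * `|12 * z| ^+ N| <= e by near: N; apply: near9.
  by rewrite sub0r normrN; apply: le_trans; apply: ler_norm.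
have cS : S N @[N --> \oo] --> Num.sqrt (1 - 12 * z).
  have -> : S = fun N => Num.sqrt (S N ^+ 2).
    by apply/funext => N; rewrite sqrtr_sqr ger0_norm.
  by apply: continuous_cvg => //; apply: sqrt_continuous.
have -> : (fun N => (gpoly N).[z]) = (fun N => (1 - S N) / 3).
  by apply/funext => N; rewrite /S; field.
by apply: cvgMl; apply: cvgB => //; apply: cvg_cst.
Unshelve. all: by end_near.
Qed.

End GeneratingFunction.

Lemma cardHP n : (1 < n)%N -> Hset_has_card n (cardH n) /\ cardH n = nb_codes n.-1.
Proof.
move=> n1; have n0 : (0 < n)%N by lia.
have h : Hset_has_card n (cardH n).
  by apply: (@xgetPex _ 0%N); exists (size (codes n.-1)); apply/Hset_cardP.
split=> //; rewrite ((Hset_cardP _ n0).1 h).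
by case: n n1 {n0 h} => [|[|n]] // _; rewrite size_codes.
Qed.

Theorem proposition37 (R : realType) :
  [/\ (forall z : R, `|z| < 12^-1 ->
         \sum_(2 <= n < N) (cardH n)%:R * z ^+ n.-1 @[N --> \oo]
           --> (1 - Num.sqrt (1 - 12 * z)) / 3),
      [/\ cardH 2 = 2%N, cardH 3 = 6%N & cardH 4 = 36%N],
      (forall n : nat, (2 <= n)%N ->
         Hset_has_card n (cardH n) /\
         (cardH n)%:R = 2 * 3 ^+ (n - 2) * Cat R (n - 2)) &
      (fun n : nat => (cardH n)%:R : R) ~_\oo
        (fun n : nat => (72 * Num.sqrt pi)^-1 * (12 ^+ n / n%:R `^ (3 / 2)))].
Proof.
have cE n : cardH n.+2 = nb_codes n.+1 by rewrite (cardHP (isT : 1 < n.+2)%N).2.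
split.
(* As [nb_codes 0 = 0], the sum over [2 <= n < N + 2] is the value of [gpoly R (N + 1)]. *)
- move=> z z12; rewrite -(cvg_shiftn 2).
  have -> : (fun N => \sum_(2 <= n < N + 2) (cardH n)%:R * z ^+ n.-1) =
      (fun N => (gpoly R (N + 1)).[z]).
    apply/funext => N; rewrite gpolyE addn1 addn2 big_ord_recl /= mul0r add0r.
    rewrite -{1}[2%N]add0n -[N.+2]addn2 big_addn addnK big_mkord.
    by apply: eq_bigr => i _; rewrite addn2 cE.
  exact: (cvg_comp _ _ (cvg_addnr 1) (gpoly_cvg z12)).
- have c := nb_codes_bin; rewrite !cE; split; first by have := c 0%N; rewrite bin0; lia.
    by have := c 1%N; rewrite (_ : 'C(1.*2, 1) = 2%N) //; lia.
  by have := c 2%N; rewrite (_ : 'C(2.*2, 2) = 6%N) //; lia.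
- move=> [|[|n]] // n2; split; first exact: (cardHP n2).1.
  by rewrite cE nb_codes_Cat !subSS subn0.
apply/eqaddoP => _/posnumP[e]; near=> n.
rewrite !fctE -/(asym R n).
(* The relative error [12 / (m + 1)] is at most [e] as soon as [m + 1] reaches [12 / e]. *)
have [m [-> m0 me]] : exists m, [/\ n = m.+2, (0 < m)%N & 12 / e%:num <= m%:R + 1 :> R].
  exists (n - 2)%N; split.
  - by rewrite -addn2 subnK //; near: n; exists 2%N.
  - by rewrite subn_gt0; near: n; exists 3%N.
  near: n; exists (Num.truncn (12 / e%:num : R) + 3)%N => // k /= kn.
  have := truncnS_gt (12 / e%:num : R).
  move/ltW/le_trans; apply; rewrite natr1 ler_nat; move: kn; clear.
  by move: (Num.truncn _) => q; lia.
have /andP[lo hi] := nb_codes_bounds R m0; have a0 := asym_gt0 R (ltn0Sn m.+1).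
rewrite cE ger0_norm ?subr_ge0 // gtr0_norm // lerBlDl; apply: le_trans hi _.
rewrite mulrDl mul1r lerD2l ler_pM2r // ler_pdivrMr; last by rewrite natr1 ltr0n.
by move: me; rewrite ler_pdivrMr // mulrC.
Unshelve. all: by end_near.
Qed.
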